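(* Let $m>0$ and let $\Sigma$ be a spacelike surface in Region I (i.e. $r>2m$) of the Kruskal extension of Schwarzschild spacetime with constant mean curvature $H$ with respect to the future directed unit normal, which is the graph $t=u(\eta,\mathbf y)$ of a bounded function $u$, where $\eta=\left(1-\frac{2m}{r}\right)^{\frac12}$ and $\mathbf y\in\mathbb S^2$. Assume that $\Sigma$ can be extended to be a smooth spacelike surface near $T=X=0$ so that $T$ is a smooth function of $X,\mathbf y$ on it. Then all derivatives of $u$ at $\eta=0$ can be expressed in terms of the derivatives of $u|_{\eta=0}$ with respect to $\mathbb S^2$. Moreover, at $\eta=0$, $$\partial_\eta u=24m^2H.$$
   Context: $\mathbb S^2$ is the unit sphere with standard metric $\sigma$. The Kruskal extension has coordinates $(T,X,\mathbf y)$ and metric $\frac{32m^3}{r}\exp(-\frac r{2m})(-dT^2+dX^2)+r^2\sigma$, where $r=r(T,X)$ is given by $X^2-T^2=(\frac r{2m}-1)\exp(\frac r{2m})$. Region I is $X>0$, $X^2-T^2>0$ (so $r>2m$); there the metric is $g_{\mathrm{Sch}}=-(1-\frac{2m}r)dt^2+(1-\frac{2m}r)^{-1}dr^2+r^2\sigma$ with $T=(\frac r{2m}-1)^{1/2}e^{r/4m}\sinh\frac t{4m}$, $X=(\frac r{2m}-1)^{1/2}e^{r/4m}\cosh\frac t{4m}$, and $\partial_t$ is future directed. Mean curvature is one third of the trace of the second fundamental form, $H=\frac13\mathrm{div}\,\mathbf n$ with $\mathbf n$ the future directed unit normal. Under the stated assumption, $u$ is smooth up to $\eta=0$ as a function of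 $(\eta,\mathbf y)$. The expressions may also involve the constants $m$ and $H$. *)

(* Defs.v *)
From HB Require Import structures.
From mathcomp Require Import all_boot all_order all_algebra.
From mathcomp Require Import all_classical all_reals all_analysis.

Set Implicit Arguments.
Unset Strict Implicit.
Unset Printing Implicit Defensive.

Import Order.TTheory GRing.Theory Num.Theory.
Import numFieldNormedType.Exports.

Local Open Scope classical_set_scope.
Local Open Scope ring_scope.

Section Smoothness.
Variables (R : realType) (V : normedModType R).

(* Meant for open A. *)
Fixpoint C_k (k : nat) (A : set V) (f : V -> R) : Prop :=
  match k with
  | 0%N => forall x, A x -> {for x, continuous f}
  | k'.+1 => (forall x, A x -> differentiable f x) /\
             (forall v, C_k k' A (fun x => 'D_v f x))
  end.

Definition smooth_on (A : set V) (f : V -> R) : Prop := forall k, C_k k A f.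

End Smoothness.

(* S^2 is the Euclidean unit sphere of R^3 (the norm `|x| of the library is the
   sup norm), with tangent spaces y^perp and sigma the restricted dot product.
   A function on S^2 is a function on 'rV_3 of which only the values on S^2
   matter; it is differentiated through its 0-homogeneous extension to
   R^3 minus the origin. *)
Section Sphere.
Variable R : realType.
Implicit Types (x y v w : 'rV[R]_3) (i : 'I_3).

Definition dot v w : R := (v *m w^T) 0 0.
Definition enorm x : R := Num.sqrt (dot x x).
Definition sphere : set 'rV[R]_3 := [set y | dot y y = 1].
Definition sproj x : 'rV[R]_3 := (enorm x)^-1 *: x.

(* On S^2 this is the i-th Cartesian component of the sigma-gradient of f.
   In particular these components determine df, and the iterates [sph_derivs]
   of order at most n determine the n-jet of f at each point. *)
Definition sph_deriv i (f : 'rV[R]_3 -> R) : 'rV[R]_3 -> R :=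
  fun y => 'D_(delta_mx 0 i) (f \o sproj) y.

Definition sph_derivs (s : seq 'I_3) (f : 'rV[R]_3 -> R) : 'rV[R]_3 -> R :=
  foldr sph_deriv f s.

(* Expressions in finitely many derivatives of a function on S^2. *)
Inductive sph_expr : Type :=
  | SphConst of R
  | SphDeriv of seq 'I_3
  | SphAdd of sph_expr & sph_expr
  | SphMul of sph_expr & sph_expr.

Fixpoint sph_eval (e : sph_expr) (f : 'rV[R]_3 -> R) y : R :=
  match e with
  | SphConst c => c
  | SphDeriv s => sph_derivs s f y
  | SphAdd e1 e2 => sph_eval e1 f y + sph_eval e2 f y
  | SphMul e1 e2 => sph_eval e1 f y * sph_eval e2 f y
  end.

(* Points and tangent vectors of R x R^3. *)
Definition pair_mx (s : R) x : 'rV[R]_(1 + 3) := row_mx s%:M x.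

(* A function on an interval times S^2, read on R x (R^3 minus 0). *)
Definition cyl (f : R -> 'rV[R]_3 -> R) (p : 'rV[R]_(1 + 3)) : R :=
  f (lsubmx p 0 0) (sproj (rsubmx p)).

Definition smooth_cyl (a b : R) (f : R -> 'rV[R]_3 -> R) : Prop :=
  smooth_on [set p : 'rV[R]_(1 + 3) | a < lsubmx p 0 0 < b /\ rsubmx p != 0]
    (cyl f).

End Sphere.

Section Geometry.
Variable R : realType.
Implicit Types (m r t : R) (x y v w : 'rV[R]_3) (p : 'rV[R]_(1 + 3)).

Definition pairing (G : 'M[R]_(1 + 3)) (a b : 'rV[R]_(1 + 3)) : R :=
  (a *m G *m b^T) 0 0.

(* Divergence of the vector field X for the metric G in coordinates. *)
Definition divergence (G : 'rV[R]_(1 + 3) -> 'M[R]_(1 + 3))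
    (X : 'rV[R]_(1 + 3) -> 'rV[R]_(1 + 3)) p : R :=
  let vol q := Num.sqrt `|\det (G q)| in
  (vol p)^-1 *
  \sum_(mu < 1 + 3) 'D_(delta_mx 0 mu) (fun q => vol q * X q 0 mu) p.

(* The Schwarzschild metric in the global coordinates (t, x) of Region I,
   x = r y with y in S^2, so that r = |x|, dr = (x . dx) / r and
   r^2 sigma = |dx|^2 - dr^2. *)
Definition schwarzschild m p : 'M[R]_(1 + 3) :=
  let x := rsubmx p in
  let r := enorm x in
  let f := 1 - 2 * m / r in
  block_mx (- f)%:M 0
           0 (1%:M + ((f^-1 - 1) / r ^+ 2) *: (x^T *m x)).

Definition eta m r : R := Num.sqrt (1 - 2 * m / r).

(* u is a function of (eta, y) with 0 < eta < eta0 and y in S^2; in the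
   coordinates (t, x) its graph is t = height m u x, for x in base m eta0. *)
Definition base m (eta0 : R) : set 'rV[R]_3 :=
  [set x | 2 * m < enorm x /\ eta m (enorm x) < eta0].

Definition height m (u : R -> 'rV[R]_3 -> R) x : R :=
  u (eta m (enorm x)) (sproj x).

Definition graph_tangent m (u : R -> 'rV[R]_3 -> R) x w : 'rV[R]_(1 + 3) :=
  pair_mx ('D_w (height m u) x) w.

Definition bounded_height (eta0 : R) (u : R -> 'rV[R]_3 -> R) : Prop :=
  exists M : R, forall s y, 0 < s < eta0 -> sphere y -> `|u s y| <= M.

Definition spacelike_graph m (eta0 : R) (u : R -> 'rV[R]_3 -> R) : Prop :=
  forall x w, base m eta0 x -> w != 0 ->
    0 < pairing (schwarzschild m (pair_mx (height m u x) x))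
          (graph_tangent m u x w) (graph_tangent m u x w).

(* At (t, x) the field n is the unit normal of the time translate of the graph
   through (t, x): this extends the normal of the graph to a unit field, so its
   divergence on the graph is the trace of the second fundamental form. *)
Definition future_unit_normal m (eta0 : R) (u : R -> 'rV[R]_3 -> R)
    (n : 'rV[R]_(1 + 3) -> 'rV[R]_(1 + 3)) : Prop :=
  forall t x, base m eta0 x ->
    let p := pair_mx t x in
    [/\ pairing (schwarzschild m p) (n p) (n p) = -1,
        forall w, pairing (schwarzschild m p) (n p) (graph_tangent m u x w) = 0
      & 0 < lsubmx (n p) 0 0].

Definition has_mean_curvature m (eta0 : R) (u : R -> 'rV[R]_3 -> R) (H : R)
    : Prop :=
  exists2 n, future_unit_normal m eta0 u n &
    forall x, base m eta0 x ->
      3^-1 * divergence (schwarzschild m) n (pair_mx (height m u x) x) = H.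

Definition sinh (z : R) : R := (expR z - expR (- z)) / 2.
Definition cosh (z : R) : R := (expR z + expR (- z)) / 2.

Definition kruskal_T m r t : R :=
  Num.sqrt (r / (2 * m) - 1) * expR (r / (4 * m)) * sinh (t / (4 * m)).
Definition kruskal_X m r t : R :=
  Num.sqrt (r / (2 * m) - 1) * expR (r / (4 * m)) * cosh (t / (4 * m)).

Definition kruskal_radius m (T X r : R) : Prop :=
  0 < r /\ X ^+ 2 - T ^+ 2 = (r / (2 * m) - 1) * expR (r / (2 * m)).

(* Kruskal metric, at a point of radius r, on the vector (a, b, v) in
   coordinates (T, X, y). *)
Definition kruskal_form m r (a b : R) v : R :=
  32 * m ^+ 3 / r * expR (- (r / (2 * m))) * (- a ^+ 2 + b ^+ 2)
  + r ^+ 2 * dot v v.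

(* The graph T = F(X, y), |X| < delta, lies in the Kruskal extension and is
   spacelike. *)
Definition kruskal_spacelike m (delta : R) (F : R -> 'rV[R]_3 -> R) : Prop :=
  forall X y, - delta < X < delta -> sphere y ->
    exists2 r, kruskal_radius m (F X y) X r &
      forall (b : R) v, dot v y = 0 -> (b != 0) || (v != 0) ->
        0 < kruskal_form m r
              ('D_(pair_mx b v) (cyl F) (pair_mx X y)) b v.

Definition extends_across_bifurcation m (eta0 : R) (u : R -> 'rV[R]_3 -> R)
    : Prop :=
  exists (delta : R) (F : R -> 'rV[R]_3 -> R),
    [/\ 0 < delta, smooth_cyl (- delta) delta F, kruskal_spacelike m delta F
      & forall x, base m eta0 x ->
          let T := kruskal_T m (enorm x) (height m u x) in
          let X := kruskal_X m (enorm x) (height m u x) in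
          X < delta -> T = F X (sproj x)].

(* v is a smooth extension of u past eta = 0. *)
Definition smooth_extension (eta0 : R) (u v : R -> 'rV[R]_3 -> R) : Prop :=
  exists eps : R,
    [/\ 0 < eps <= eta0, smooth_cyl (- eps) eps v
      & forall s y, 0 < s < eps -> sphere y -> v s y = u s y].

End Geometry.

(* Main.v *)
Require Import Defs.
From mathcomp Require Import all_boot all_order all_algebra.
From mathcomp Require Import all_classical all_reals all_analysis.
From mathcomp Require Import ring lra.
Import Order.TTheory GRing.Theory Num.Theory.
Import numFieldNormedType.Exports.
Local Open Scope classical_set_scope.
Local Open Scope ring_scope.

(** Write s for the variable eta.

    Extension across s = 0. Near the bifurcation sphere the surface is
    T = F(X, y). In terms of s one has T = A(s) sinh tau and X = A(s) cosh tau
    with tau = u / 4m, and A = [kruskal_amp] is a smooth odd function of s, |s| < 1.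
    Since u is bounded, letting s tend to 0 gives F(0, y) = 0, so F = X G with G
    smooth ([hadamard_cyl]), and also that |G(0, y)| is at most some tanh M0 < 1.
    Dividing T = X G by A(s), tau becomes a zero of
    sinh tau - cosh tau * G(A(s) cosh tau, y), an expression that is smooth
    across s = 0 and, for s small, strictly increasing in tau on a fixed
    interval. The implicit function theorem ([smooth_implicit]) makes the zero
    smooth in (s, y) for s on both sides of 0; for s > 0 it is u / 4m. This is
    [smooth_extension_exists].

    The equation. In the coordinates (t, x) the Schwarzschild metric has
    determinant -1, so the divergence of the unit normal is a sum of partial
    derivatives. With w = (1 - s^2) / 2m = 1 / r, with d_i the sphere derivatives
    and W = 1 - s^2 (m^2 w^4 u_s^2 + w^2 sum_i (d_i u)^2), constant mean curvature
    H means ([cmc_pde])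

      W (m^2 w^4 (s u_ss + 2 u_s) + s w^2 sum_i d_i d_i u)
        - (s / 2) (m^2 w^4 u_s W_s + w^2 sum_i d_i W d_i u) = 3 H W^(3/2).

    At s = 0 only the term in u_s remains, and it reads u_s / (8 m^2) = 3 H:
    this is the value 24 m^2 H ([boundary_slope]).

    The derivatives at s = 0. The equation is singular at s = 0, of Fuchsian type:
    the k-th derivative of s u_ss + 2 u_s at s = 0 is (k + 2) times the derivative
    of u of order k + 1, while all other terms, thanks to their factors s, only
    involve derivatives of u of lower order. So the equation differentiated k
    times at s = 0 gives the derivative of order k + 1 in terms of lower ones and
    of their sphere derivatives, by formulas that are the same for all solutions
    ([determined_step]). The induction is carried by the predicate [determined],
    which says that the first n derivatives at s = 0 of a quantity built from u
    are such universal expressions, and by its behaviour under products, d_i, s,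
    and division. The square root on the right-hand side is avoided by passing to
    squares, except at s = 0 where the sign is read off ([determined_cmc_op]). *)

Set Implicit Arguments.
Unset Strict Implicit.
Unset Printing Implicit Defensive.

(** * Directional derivatives *)

Section Directional.
Variables (R : realType) (V : normedModType R).
Implicit Types (f g : V -> R) (x v w : V).

Lemma is_derive_line f x v (t : R) : derivable f (t *: v + x) v ->
  is_derive t 1 (fun s => f (s *: v + x)) ('D_v f (t *: v + x)).
Proof.
have E : (fun h : R => h^-1 *: (((fun s => f (s *: v + x)) \o shift t) (h *: 1)
           - f (t *: v + x)))
       = (fun h : R => h^-1 *: ((f \o shift (t *: v + x)) (h *: v)
           - f (t *: v + x))).
  by apply/funext => h /=; rewrite [h *: 1]mulr1 scalerDl addrA.
by move=> df; split; rewrite /derivable /derive E.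
Qed.

Lemma MVT_dir f x v :
  (forall t : R, 0 <= t <= 1 -> derivable f (t *: v + x) v) ->
  exists2 c : R, 0 < c < 1 & f (v + x) - f x = 'D_v f (c *: v + x).
Proof.
move=> df; pose g (s : R) := f (s *: v + x).
have dg (s : R) : 0 <= s <= 1 -> is_derive s 1 g ('D_v f (s *: v + x)).
  by move=> /df; exact: is_derive_line.
have [||c] := @MVT R g (fun s => 'D_v f (s *: v + x)) 0 1 ltr01.
- by move=> s; rewrite in_itv/= => /andP[/ltW s0 /ltW s1]; apply: dg; rewrite s0.
- apply: derivable_within_continuous => s; rewrite in_itv/= => s01.
  by have [] := dg _ s01.
rewrite in_itv/= => c01; rewrite /g scale1r scale0r add0r subr0 mulr1 => E.
by exists c.
Qed.

Lemma line_is_derive f x v (d : R) :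
  is_derive (0 : R) 1 (fun s => f (s *: v + x)) d -> is_derive x v f d.
Proof.
have E : (fun h : R => h^-1 *: (((fun s => f (s *: v + x)) \o shift 0) (h *: 1)
           - f (0 *: v + x)))
       = (fun h : R => h^-1 *: ((f \o shift x) (h *: v) - f x)).
  by apply/funext => h /=; rewrite [h *: 1]mulr1 addr0 scale0r add0r.
by move=> [F1 F2]; split; move: F1 F2; rewrite /derivable /derive E.
Qed.

Lemma is_derive_scale f x v (c : R) : derivable f x v ->
  is_derive x (c *: v) f (c * 'D_v f x).
Proof.
move=> dx; have := @is_derive_line f x v (c * 0).
rewrite mulr0 scale0r add0r => /(_ dx) H1.
have H2 : is_derive (0:R) 1 (fun s : R => c * s) c.
  have := @is_deriveZ R R R id c 0 1 1 (is_derive_id _ _).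
  by rewrite [c *: 1]mulr1.
have H3 : is_derive (c * 0) 1 (fun s : R => f (s *: v + x)) ('D_v f x).
  by rewrite mulr0.
have := @is_derive1_comp R (fun s : R => f (s *: v + x)) (fun s : R => c * s)
  0 _ _ H3 H2.
set F := _ \o _.
have -> : F = (fun s : R => f (s *: (c *: v) + x)).
  by apply/funext => s; rewrite /F/= scalerA mulrC.
by rewrite mulrC; exact: line_is_derive.
Qed.

Lemma derive_scale f x v (c : R) : differentiable f x ->
  'D_(c *: v) f x = c * 'D_v f x.
Proof. by move=> df; rewrite !deriveE// linearZ. Qed.

Lemma derive_dirD f x v w : differentiable f x ->
  'D_(v + w) f x = 'D_v f x + 'D_w f x.
Proof. by move=> df; rewrite !deriveE// linearD. Qed.

(** Differentiability with differential 0; the general case follows by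
    subtracting a candidate for the differential. *)
Lemma littleo_differentiable f x :
  (forall e : R, 0 < e -> \forall h \near (0 : V), `|f (h + x) - f x| <= e * `|h|) ->
  differentiable f x.
Proof.
move=> H.
have E : f \o shift x = cst (f x) + (\0 : V -> R) +o_ (0 : V) id.
  apply/eqaddoP => e e0; near=> h.
  rewrite /= !fctE /= addr0; near: h; exact: H.
have cc : continuous (\0 : V -> R) by move=> y; exact: cvg_cst.
have D : 'd f x = (\0 : V -> R) :> (V -> R) by exact: diff_unique.
by apply/diff_locallyP; rewrite D.
Unshelve. all: by end_near. Qed.

End Directional.

(** A directional derivative only sees the function on a line, so it can be
    transported to another point of another space along any identification of
    the two lines. *)
Lemma derive_ext (R : realType) (V V' : normedModType R) (f : V -> R) (g : V' -> R)
    x v x' v' :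
  (forall h : R, f (h *: v + x) = g (h *: v' + x')) -> 'D_v f x = 'D_v' g x'.
Proof.
move=> E; have E0 : f x = g x' by have := E 0; rewrite !scale0r !add0r.
have D : (fun h : R => h^-1 *: ((f \o shift x) (h *: v) - f x)) =
         (fun h : R => h^-1 *: ((g \o shift x') (h *: v') - g x')).
  by apply/funext => h /=; rewrite E E0.
by rewrite /derive D.
Qed.

(** * Functions of class C^k *)

Section CkAlgebra.
Variables (R : realType) (V : normedModType R).
Implicit Types (f g : V -> R) (x v w : V) (A B : set V) (k : nat).

(** The difference vanishes near x, so its differential is 0. *)
Lemma near_eq_differentiable f g x :
  (\forall y \near x, f y = g y) -> differentiable f x -> differentiable g x.
Proof.
move=> fg df.
have -> : g = f + (g - f) by apply/funext => y; rewrite !fctE addrC subrK.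
apply: differentiableD => //; apply: littleo_differentiable => e e0.
have H0 : f x = g x by exact: nbhs_singleton fg.
have fg0 : \forall h \near (0 : V), f (h + x) = g (h + x).
  have := fg; rewrite (near_shift 0)/=; apply: filterS => h /=.
  by rewrite subr0.
apply: filterS fg0 => h H.
by rewrite !fctE H H0 !subrr normr0 mulr_ge0// ltW.
Qed.

Lemma open_near A x (P : V -> Prop) : open A -> A x -> (forall y, A y -> P y) ->
  \forall y \near x, P y.
Proof. by move=> oA Ax H; apply: filterS (open_nbhs_nbhs (conj oA Ax)). Qed.

Lemma C_k_continuous k A f x : C_k k A f -> A x -> {for x, continuous f}.
Proof.
case: k => [|k] /=; first by move=> H; exact: H.
by move=> [H _] Ax; apply: differentiable_continuous; exact: H.
Qed.

Lemma C_k_eq k A f g : open A -> (forall x, A x -> f x = g x) ->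
  C_k k A f -> C_k k A g.
Proof.
move=> oA; elim: k f g => [|k IH] f g fg /=.
  move=> cf x Ax; rewrite /prop_for /continuous_at -(fg _ Ax).
  apply: cvg_trans (cf x Ax); apply: near_eq_cvg.
  by apply: open_near oA Ax _ => y /fg.
move=> [df Df]; split=> [x Ax|v].
  by apply: near_eq_differentiable (df _ Ax); exact: open_near oA Ax fg.
apply: IH (Df v) => x Ax; apply: near_eq_derive.
exact: open_near oA Ax fg.
Qed.

Lemma C_k_subset k A B f : A `<=` B -> C_k k B f -> C_k k A f.
Proof.
move=> AB; elim: k f => [|k IH] f /= => [H x /AB|[H1 H2]]; first exact: H.
by split=> [x /AB|v]; [exact: H1|exact: IH].
Qed.

Lemma C_k_pred k A f : C_k k.+1 A f -> C_k k A f.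
Proof.
elim: k f => [|k IH] f.
  by move=> [H _] x Ax; apply: differentiable_continuous; exact: H.
by move=> [H1 H2]; split=> // v; apply: IH; exact: H2.
Qed.

Lemma C_k_cst k A (c : R) : open A -> C_k k A (fun=> c).
Proof.
move=> oA; elim: k c => [|k IH] c /=; first by move=> x _; exact: cvg_cst.
split=> [x _|v]; first exact: differentiable_cst.
by apply: C_k_eq (IH 0) => // x _; rewrite derive_cst.
Qed.

Lemma C_kD k A f g : open A -> C_k k A f -> C_k k A g ->
  C_k k A (fun x => f x + g x).
Proof.
move=> oA; elim: k f g => [|k IH] f g /=.
  by move=> cf cg x Ax; apply: continuousD; [exact: cf|exact: cg].
move=> [df Df] [dg Dg]; split=> [x Ax|v].
  by apply: differentiableD; [exact: df|exact: dg].
apply: C_k_eq (IH _ _ (Df v) (Dg v)) => // x Ax.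
by rewrite deriveD//; apply: diff_derivable; [exact: df|exact: dg].
Qed.

Lemma C_kM k A f g : open A -> C_k k A f -> C_k k A g ->
  C_k k A (fun x => f x * g x).
Proof.
move=> oA; elim: k f g => [|k IH] f g.
  by move=> /= cf cg x Ax; apply: continuousM; [exact: cf|exact: cg].
move=> cf cg; have cf' := C_k_pred cf; have cg' := C_k_pred cg.
move: cf cg => /= [df Df] [dg Dg]; split=> [x Ax|v].
  by apply: differentiableM; [exact: df|exact: dg].
apply: C_k_eq (C_kD oA (IH _ _ cf' (Dg v)) (IH _ _ cg' (Df v))) => // x Ax.
by rewrite deriveM//; apply: diff_derivable; [exact: df|exact: dg].
Qed.

Lemma C_k_sum k A n (f : 'I_n -> V -> R) : open A ->
  (forall i, C_k k A (f i)) -> C_k k A (fun x => \sum_(i < n) f i x).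
Proof.
move=> oA; elim: n f => [|n IH] f cf.
  by apply: C_k_eq (C_k_cst k 0 oA) => // x _; rewrite big_ord0.
apply: C_k_eq (C_kD oA (IH (fun i => f (widen_ord (leqnSn n) i)) _) (cf ord_max)).
- by [].
- by move=> x _; rewrite big_ord_recr.
- by move=> i; exact: cf.
Qed.

Lemma C_kV k A f : open A -> (forall x, A x -> f x != 0) -> C_k k A f ->
  C_k k A (fun x => (f x)^-1).
Proof.
move=> oA f0; elim: k => [|k IH] cf.
  by move=> x Ax; apply: (@continuousV R V f) => //; [exact: f0|exact: cf].
have {}IH := IH (C_k_pred cf).
move: cf => /= [df Df]; split=> [x Ax|v].
  by apply: differentiableV; [exact: df|exact: f0].
have c1 := C_kM oA (C_kM oA IH IH) (C_kM oA (Df v) (C_k_cst k (-1) oA)).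
apply: C_k_eq c1 => // x Ax.
rewrite [RHS]deriveV; [|exact: f0|apply: diff_derivable; exact: df].
by rewrite /GRing.scale/= expr2 invfM mulrN1 mulrN mulNr.
Qed.

(** The functions composed with below (exponential and square root) have
    derivatives that are rational in themselves: this is what closes the inductions on
    the order of differentiability. *)
Lemma derive_comp1 (h : R -> R) f x v (dh : R) :
  is_derive (f x) 1 h dh -> differentiable f x ->
  differentiable (h \o f) x /\ 'D_v (h \o f) x = dh * 'D_v f x.
Proof.
move=> [dh1 dh2] df; have dh' : differentiable h (f x) by exact/derivable1_diffP.
have dhf := differentiable_comp df dh'; split=> //.
rewrite deriveE// diff_comp//= -(deriveE v df) -['D_v f x]mulr1.
by rewrite [LHS]linearZ -(deriveE (1 : R) dh') dh2 mulr1 mulrC.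
Qed.

Lemma C_k_expR k A f : open A -> C_k k A f -> C_k k A (fun x => expR (f x)).
Proof.
move=> oA; elim: k => [|k IH] cf.
  move=> x Ax; apply: (@continuous_comp _ _ _ f (@expR R)); first exact: cf.
  exact: continuous_expR.
have {}IH := IH (C_k_pred cf).
move: cf => /= [df Df]; split=> [x Ax|v].
  by have [] := @derive_comp1 expR f x 0 _ (is_derive_expR _) (df x Ax).
apply: C_k_eq (C_kM oA IH (Df v)) => // x Ax.
by have [_ ->] := @derive_comp1 expR f x v _ (is_derive_expR _) (df x Ax).
Qed.

Lemma C_k_sqrt k A f : open A -> (forall x, A x -> 0 < f x) -> C_k k A f ->
  C_k k A (fun x => Num.sqrt (f x)).
Proof.
move=> oA f0; elim: k => [|k IH] cf.
  move=> x Ax; apply: (@continuous_comp _ _ _ f (@Num.sqrt R)); first exact: cf.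
  exact: sqrt_continuous.
have {}IH := IH (C_k_pred cf).
have s0 x : A x -> 2 * Num.sqrt (f x) != 0.
  by move=> Ax; rewrite mulf_neq0 ?gt_eqF ?sqrtr_gt0 ?f0.
move: cf => /= [df Df]; split=> [x Ax|v].
  by have [] := @derive_comp1 _ f x 0 _ (is_derive1_sqrt (f0 x Ax)) (df x Ax).
apply: C_k_eq (C_kM oA (C_kV oA s0 (C_kM oA (C_k_cst k 2 oA) IH)) (Df v)) => // x Ax.
by have [_ ->] := @derive_comp1 _ f x v _ (is_derive1_sqrt (f0 x Ax)) (df x Ax).
Qed.

End CkAlgebra.

(** * Functions of several real variables *)

Section CkRow.
Variables (R : realType).

Lemma norm_coord n (h : 'rV[R]_n) i : `|h 0 i| <= `|h|.
Proof.
rewrite [leRHS]/Num.Def.normr/= mx_normrE.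
exact: (le_bigmax _ (fun k : 'I_1 * 'I_n => `|h k.1 k.2|) (0, i)).
Qed.

Lemma norm_le_coord n (h : 'rV[R]_n) (e : R) : 0 <= e ->
  (forall i, `|h 0 i| <= e) -> `|h| <= e.
Proof.
move=> e0 H; rewrite /Num.Def.normr/= mx_normrE bigmax_le// => -[i j] _ /=.
by rewrite ord1.
Qed.

Lemma derive_sum_coord n (f : 'rV[R]_n -> R) x v : differentiable f x ->
  'D_v f x = \sum_(j < n) v 0 j * 'D_(delta_mx 0 j) f x.
Proof.
move=> df; rewrite deriveE// [in LHS](row_sum_delta v) raddf_sum /=.
by apply: eq_bigr => j _; rewrite linearZ deriveE.
Qed.

(** Going from x to x + h by changing one coordinate at a time, the mean value
    theorem applies on each edge, and by continuity the partial derivative found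
    there differs little from the one at x. *)
Lemma C1_differentiable n (f : 'rV[R]_n -> R) (x : 'rV[R]_n) :
  (forall i, \forall y \near x, derivable f y (delta_mx 0 i)) ->
  (forall i, {for x, continuous ('D_(delta_mx 0 i) f)}) ->
  differentiable f x.
Proof.
move=> dv cD.
(* the candidate for the differential *)
pose L (y : 'rV[R]_n) := \sum_(i < n) 'D_(delta_mx 0 i) f x * y 0 i.
have dL : differentiable L x.
  have -> : L = \sum_(i < n) (fun y : 'rV_n => 'D_(delta_mx 0 i) f x * y 0 i).
    by apply/funext => y; rewrite fct_sumE.
  apply: differentiable_sum => i; apply: differentiableM.
    exact: differentiable_cst.
  exact: differentiable_coord.
suff : differentiable (f - L) x.
  move=> H; have -> : f = (f - L) + L by apply/funext => y; rewrite !fctE subrK.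
  exact: differentiableD.
apply: littleo_differentiable => e e0.
pose e' := e / n.+1%:R.
have e'0 : 0 < e' by rewrite divr_gt0// ltr0n.
have good (i : 'I_n) : \forall y \near x, derivable f y (delta_mx 0 i) /\
    `|'D_(delta_mx 0 i) f y - 'D_(delta_mx 0 i) f x| <= e'.
  near=> y; split; first by near: y; exact: dv.
  by rewrite distrC; near: y; move/cvgrPdist_le: (cD i); exact.
have {}good : \forall y \near x, forall i : 'I_n, derivable f y (delta_mx 0 i) /\
    `|'D_(delta_mx 0 i) f y - 'D_(delta_mx 0 i) f x| <= e'.
  exact: (@filter_forall _ 'I_n (fun i y => derivable f y (delta_mx 0 i) /\
    `|'D_(delta_mx 0 i) f y - 'D_(delta_mx 0 i) f x| <= e') (nbhs x)).
have [d /= d0 {}good] := (nbhs_normP _ _).1 good.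
near=> h.
have hd : `|h| < d by near: h; exact: (@nbhs0_lt R 'rV[R]_n).
(* the path that switches on the coordinates of h one after the other *)
pose T (j : nat) : 'rV[R]_n := \row_i (if (i < j)%N then h 0 i else 0).
have TS (i : 'I_n) : T i.+1 = h 0 i *: delta_mx 0 i + T i.
  apply/rowP => k; rewrite !mxE eqxx/= ltnS leq_eqVlt.
  have [->|ki] := eqVneq k i; first by rewrite eqxx ltnn mulr1 addr0.
  by rewrite mulr0 add0r (_ : (_ == _ :> nat) = false) //; apply: negbTE.
have small (i : 'I_n) (t : R) : 0 <= t <= 1 ->
    `|(t *: (h 0 i *: delta_mx 0 i)) + (T i)| <= `|h|.
  move=> /andP[t0 t1]; apply: norm_le_coord => // k; rewrite !mxE eqxx/=.
  have [->|ki] := eqVneq k i.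
    rewrite ltnn addr0 mulr1 normrM ger0_norm//.
    by rewrite (le_trans _ (norm_coord h i))// ler_piMl.
  by rewrite !mulr0 add0r; case: ifP; rewrite ?normr0 ?norm_coord.
have inball (i : 'I_n) (t : R) : 0 <= t <= 1 ->
    ball_ Num.norm x d ((t *: (h 0 i *: delta_mx 0 i)) + (T i + x)).
  move=> t01; rewrite /ball_/= addrA opprD addrCA subrr addr0 normrN.
  exact: le_lt_trans (small _ _ t01) hd.
have step (i : 'I_n) :
    `|f (T i.+1 + x) - f (T i + x) - 'D_(delta_mx 0 i) f x * h 0 i| <= e' * `|h|.
  have dh y : ball_ Num.norm x d y ->
      derivable f y (h 0 i *: delta_mx 0 i) /\
      'D_(h 0 i *: delta_mx 0 i) f y = h 0 i * 'D_(delta_mx 0 i) f y.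
    by move=> /good/(_ i)[/(@is_derive_scale _ _ _ _ _ (h 0 i))[]].
  have [|c c01] := @MVT_dir R _ f (T i + x) (h 0 i *: delta_mx 0 i).
    by move=> t t01; have [] := dh _ (inball i t t01).
  rewrite addrA -TS => ->.
  have c01' : 0 <= c <= 1 by case/andP: c01 => /ltW-> /ltW->.
  have [_ ->] := dh _ (inball i c c01').
  rewrite mulrC -mulrBl normrM; apply: ler_pM => //; last exact: norm_coord.
  by have [] := good _ (inball i c c01') i.
have -> : (f - L) (h + x) - (f - L) x =
    \sum_(i < n) (f (T i.+1 + x) - f (T i + x) - 'D_(delta_mx 0 i) f x * h 0 i).
  rewrite sumrB -(big_mkord xpredT (fun i => f (T i.+1 + x) - f (T i + x))).
  rewrite telescope_sumr// !fctE.
  have -> : T n = h by apply/rowP => k; rewrite !mxE ltn_ord.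
  have -> : T 0%N = 0 by apply/rowP => k; rewrite !mxE.
  rewrite add0r; have -> : L (h + x) = \sum_(i < n) 'D_(delta_mx 0 i) f x * h 0 i + L x.
    by rewrite /L -big_split/=; apply: eq_bigr => i _; rewrite mxE mulrDr.
  by ring.
apply: le_trans (ler_norm_sum _ _ _) _.
apply: le_trans (ler_sum _ (fun i _ => step i)) _.
rewrite sumr_const card_ord -mulr_natr mulrAC ler_wpM2r//.
by rewrite /e' mulrAC ler_pdivrMr ?ltr0n// ler_pM2l// ler_nat.
Unshelve. all: by end_near. Qed.

Lemma differentiable_row (V : normedModType R) n (phi : V -> 'rV[R]_n) (x : V) :
  (forall j, differentiable (fun y => phi y 0 j) x) ->
  differentiable phi x /\
  forall v, 'D_v phi x = \row_j 'D_v (fun y => phi y 0 j) x.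
Proof.
move=> dphi; have d : differentiable phi x.
  have -> : phi = \sum_(j < n) (fun y => phi y 0 j *: (delta_mx 0 j : 'rV[R]_n)).
    by apply/funext => y; rewrite fct_sumE -row_sum_delta.
  by apply: differentiable_sum => j; apply: differentiableZl.
split=> // v; rewrite derive_mx; last exact: diff_derivable.
by apply/rowP => j; rewrite !mxE.
Qed.

Lemma derive_comp_row (V : normedModType R) n (phi : V -> 'rV[R]_n)
    (g : 'rV[R]_n -> R) (x v : V) :
  (forall j, differentiable (fun y => phi y 0 j) x) ->
  differentiable g (phi x) ->
  differentiable (fun y => g (phi y)) x /\
  'D_v (fun y => g (phi y)) x =
    \sum_(j < n) 'D_v (fun y => phi y 0 j) x * 'D_(delta_mx 0 j) g (phi x).
Proof.
move=> dphi dg; have [d Dphi] := differentiable_row dphi.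
have dgp : differentiable (g \o phi) x by exact: differentiable_comp.
split=> //; rewrite -[LHS]/('D_v (g \o phi) x) deriveE// diff_comp//=.
rewrite -(deriveE _ d) Dphi -deriveE// derive_sum_coord//.
by apply: eq_bigr => j _; rewrite mxE.
Qed.

Lemma C_k_comp (V : normedModType R) n k (A : set V) (B : set 'rV[R]_n)
    (phi : V -> 'rV[R]_n) (g : 'rV[R]_n -> R) :
  open A -> open B -> (forall x, A x -> B (phi x)) ->
  (forall j, C_k k A (fun x => phi x 0 j)) -> C_k k B g ->
  C_k k A (fun x => g (phi x)).
Proof.
move=> oA oB AB; elim: k g => [|k IH] g cphi.
  move=> cg x Ax; apply: (@continuous_comp _ _ _ phi g); last exact/cg/AB.
  have -> : phi = \sum_(j < n) (fun y => phi y 0 j *: (delta_mx 0 j : 'rV[R]_n)).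
    by apply/funext => y; rewrite fct_sumE -row_sum_delta.
  apply: (big_ind (fun F : V -> 'rV[R]_n => {for x, continuous F})).
  - exact: cvg_cst.
  - by move=> F G cF cG; exact: continuousD.
  - by move=> j _; apply: continuousZl; exact: cphi.
move=> [dg Dg].
have cphi' j : C_k k A (fun x => phi x 0 j) by apply: C_k_pred; exact: cphi.
have H x v : A x -> _ := fun Ax => @derive_comp_row V n phi g x v
  (fun j => (cphi j).1 x Ax) (dg _ (AB _ Ax)).
split=> [x Ax|v]; first by have [] := H x 0 Ax.
apply: C_k_eq (C_k_sum oA (fun j => C_kM oA ((cphi j).2 v) (IH _ cphi' (Dg _)))) => //.
by move=> x Ax; have [_ ->] := H x v Ax.
Qed.

(** For a function given by an integral or by an implicit equation only the
    directional derivatives can be computed; this lemma supplies the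
    differentiability. *)
Lemma C_kS_intro n k (A : set 'rV[R]_n) (f : 'rV[R]_n -> R) : open A ->
  (forall x v, A x -> derivable f x v) ->
  (forall v, C_k k A ('D_v f)) -> C_k k.+1 A f.
Proof.
move=> oA df Df; split=> // x Ax; apply: C1_differentiable => i.
  by apply: (open_near oA Ax) => y Ay; exact: df.
exact: C_k_continuous (Df _) Ax.
Qed.

End CkRow.

Section Schwarz.
Variables (R : realType) (V : normedModType R).
Implicit Types (f : V -> R).

Lemma is_derive_translate f (z y v : V) : derivable f (z + y) v ->
  is_derive y v (fun y' => f (z + y')) ('D_v f (z + y)).
Proof.
have E : (fun h : R => h^-1 *: (((fun y' => f (z + y')) \o shift y) (h *: v)
           - f (z + y)))
       = (fun h : R => h^-1 *: ((f \o shift (z + y)) (h *: v) - f (z + y))).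
  by apply/funext => h /=; rewrite addrCA.
by move=> df; split; rewrite /derivable /derive E.
Qed.

(** The second difference quotient is symmetric in the two directions, and two
    uses of the mean value theorem show that it tends to the iterated derivative. *)
Lemma derive_swap (A : set V) f (x v w : V) :
  open A -> A x -> C_k 2 A f -> 'D_v ('D_w f) x = 'D_w ('D_v f) x.
Proof.
move=> oA Ax cf.
suff main (a b : V) : C_k 2 A f ->
    (fun h : R => h^-1 * h^-1 * (f (h *: a + (h *: b + x)) - f (h *: b + x)
       - (f (h *: a + x) - f x))) @ 0^' --> 'D_b ('D_a f) x.
  have H1 := main v w cf; have H2 := main w v cf.
  have E : (fun h : R => h^-1 * h^-1 * (f (h *: v + (h *: w + x)) - f (h *: w + x)
       - (f (h *: v + x) - f x))) = (fun h : R => h^-1 * h^-1 *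
       (f (h *: w + (h *: v + x)) - f (h *: v + x) - (f (h *: w + x) - f x))).
    by apply/funext => h; congr (_ * _); rewrite [h *: w + (_ + _)]addrCA; ring.
  by rewrite E in H1; apply: cvg_unique H2 H1.
move=> [df Df]; have [da Dab] := Df a.
have cD : {for x, continuous ('D_b ('D_a f))} by exact: (Dab b).
have [d /= d0 good] := (nbhs_normP _ _).1 (open_nbhs_nbhs (conj oA Ax)).
apply/cvgrPdist_le => e e0.
have [d' /= d'0 close] := (nbhs_normP _ _).1 (proj1 (cvgrPdist_le _ _) cD e e0).
near=> h.
have h0 : h != 0 by near: h; exact: nbhs_dnbhs_neq.
have ab0 : 0 < `|a| + `|b| + 1 by rewrite ltr_wpDl// addr_ge0.
have hs : `|h| * (`|a| + `|b|) < Num.min d d'.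
  have : `|h| < Num.min d d' / (`|a| + `|b| + 1).
    near: h; apply: dnbhs0_lt; rewrite divr_gt0// lt_min d0; exact: d'0.
  rewrite ltr_pdivlMr//; apply: le_lt_trans.
  by rewrite ler_wpM2l// lerDl.
have small (t s : R) : 0 <= t <= 1 -> 0 <= s <= 1 ->
    `|x - (t *: (h *: a) + (s *: (h *: b) + x))| < Num.min d d'.
  move=> /andP[t0 t1] /andP[s0 s1]; apply: le_lt_trans hs.
  rewrite addrA opprD addrCA subrr addr0 normrN mulrDr.
  rewrite (le_trans (ler_normD _ _))// !normrZ (ger0_norm t0) (ger0_norm s0).
  by rewrite lerD// ler_piMl// mulr_ge0.
have inA t s : 0 <= t <= 1 -> 0 <= s <= 1 ->
    A (t *: (h *: a) + (s *: (h *: b) + x)).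
  by move=> t01 s01; apply: good; move: (small t s t01 s01); rewrite lt_min => /andP[].
have z01 : 0 <= (0 : R) <= 1 by rewrite lexx ler01.
have o01 : 0 <= (1 : R) <= 1 by rewrite lexx ler01.
pose g y := f (h *: b + y) - f y.
have dg (t : R) : 0 <= t <= 1 -> is_derive (t *: (h *: a) + x) (h *: a) g
    (h * ('D_a f (h *: b + (t *: (h *: a) + x)) - 'D_a f (t *: (h *: a) + x))).
  move=> t01.
  have A1 : A (h *: b + (t *: (h *: a) + x)).
    by rewrite addrCA; have := inA t 1 t01 o01; rewrite scale1r.
  have A0 : A (t *: (h *: a) + x).
    by have := inA t 0 t01 z01; rewrite scale0r add0r.
  have B1 := is_derive_translate (@diff_derivable R V _ f _ (h *: a) (df _ A1)).
  have B0 := derivableP (@diff_derivable R V _ f _ (h *: a) (df _ A0)).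
  by have := is_deriveB B1 B0; rewrite !derive_scale ?mulrBr//; exact: df.
have [t t01|c c01] := @MVT_dir R V g x (h *: a); first by have [] := dg _ t01.
have c01' : 0 <= c <= 1 by case/andP: c01 => /ltW-> /ltW->.
have [_ Ed] := dg _ c01'; rewrite Ed => Eg.
have [s s01|c' c'01 Eh] := @MVT_dir R V ('D_a f) (c *: (h *: a) + x) (h *: b).
  by apply: diff_derivable; apply: da; rewrite addrCA; exact: inA.
have c'01' : 0 <= c' <= 1 by case/andP: c'01 => /ltW-> /ltW->.
have -> : f (h *: a + (h *: b + x)) - f (h *: b + x) - (f (h *: a + x) - f x)
    = g (h *: a + x) - g x by rewrite /g [h *: a + (_ + _)]addrCA; ring.
rewrite Eg Eh derive_scale; last by apply: da; rewrite addrCA; exact: inA.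
rewrite [c' *: _ + _]addrCA; set q := 'D_b _ (c *: _ + _).
have -> : h^-1 / h * (h * (h * q)) = q by field.
apply: close; have := small _ _ c01' c'01'.
by rewrite /ball_ lt_min => /andP[].
Unshelve. all: by end_near. Qed.

End Schwarz.

(** * Integrals with a parameter *)

Section UnitMean.
Variable R : realType.
Implicit Types (h F : R -> R).

Definition unit_mean h : R := \int[@lebesgue_measure R]_(s in `[0, 1]) h s.

Let mu := @lebesgue_measure R.

Lemma unit_integrable h : {within `[(0 : R), 1], continuous h} ->
  mu.-integrable `[0, 1] (EFin \o h).
Proof.
move=> ch; apply: continuous_compact_integrable => //; exact: segment_compact.
Qed.

Lemma within_continuousB (A : set R) h1 h2 : {within A, continuous h1} ->
  {within A, continuous h2} -> {within A, continuous (fun s => h1 s - h2 s)}.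
Proof.
by move=> c1 c2 s; apply: (@continuousB R _ _ (h1 : subspace A -> R) h2);
  [exact: c1|exact: c2].
Qed.

Lemma within_continuousZ (A : set R) h c : {within A, continuous h} ->
  {within A, continuous (fun s => c * h s)}.
Proof.
move=> c1 s.
apply: (@continuousM R _ ((fun=> c) : subspace A -> R) (h : subspace A -> R)).
  exact: cvg_cst.
exact: c1.
Qed.

Lemma unit_meanB h1 h2 : {within `[(0 : R), 1], continuous h1} ->
  {within `[(0 : R), 1], continuous h2} ->
  unit_mean (fun s => h1 s - h2 s) = unit_mean h1 - unit_mean h2.
Proof. by move=> c1 c2; apply: RintegralB => //; exact: unit_integrable. Qed.

Lemma unit_meanD h1 h2 : {within `[(0 : R), 1], continuous h1} ->
  {within `[(0 : R), 1], continuous h2} ->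
  unit_mean (fun s => h1 s + h2 s) = unit_mean h1 + unit_mean h2.
Proof. by move=> c1 c2; apply: RintegralD => //; exact: unit_integrable. Qed.

Lemma unit_meanZ h c : {within `[(0 : R), 1], continuous h} ->
  unit_mean (fun s => c * h s) = c * unit_mean h.
Proof. by move=> c1; apply: RintegralZl => //; exact: unit_integrable. Qed.

Lemma unit_mean_bound h e : {within `[(0 : R), 1], continuous h} ->
  (forall s, 0 <= s <= 1 -> `|h s| <= e) -> `|unit_mean h| <= e.
Proof.
move=> ch he; apply: (le_trans (le_normr_Rintegral _ (unit_integrable ch))) => //.
have -> : e = unit_mean (fun=> e).
  rewrite /unit_mean Rintegral_cst//= lebesgue_measure_itv/= lte_fin ltr01.
  by rewrite oppr0 adde0 mulr1.
apply: le_Rintegral => //.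
- apply: (@unit_integrable (fun s => `|h s|)) => s.
  apply: (@continuous_comp _ _ _ (h : subspace _ -> R) (@Num.norm R R)).
    exact: ch.
  exact: norm_continuous.
- by apply: unit_integrable => s; exact: cvg_cst.
Qed.

Lemma unit_mean_derive h F : {within `[(0 : R), 1], continuous h} ->
  (forall s : R, 0 <= s <= 1 -> is_derive s 1 F (h s)) ->
  unit_mean h = F 1 - F 0.
Proof.
move=> ch dF.
have cF (s : R) : 0 <= s <= 1 -> {for s, continuous F}.
  by move=> /dF[dFs _]; apply/differentiable_continuous/derivable1_diffP.
rewrite /unit_mean /Rintegral (@continuous_FTC2 R h F) ?ltr01//.
  split.
  - by move=> s; rewrite in_itv/= => /andP[/ltW s0 /ltW s1]; apply: (@ex_derive _ _ _ _ _ _ (h s)); apply: dF; rewrite s0.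
  - by apply: cvg_at_right_filter; apply: cF; rewrite lexx ler01.
  - by apply: cvg_at_left_filter; apply: cF; rewrite lexx ler01.
move=> s; rewrite in_itv/= => /andP[/ltW s0 /ltW s1].
have s01 : 0 <= s <= 1 by rewrite s0.
by rewrite derive1E; have [_ ->] := dF s s01.
Qed.

End UnitMean.

Section ParameterIntegral.
Variables (R : realType) (V : normedModType R).

(** The tube lemma: continuity in the parameter is uniform over the compact
    interval of integration. *)
Lemma near_unit_uniform (h : R -> V -> R) (p : V) (e : R) : 0 < e ->
  (forall s : R, 0 <= s <= 1 -> {for (s, p), continuous (fun z => h z.1 z.2)}) ->
  \forall q \near p, forall s : R, 0 <= s <= 1 -> `|h s q - h s p| <= e.
Proof.
move=> e0 ch.
have := (compact_near_coveringP _).1 (@segment_compact R 0 1) V (nbhs p)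
  (fun q s => `|h s q - h s p| <= e) _.
move=> H; have {}H : \forall q \near p, `[(0:R), 1] `<=` (fun s => `|h s q - h s p| <= e).
  apply: H => s; rewrite /= in_itv/= => s01.
  have /cvgrPdist_le/(_ (e / 2)) := ch s s01; rewrite divr_gt0// => /(_ isT).
  move=> [[U W] /= [Us Wp] UW].
  exists (U, W) => //= -[s' q] [/= Us' Wq].
  have H1 := UW (s', q) (conj Us' Wq).
  have H2 := UW (s', p) (conj Us' (nbhs_singleton Wp)).
  rewrite /= in H1 H2.
  rewrite (splitr e) -[X in `|X|](subrKA (h s p)) (le_trans (ler_normD _ _))//.
  by rewrite lerD// distrC.
by apply: filterS H => q H s s01; apply: H; rewrite /= in_itv.
Qed.

Lemma joint_unit_continuous (h : R -> V -> R) (p : V) :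
  (forall s : R, 0 <= s <= 1 -> {for (s, p), continuous (fun z => h z.1 z.2)}) ->
  {within `[(0 : R), 1], continuous (h ^~ p)}.
Proof.
move=> ch; apply: continuous_in_subspaceT => s.
rewrite inE/= in_itv/= => s01.
apply/cvgrPdist_le => e e0.
have /cvgrPdist_le/(_ e e0)[[U W] /= [Us Wp] UW] := ch s s01.
apply: filterS Us => s' Us'; exact: (UW (s', p) (conj Us' (nbhs_singleton Wp))).
Qed.

Lemma continuous_unit_mean (h : R -> V -> R) (A : set V) (p : V) :
  open A -> A p ->
  (forall (s : R) q, 0 <= s <= 1 -> A q ->
    {for (s, q), continuous (fun z => h z.1 z.2)}) ->
  {for p, continuous (fun q => unit_mean (h ^~ q))}.
Proof.
move=> oA Ap ch.
have cp q (Aq : A q) := joint_unit_continuous (fun s s01 => ch s q s01 Aq).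
apply/cvgrPdist_le => e e0; near=> q.
have Aq : A q by near: q; exact: open_nbhs_nbhs (conj oA Ap).
rewrite -unit_meanB; [|exact: cp..].
apply: unit_mean_bound.
  by apply: within_continuousB; exact: cp.
move=> s s01; rewrite distrC; move: s s01; near: q.
by apply: near_unit_uniform => // s s01; exact: ch.
Unshelve. all: by end_near. Qed.

(** Differentiation under the integral sign: by the mean value theorem the
    difference quotient of h s is a value of dh s at a nearby point, which is close
    to dh s p uniformly in s. *)
Lemma is_derive_unit_mean (h dh : R -> V -> R) (A : set V) (p v : V) :
  open A -> A p ->
  (forall (s : R) q, 0 <= s <= 1 -> A q ->
    {for (s, q), continuous (fun z => h z.1 z.2)}) ->
  (forall (s : R) q, 0 <= s <= 1 -> A q ->
    {for (s, q), continuous (fun z => dh z.1 z.2)}) ->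
  (forall (s : R) q, 0 <= s <= 1 -> A q -> is_derive q v (h s) (dh s q)) ->
  is_derive p v (fun q => unit_mean (h ^~ q)) (unit_mean (dh ^~ p)).
Proof.
move=> oA Ap ch cdh dh_.
have cp q (Aq : A q) := joint_unit_continuous (fun s s01 => ch s q s01 Aq).
have cdp q (Aq : A q) := joint_unit_continuous (fun s s01 => cdh s q s01 Aq).
pose I q := unit_mean (h ^~ q).
suff H : (fun t : R => t^-1 *: ((I \o shift p) (t *: v) - I p)) @ 0^' -->
    unit_mean (dh ^~ p).
  by split; [apply/cvg_ex; eexists; exact: H|exact: cvg_lim H].
apply/cvgrPdist_le => e e0.
have := near_unit_uniform e0 (fun s s01 => cdh s p s01 Ap).
move=> /(filterI (open_nbhs_nbhs (conj oA Ap))) /nbhs_normP[d /= d0 good].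
near=> t.
have t0 : t != 0 by near: t; exact: nbhs_dnbhs_neq.
have v0 : 0 < `|v| + 1 by rewrite ltr_wpDl.
have td : `|t| < d / (`|v| + 1) by near: t; apply: dnbhs0_lt; rewrite divr_gt0.
have inb (c : R) : 0 <= c <= 1 -> ball_ Num.norm p d (c *: (t *: v) + p).
  move=> /andP[c0 c1]; rewrite /ball_/= opprD addrCA subrr addr0 normrN.
  rewrite !normrZ (ger0_norm c0); move: td; rewrite ltr_pdivlMr//.
  apply: le_lt_trans; rewrite mulrA ler_pM ?mulr_ge0//.
    by rewrite ler_piMl.
  by rewrite lerDl.
have A1 : A (t *: v + p).
  by have [] := good _ (inb 1 _); rewrite ?ler01 ?lexx ?scale1r.
rewrite /I/= -unit_meanB; [|exact: cp..].
have cI : {within `[(0:R), 1], continuous (fun s => h s (t *: v + p) - h s p)}.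
  by apply: within_continuousB; exact: cp.
rewrite [_ *: _]mulrC mulrC -unit_meanZ//.
have cI' := @within_continuousZ _ _ _ t^-1 cI.
rewrite -unit_meanB//; last exact: cdp.
apply: unit_mean_bound; first by apply: within_continuousB => //; exact: cdp.
move=> s s01.
have [c c01|c c01 ->] := @MVT_dir R V (h s) p (t *: v).
  have [Ac _] := good _ (inb c c01).
  by have [dd _] := dh_ s _ s01 Ac; have [] := is_derive_scale t dd.
have c01' : 0 <= c <= 1 by case/andP: c01 => /ltW-> /ltW->.
have [Ac Hc] := good _ (inb c c01').
have [dd Edd] := dh_ s _ s01 Ac; have [_ ->] := is_derive_scale t dd.
by rewrite Edd mulKf// distrC; exact: Hc.
Unshelve. all: by end_near. Qed.

End ParameterIntegral.

(** * The Hadamard lemma *)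

Lemma continuous_row (R : realType) (T : topologicalType) n (phi : T -> 'rV[R]_n) x :
  (forall j, {for x, continuous (fun y => phi y 0 j)}) -> {for x, continuous phi}.
Proof.
move=> cphi; have -> : phi = \sum_(j < n) (fun y => phi y 0 j *: (delta_mx 0 j : 'rV[R]_n)).
  by apply/funext => y; rewrite fct_sumE -row_sum_delta.
apply: (big_ind (fun F : T -> 'rV[R]_n => {for x, continuous F})).
- exact: cvg_cst.
- by move=> F G cF cG; exact: continuousD.
- by move=> j _; apply: continuousZl; exact: cphi.
Qed.

Section Hadamard.
Variables (R : realType) (n : nat).
Local Notation V := 'rV[R]_n.+1.
Implicit Types (f : V -> R) (p q v : V) (A : set V).

(** Only the coordinate of index 0 is scaled: it is the one to be factored out. *)
Definition shrink (s : R) p : V :=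
  \row_j (if j == 0 then s * p 0 j else p 0 j).

Definition shrink_closed A :=
  forall p, A p -> forall s : R, 0 <= s <= 1 -> A (shrink s p).

(** The weight s^k is there for differentiation: a derivative in the coordinate
    of index 0 creates a factor s, and without weight the family would not be stable. *)
Definition ray_mean (k : nat) f p : R := unit_mean (fun s => s ^+ k * f (shrink s p)).

Lemma shrink1 p : shrink 1 p = p.
Proof. by apply/rowP => j; rewrite mxE mul1r if_same. Qed.

Lemma shrink_line s (t : R) v p : shrink s (t *: v + p) = t *: shrink s v + shrink s p.
Proof. by apply/rowP => j; rewrite !mxE; case: ifP => // _; ring. Qed.

Lemma shrinkE s v : shrink s v = (s * v 0 0) *: delta_mx 0 0 + shrink 0 v.
Proof.
apply/rowP => j; rewrite !mxE eqxx/=; case: eqVneq => [->|_].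
  by rewrite mulr1 mul0r addr0.
by rewrite mulr0 add0r.
Qed.

Lemma shrink_continuous : continuous (fun z : R * V => shrink z.1 z.2).
Proof.
move=> z; apply: continuous_row => j.
have c2 : {for z, continuous (fun y : R * V => y.2 0 j)}.
  apply: (@continuous_comp _ _ _ snd (fun p : V => p 0 j)); first exact: cvg_snd.
  exact: coord_continuous.
have -> : (fun y : R * V => shrink y.1 y.2 0 j) =
    if j == 0 then (fun y : R * V => y.1 * y.2 0 j) else (fun y : R * V => y.2 0 j).
  by apply/funext => y; rewrite mxE; case: ifP.
case: ifP => // _.
have c1 : {for z, continuous (fun y : R * V => y.1)} by exact: cvg_fst.
exact: (continuousM c1 c2).
Qed.

Lemma is_derive_shrink f p v (s : R) : differentiable f (shrink s p) ->
  is_derive p v (fun q => f (shrink s q))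
    (s * v 0 0 * 'D_(delta_mx 0 0) f (shrink s p) + 'D_(shrink 0 v) f (shrink s p)).
Proof.
move=> df; apply: line_is_derive.
have := @is_derive_line _ _ f (shrink s p) (shrink s v) 0.
rewrite scale0r add0r => /(_ (diff_derivable df)).
under [X in is_derive _ _ X]eq_fun do rewrite -shrink_line.
move=> H; apply: is_derive_eq H _.
by rewrite [shrink s v]shrinkE derive_dirD// derive_scale.
Qed.

Lemma joint_continuous_ray A k f (s : R) p : shrink_closed A ->
  (forall q, A q -> {for q, continuous f}) -> 0 <= s <= 1 -> A p ->
  {for (s, p), continuous (fun z : R * V => z.1 ^+ k * f (shrink z.1 z.2))}.
Proof.
move=> sA cf s01 Ap; apply: continuousM.
  apply: (@continuous_comp _ _ _ fst (fun t : R => t ^+ k)); first exact: cvg_fst.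
  exact: exprn_continuous.
apply: (@continuous_comp _ _ _ (fun z : R * V => shrink z.1 z.2) f).
  exact: shrink_continuous.
by apply: cf; exact: sA.
Qed.

Lemma is_derive_ray_mean A k f p v : open A -> shrink_closed A -> A p ->
  C_k 1 A f ->
  is_derive p v (ray_mean k f)
    (v 0 0 * ray_mean k.+1 ('D_(delta_mx 0 0) f) p + ray_mean k ('D_(shrink 0 v) f) p).
Proof.
move=> oA sA Ap [df Df].
have cf q : A q -> {for q, continuous f}.
  by move=> Aq; apply: differentiable_continuous; exact: df.
have j1 s q s01 Aq := @joint_continuous_ray A k.+1 ('D_(delta_mx 0 0) f) s q sA (Df _) s01 Aq.
have j2 s q s01 Aq := @joint_continuous_ray A k ('D_(shrink 0 v) f) s q sA (Df _) s01 Aq.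
have c1 := @joint_unit_continuous _ _
  (fun s q => s ^+ k.+1 * 'D_(delta_mx 0 0) f (shrink s q)) p (fun s s01 => j1 s p s01 Ap).
have c2 := @joint_unit_continuous _ _
  (fun s q => s ^+ k * 'D_(shrink 0 v) f (shrink s q)) p (fun s s01 => j2 s p s01 Ap).
have := @is_derive_unit_mean R V (fun s q => s ^+ k * f (shrink s q))
  (fun s q => v 0 0 * (s ^+ k.+1 * 'D_(delta_mx 0 0) f (shrink s q)) +
     s ^+ k * 'D_(shrink 0 v) f (shrink s q)) A p v oA Ap.
move=> H; apply: is_derive_eq; first apply: H.
- by move=> s q s01 Aq; exact: joint_continuous_ray sA cf s01 Aq.
- move=> s q s01 Aq; apply: continuousD; last exact: j2.
  by apply: continuousM; [exact: cvg_cst|exact: j1].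
- move=> s q s01 Aq.
  have := is_derive_shrink v (df _ (sA _ Aq _ s01)) => d1.
  have := @is_deriveZ R V R _ (s ^+ k) _ _ _ d1.
  move=> H'; apply: is_derive_eq H' _.
  by rewrite /GRing.scale/= exprS; ring.
have E1 := unit_meanZ (v 0 0) c1.
have E2 := unit_meanD (within_continuousZ (c := v 0 0) c1) c2.
by rewrite /ray_mean -E1; exact: E2.
Qed.

Lemma smooth_ray_mean A k f : open A -> shrink_closed A ->
  smooth_on A f -> smooth_on A (ray_mean k f).
Proof.
move=> oA sA + l; elim: l k f => [|l IH] k f cf.
  move=> p Ap; apply: (continuous_unit_mean oA Ap) => s q s01 Aq.
  by apply: joint_continuous_ray sA (cf 0%N) s01 Aq.
have sD v : smooth_on A ('D_v f) by move=> k'; exact: (cf k'.+1).2.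
apply: C_kS_intro => // [x v Ax|v].
  exact: (@ex_derive _ _ _ _ _ _ _ (is_derive_ray_mean k v oA sA Ax (cf 1%N))).
apply: C_k_eq (C_kD oA (C_kM oA (C_k_cst l (v 0 0) oA) (IH k.+1 _ (sD _)))
  (IH k _ (sD (shrink 0 v)))) => // x Ax.
by have [_ ->] := is_derive_ray_mean k v oA sA Ax (cf 1%N).
Qed.

(** The derivative is integrated along the segment from shrink 0 p to p. *)
Lemma hadamard A f p : shrink_closed A -> A p -> C_k 1 A f ->
  f p = f (shrink 0 p) + p 0 0 * ray_mean 0 ('D_(delta_mx 0 0) f) p.
Proof.
move=> sA Ap [df Df].
have j1 s s01 := @joint_continuous_ray A 0 ('D_(delta_mx 0 0) f) s p sA (Df _) s01 Ap.
have c1 := @joint_unit_continuous _ _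
  (fun s q => s ^+ 0 * 'D_(delta_mx 0 0) f (shrink s q)) p j1.
rewrite /ray_mean -unit_meanZ//.
have D (s : R) : 0 <= s <= 1 -> is_derive s 1 (fun s => f (shrink s p))
    (p 0 0 * (s ^+ 0 * 'D_(delta_mx 0 0) f (shrink s p))).
  move=> s01.
  have E : (fun t : R => f (shrink t p)) =
      (fun t => f (t *: (p 0 0 *: delta_mx 0 0) + shrink 0 p)).
    by apply/funext => t; rewrite shrinkE scalerA.
  rewrite E; have Es : shrink s p = s *: (p 0 0 *: delta_mx 0 0) + shrink 0 p.
    by rewrite shrinkE scalerA.
  have dfs := df _ (sA _ Ap _ s01).
  have := @is_derive_line _ _ f (shrink 0 p) (p 0 0 *: delta_mx 0 0) s.
  rewrite -Es => /(_ (diff_derivable dfs)) H; apply: is_derive_eq H _.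
  by rewrite derive_scale// expr0 mul1r.
rewrite (unit_mean_derive (within_continuousZ c1) D).
by rewrite shrink1 addrC subrK.
Qed.

End Hadamard.

(** * The implicit function theorem for one real unknown *)

Lemma derive_coord (R : realType) n (x v : 'rV[R]_n) j :
  'D_v (fun p : 'rV[R]_n => p 0 j) x = v 0 j.
Proof.
have H : is_derive x v (fun p : 'rV[R]_n => p 0 j) (v 0 j).
  apply: line_is_derive.
  have -> : (fun s : R => (s *: v + x) 0 j) = v 0 j *: @id R + cst (x 0 j).
    by apply/funext => s; rewrite !fctE !mxE [v 0 j *: s]mulrC.
  have := @is_deriveD R R R _ (cst (x 0 j)) 0 1 _ _
    (@is_deriveZ R R R id (v 0 j) 0 1 1 (is_derive_id _ _)) (is_derive_cst _ _ _).
  by rewrite addr0 [_ *: 1]mulr1.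
by case: H.
Qed.

Lemma C_k_coord (R : realType) n k (A : set 'rV[R]_n) (j : 'I_n) : open A ->
  C_k k A (fun p => p 0 j).
Proof.
move=> oA; case: k => [|k]; first by move=> p _; exact: coord_continuous.
split=> [p _|v]; first exact: differentiable_coord.
by apply: C_k_eq (C_k_cst k (v 0 j) oA) => // p _; rewrite derive_coord.
Qed.

Lemma open_neq0 (R : realType) (V : normedModType R) (B : set V) (f : V -> R) :
  open B -> (forall x, B x -> {for x, continuous f}) ->
  open [set x | B x /\ f x != 0].
Proof.
move=> oB cf; rewrite openE => x [Bx fx]; apply: filterI.
  exact: open_nbhs_nbhs.
exact: (cf x Bx) (open_nbhs_nbhs (conj (open_neq (y := 0)) fx)).
Qed.

Section ImplicitFunction.
Variables (R : realType) (n : nat).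
Implicit Types (p v : 'rV[R]_n) (q : 'rV[R]_(1 + n)).

(** Both a point of R x R^3, for which it is convertible to [pair_mx], and such a
    point with an unknown t put in front of it. *)
Definition consr (t : R) p : 'rV[R]_(1 + n) := row_mx t%:M p.

Lemma consr_l t p j : consr t p 0 (lshift n j) = t.
Proof. by rewrite row_mxEl mxE !ord1. Qed.

Lemma consr_r t p j : consr t p 0 (rshift 1 j) = p 0 j.
Proof. by rewrite row_mxEr. Qed.

Lemma consrD t s p v : consr t p + consr s v = consr (t + s) (p + v).
Proof. by rewrite /consr add_row_mx raddfD. Qed.

Lemma consrZ (a : R) t p : a *: consr t p = consr (a * t) (a *: p).
Proof. by rewrite /consr scale_row_mx scale_scalar_mx. Qed.

Lemma consr_decomp t p : consr t p = t *: consr 1 0 + consr 0 p.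
Proof. by rewrite consrZ consrD mulr1 scaler0 addr0 add0r. Qed.

Lemma ord_split_ind (P : 'I_(1 + n) -> Prop) :
  (forall j, P (lshift n j)) -> (forall j, P (rshift 1 j)) -> forall j, P j.
Proof. by move=> Hl Hr j; case: (split_ordP j) => k ->. Qed.

Variables (A : set 'rV[R]_n) (B : set 'rV[R]_(1 + n)).
Variables (K : 'rV[R]_(1 + n) -> R) (tau : 'rV[R]_n -> R).
Hypotheses (oA : open A) (oB : open B) (smK : smooth_on B K).
Hypothesis tauB : forall p, A p -> B (consr (tau p) p).
Hypothesis tau0 : forall p, A p -> K (consr (tau p) p) = 0.
Hypothesis K0 : forall p, A p -> 'D_(consr 1 0) K (consr (tau p) p) != 0.
Hypothesis ctau : forall p, A p -> {for p, continuous tau}.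

(** Between the two points of the graph above p and t v + p the function K does
    not change, so by the mean value theorem its derivative along their difference
    vanishes somewhere on the segment; this gives the difference quotient of tau
    exactly. Continuity of tau is enough to pass to the limit. *)
Lemma is_derive_implicit p v : A p ->
  is_derive p v tau (- ('D_(consr 0 v) K (consr (tau p) p) /
                        'D_(consr 1 0) K (consr (tau p) p))).
Proof.
move=> Ap; pose q0 := consr (tau p) p.
pose Q q := 'D_(consr 0 v) K q / 'D_(consr 1 0) K q.
have Bq0 : B q0 by exact: tauB.
have [dK DK] := smK 1.
have cQ : {for q0, continuous Q}.
  apply: continuousM; first exact: DK.
  by apply: (@continuousV R _ ('D_(consr 1 0) K)); [exact: K0|exact: DK].
have oB' := open_neq0 oB (DK (consr 1 0)).
have B'q0 : [set q | B q /\ 'D_(consr 1 0) K q != 0] q0 by split=> //; exact: K0.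
pose D (t : R) := t^-1 *: ((tau \o shift p) (t *: v) - tau p).
suff H : D @ 0^' --> - Q q0.
  by split; [apply/cvg_ex; eexists; exact: H|exact: cvg_lim H].
apply/cvgrPdist_le => e e0.
have [d /= d0 good] := (nbhs_normP _ _).1
  (filterI (open_nbhs_nbhs (conj oB' B'q0)) ((cvgrPdist_le _ _).1 cQ e e0)).
have v0 : 0 < `|v| + 1 by rewrite ltr_wpDl.
have ct : \forall t \near (0 : R), `|tau p - tau (t *: v + p)| < d.
  have c1 : {for (0 : R), continuous (fun t : R => tau (t *: v + p))}.
    apply: (@continuous_comp _ _ _ (fun t : R => t *: v + p) tau).
      apply: continuousD; last exact: cvg_cst.
      exact: scalel_continuous.
    by rewrite scale0r add0r; exact: ctau.
  by have /cvgrPdist_lt/(_ d d0) := c1; rewrite scale0r add0r.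
have cA : \forall t \near (0 : R), A (t *: v + p).
  have c1 : {for (0 : R), continuous (fun t : R => t *: v + p)}.
    apply: continuousD; last exact: cvg_cst.
    exact: scalel_continuous.
  have := c1 A; rewrite scale0r add0r; apply.
  exact: open_nbhs_nbhs.
near=> t.
have t0 : t != 0 by near: t; exact: nbhs_dnbhs_neq.
have td : `|t| < d / (`|v| + 1) by near: t; apply: dnbhs0_lt; rewrite divr_gt0.
have tv : `|t| * `|v| < d.
  by move: td; rewrite ltr_pdivlMr//; apply: le_lt_trans; rewrite ler_wpM2l// lerDl.
have At : A (t *: v + p) by near: t; exact: (nbhs_dnbhs cA).
have tt : `|tau p - tau (t *: v + p)| < d by near: t; exact: (nbhs_dnbhs ct).
pose Dt := tau (t *: v + p) - tau p.
pose w := consr Dt (t *: v).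
have inb (c : R) : 0 <= c <= 1 -> ball_ Num.norm q0 d (c *: w + q0).
  move=> /andP[c0 c1]; rewrite /ball_/= opprD addrCA subrr addr0 normrN.
  rewrite normrZ (ger0_norm c0); apply: (@le_lt_trans _ _ `|w|); first exact: ler_piMl.
  have : `|w| <= Num.max `|Dt| (`|t| * `|v|).
    apply: norm_le_coord; first by rewrite le_max normr_ge0.
    elim/ord_split_ind => j; rewrite ?consr_l ?consr_r le_max ?lexx//.
    by rewrite mxE normrM ler_wpM2l ?norm_coord ?orbT.
  by move=> /le_lt_trans; apply; rewrite gt_max distrC tt.
have [c c01|c c01] := @MVT_dir R _ K q0 w.
  by have [[Bc _] _] := good _ (inb c c01); apply: diff_derivable; exact: dK.
have -> : w + q0 = consr (tau (t *: v + p)) (t *: v + p).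
  by rewrite /w /q0 consrD subrK.
rewrite !tau0// subrr.
have c01' : 0 <= c <= 1 by case/andP: c01 => /ltW-> /ltW->.
have [[Bc Kc] Qc] := good _ (inb c c01').
have wE : w = Dt *: consr 1 0 + t *: consr 0 v.
  by rewrite /w consr_decomp [t *: consr 0 v]consrZ mulr0.
move: (dK _ Bc) Kc Qc; set xi := c *: w + q0 => dKc Kc Qc.
rewrite [X in 'D_X K xi]wE derive_dirD// !derive_scale// => E.
have -> : D t = - Q xi.
  rewrite /D /Q /= -/Dt /GRing.scale/=.
  have -> : Dt = - (t * 'D_(consr 0 v) K xi) / 'D_(consr 1 0) K xi.
    by apply: (mulIf Kc); rewrite divfK//; apply/eqP; rewrite -subr_eq0 opprK -E.
  by field; rewrite t0 Kc.
by rewrite -normrN opprD !opprK.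
Unshelve. all: by end_near. Qed.

(** The derivatives of tau are smooth functions of tau and p, so each order of
    differentiability gives the next one. *)
Lemma smooth_implicit : smooth_on A tau.
Proof.
have [dK DK] := smK 1.
have oB' := open_neq0 oB (DK (consr 1 0)).
elim=> [|k IH]; first exact: ctau.
apply: C_kS_intro => // [p v Ap|v].
  exact: (@ex_derive _ _ _ _ _ _ _ (is_derive_implicit v Ap)).
pose Q q := -1 * ('D_(consr 0 v) K q * ('D_(consr 1 0) K q)^-1).
have sD w : C_k k [set q | B q /\ 'D_(consr 1 0) K q != 0] ('D_w K).
  by apply: (@C_k_subset _ _ _ _ B) => [q []//|]; exact: (smK k.+1).2.
have cQ : C_k k [set q | B q /\ 'D_(consr 1 0) K q != 0] Q.
  apply: C_kM => //; first exact: C_k_cst.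
  apply: C_kM => //; apply: C_kV => // q [] //.
have := @C_k_comp R _ _ k A _ (fun p => consr (tau p) p) Q oA oB' _ _ cQ.
move=> H; apply: C_k_eq (H _ _) => //.
- move=> p Ap; have [_ ->] := is_derive_implicit v Ap.
  by rewrite /Q mulN1r.
- by move=> p Ap; split; [exact: tauB|exact: K0].
elim/ord_split_ind => j.
  by apply: C_k_eq IH => // p _; rewrite consr_l.
by apply: C_k_eq (C_k_coord k j oA) => // p _; rewrite consr_r.
Qed.

End ImplicitFunction.

(** * Functions on an interval times the sphere *)

Section SphereBasics.
Variable R : realType.
Implicit Types (x y v w : 'rV[R]_3).

Lemma dotE v w : dot v w = \sum_(i < 3) v 0 i * w 0 i.
Proof. by rewrite /dot mxE; apply: eq_bigr => i _; rewrite mxE. Qed.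

Lemma dot_delta v i : dot v (delta_mx 0 i) = v 0 i.
Proof.
rewrite dotE (bigD1 i)//= [X in _ * X]mxE !eqxx mulr1 big1 ?addr0// => k ki.
by rewrite mxE (negbTE ki) andbF mulr0.
Qed.

Lemma dot_ge0 x : 0 <= dot x x.
Proof. by rewrite dotE sumr_ge0// => i _; rewrite -expr2 sqr_ge0. Qed.

Lemma dot_gt0 x : x != 0 -> 0 < dot x x.
Proof.
move=> x0; rewrite lt_neqAle dot_ge0 andbT eq_sym; apply: contra x0.
rewrite dotE psumr_eq0 => [/allP H|i _]; last by rewrite -expr2 sqr_ge0.
apply/eqP/rowP => i; have := H i (mem_index_enum _).
by rewrite /= -expr2 sqrf_eq0 mxE => /eqP.
Qed.

Lemma enorm_gt0 x : x != 0 -> 0 < enorm x.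
Proof. by move=> /dot_gt0; rewrite sqrtr_gt0. Qed.

Lemma sqr_enorm x : enorm x ^+ 2 = dot x x.
Proof. by rewrite sqr_sqrtr// dot_ge0. Qed.

Lemma enormZ (c : R) x : 0 <= c -> enorm (c *: x) = c * enorm x.
Proof.
move=> c0; rewrite /enorm; have -> : dot (c *: x) (c *: x) = c ^+ 2 * dot x x.
  by rewrite !dotE big_distrr/=; apply: eq_bigr => i _; rewrite !mxE; ring.
by rewrite sqrtrM ?sqr_ge0// sqrtr_sqr ger0_norm.
Qed.

Lemma sproj_scale (c : R) x : 0 < c -> sproj (c *: x) = sproj x.
Proof.
move=> c0; rewrite /sproj enormZ ?ltW// scalerA invfM mulrAC mulVf ?mul1r//.
by rewrite gt_eqF.
Qed.

Lemma enorm_sphere y : sphere y -> enorm y = 1.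
Proof. by rewrite /sphere/= /enorm => ->; rewrite sqrtr1. Qed.

Lemma sproj_sphere y : sphere y -> sproj y = y.
Proof. by move=> /enorm_sphere E; rewrite /sproj E invr1 scale1r. Qed.

Lemma sphere_neq0 y : sphere y -> y != 0.
Proof.
apply: contraPneq => ->; rewrite /sphere/= dotE big1 => [/eqP|i _]; last by rewrite mxE mul0r.
by rewrite eq_sym oner_eq0.
Qed.

Lemma sphere_sproj x : x != 0 -> sphere (sproj x).
Proof.
move=> x0; rewrite /sphere/= -sqr_enorm /sproj enormZ; last by rewrite invr_ge0 sqrtr_ge0.
by rewrite mulVf ?expr1n// gt_eqF ?enorm_gt0.
Qed.

Lemma sprojK x : x != 0 -> sproj (sproj x) = sproj x.
Proof. by move=> /sphere_sproj/sproj_sphere. Qed.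

Lemma sproj_decomp x : x != 0 -> x = enorm x *: sproj x.
Proof. by move=> x0; rewrite /sproj scalerA divff ?scale1r// gt_eqF ?enorm_gt0. Qed.

Lemma open_nonzero : open [set x : 'rV[R]_3 | x != 0].
Proof.
have -> : [set x : 'rV[R]_3 | x != 0] =
    \bigcup_i [set x : 'rV[R]_3 | setT x /\ (fun x => x 0 i) x != 0].
  apply/seteqP; split => x /=.
    move=> /eqP x0; apply: contrapT => H; apply: x0; apply/rowP => i; rewrite mxE.
    by apply: contrapT => xi; apply: H; exists i => //; split=> //; apply/eqP.
  by move=> [i _ [_]]; apply: contra => /eqP ->; rewrite mxE.
apply: bigcup_open => i _; apply: open_neq0; first exact: openT.
by move=> x _; exact: coord_continuous.
Qed.

Lemma C_k_dot (V : normedModType R) k (A : set V) (phi : V -> 'rV[R]_3) : open A ->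
  (forall j, C_k k A (fun p => phi p 0 j)) -> C_k k A (fun p => dot (phi p) (phi p)).
Proof.
move=> oA cphi.
apply: C_k_eq (C_k_sum oA (fun j => C_kM oA (cphi j) (cphi j))) => // p _.
by rewrite dotE.
Qed.

Lemma C_k_enorm (V : normedModType R) k (A : set V) (phi : V -> 'rV[R]_3) : open A ->
  (forall p, A p -> phi p != 0) ->
  (forall j, C_k k A (fun p => phi p 0 j)) -> C_k k A (fun p => enorm (phi p)).
Proof.
move=> oA p0 cphi; apply: C_k_sqrt => //; last exact: C_k_dot.
by move=> p Ap; apply: dot_gt0; exact: p0.
Qed.

Lemma derive_enorm x v : x != 0 -> 'D_v (@enorm R) x = dot x v / enorm x.
Proof.
move=> x0; have cd (w : 'rV[R]_3) (j : 'I_3) : derivable (fun p : 'rV[R]_3 => p 0 j) x w.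
  by apply: diff_derivable; exact: differentiable_coord.
have Dd : 'D_v (fun z : 'rV[R]_3 => dot z z) x = 2 * dot x v.
  have -> : (fun z : 'rV[R]_3 => dot z z) =
      \sum_(j < 3) (fun z : 'rV[R]_3 => z 0 j * z 0 j).
    by apply/funext => z; rewrite dotE fct_sumE.
  rewrite derive_sum => [|j]; last exact: derivableM.
  rewrite dotE big_distrr/=; apply: eq_bigr => j _.
  by rewrite [LHS]deriveM// derive_coord /GRing.scale/=; ring.
have dd : differentiable (fun z : 'rV[R]_3 => dot z z) x.
  by have [H _] := @C_k_dot 'rV[R]_3 1 setT id openT (fun j => C_k_coord 1 j openT);
  exact: H.
have [_ ->] := @derive_comp1 _ _ _ (fun z => dot z z) x v _ (is_derive1_sqrt (dot_gt0 x0)) dd.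
by rewrite Dd -/(enorm x); field; rewrite gt_eqF// enorm_gt0.
Qed.

Lemma C_k_sproj (V : normedModType R) k (A : set V) (phi : V -> 'rV[R]_3) j : open A ->
  (forall p, A p -> phi p != 0) ->
  (forall j, C_k k A (fun p => phi p 0 j)) -> C_k k A (fun p => sproj (phi p) 0 j).
Proof.
move=> oA p0 cphi.
have c1 := C_k_enorm oA p0 cphi.
have c2 : C_k k A (fun p => (enorm (phi p))^-1).
  by apply: C_kV => // p Ap; rewrite gt_eqF// enorm_gt0// p0.
by apply: C_k_eq (C_kM oA c2 (cphi j)) => // p _; rewrite mxE.
Qed.

End SphereBasics.

Section Cylinder.
Variable R : realType.
Implicit Types (x y v w : 'rV[R]_3) (p : 'rV[R]_(1 + 3)) (a b s : R).
Implicit Types (Phi Psi : R -> 'rV[R]_3 -> R).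

Definition cyl_dom a b : set 'rV[R]_(1 + 3) :=
  [set p | a < lsubmx p 0 0 < b /\ rsubmx p != 0].

Lemma consr_lsub s x : lsubmx (consr s x) 0 0 = s.
Proof. by rewrite row_mxKl mxE. Qed.

Lemma consr_rsub s x : rsubmx (consr s x) = x.
Proof. by rewrite row_mxKr. Qed.

Lemma consr_eta p : p = consr (lsubmx p 0 0) (rsubmx p).
Proof. by rewrite /consr -mx11_scalar hsubmxK. Qed.

Lemma cyl_consr Phi s x : cyl Phi (consr s x) = Phi s (sproj x).
Proof. by rewrite /cyl consr_lsub consr_rsub. Qed.

Lemma cyl_sphere Phi s y : sphere y -> cyl Phi (consr s y) = Phi s y.
Proof. by move=> /sproj_sphere E; rewrite cyl_consr E. Qed.

Lemma cyl_domE a b s x : cyl_dom a b (consr s x) <-> a < s < b /\ x != 0.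
Proof. by rewrite /cyl_dom/= consr_lsub consr_rsub. Qed.

Lemma cyl_dom_sphere a b s y : a < s < b -> sphere y -> cyl_dom a b (consr s y).
Proof. by move=> sab /sphere_neq0 y0; apply/cyl_domE. Qed.

Lemma C_k_lsub k (A : set 'rV[R]_(1 + 3)) : open A -> C_k k A (fun p => lsubmx p 0 0).
Proof. by move=> oA; apply: C_k_eq (C_k_coord k (lshift 3 0) oA) => // p _; rewrite mxE. Qed.

Lemma C_k_rsub k (A : set 'rV[R]_(1 + 3)) j : open A -> C_k k A (fun p => rsubmx p 0 j).
Proof. by move=> oA; apply: C_k_eq (C_k_coord k (rshift 1 j) oA) => // p _; rewrite mxE. Qed.

Lemma open_cyl_dom a b : open (cyl_dom a b).
Proof.
rewrite openE => p [/andP[pa pb] px].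
have cl : {for p, continuous (fun q : 'rV[R]_(1 + 3) => lsubmx q 0 0)}.
  exact: C_k_continuous (C_k_lsub 0 openT) I.
have cr : {for p, continuous (fun q : 'rV[R]_(1 + 3) => rsubmx q)}.
  by apply: continuous_row => j; exact: C_k_continuous (C_k_rsub 0 j openT) I.
have h1 : \forall q \near p, a < lsubmx q 0 0.
  exact: cl (open_nbhs_nbhs (conj (open_gt (y := a)) pa)).
have h2 : \forall q \near p, lsubmx q 0 0 < b.
  exact: cl (open_nbhs_nbhs (conj (open_lt (y := b)) pb)).
have h3 : \forall q \near p, rsubmx q != 0.
  exact: cr (open_nbhs_nbhs (conj (@open_nonzero R) px)).
by apply: filterS (filterI h1 (filterI h2 h3)) => q [q1 [q2 q3]]; rewrite /cyl_dom/= q1 q2.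
Qed.

Definition dEta Phi : R -> 'rV[R]_3 -> R := fun s y => derive1 (Phi ^~ y) s.
Definition dSph (i : 'I_3) Phi : R -> 'rV[R]_3 -> R := fun s y => sph_deriv i (Phi s) y.

Notation eE := (consr 1 (0 : 'rV[R]_3)).
Notation eS i := (consr 0 (delta_mx 0 i : 'rV[R]_3)).

Lemma cyl_dEta Phi p : cyl (dEta Phi) p = 'D_eE (cyl Phi) p.
Proof.
rewrite /cyl /dEta derive1E; apply: derive_ext => h.
rewrite [in RHS](consr_eta p) consrZ consrD mulr1 scaler0 add0r.
by rewrite consr_lsub consr_rsub [h *: 1]mulr1.
Qed.

Lemma dEtaE Phi s y : sphere y -> dEta Phi s y = 'D_eE (cyl Phi) (consr s y).
Proof. by move=> Sy; rewrite -cyl_dEta cyl_sphere. Qed.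

Lemma dSphE i Phi s y : dSph i Phi s y = 'D_(eS i) (cyl Phi) (consr s y).
Proof.
rewrite /dSph /sph_deriv; apply: derive_ext => h.
by rewrite consrZ consrD mulr0 add0r !cyl_consr.
Qed.

(** A 0-homogeneous function has derivatives of degree -1, hence the factor. *)
Lemma dSph_homog i Phi s x : x != 0 -> differentiable (cyl Phi) (consr s x) ->
  dSph i Phi s (sproj x) = enorm x * 'D_(eS i) (cyl Phi) (consr s x).
Proof.
move=> x0 dPhi; rewrite dSphE -derive_scale//.
apply: derive_ext => h.
rewrite !consrZ !consrD !mulr0 !add0r !cyl_consr; congr (Phi _ _).
have -> : h *: (enorm x *: delta_mx 0 i) + x = enorm x *: (h *: delta_mx 0 i + sproj x).
  by rewrite scalerDr -sproj_decomp// !scalerA mulrC.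
by rewrite sproj_scale// enorm_gt0.
Qed.

Section Smooth.
Variables a b : R.
Let D := cyl_dom a b.
Let oD : open D := @open_cyl_dom a b.

Lemma smooth_diff Phi s x : smooth_cyl a b Phi -> a < s < b -> x != 0 ->
  differentiable (cyl Phi) (consr s x).
Proof. by move=> sm sab x0; apply: (sm 1%N).1; apply/cyl_domE. Qed.

Lemma smooth_cyl_eq Phi Psi : (forall s y, a < s < b -> sphere y -> Phi s y = Psi s y) ->
  smooth_cyl a b Phi -> smooth_cyl a b Psi.
Proof.
move=> E sm k; apply: C_k_eq (sm k) => // p [ps px].
by apply: E => //; exact: sphere_sproj.
Qed.

Lemma smooth_cst (c : R) : smooth_cyl a b (fun _ _ => c).
Proof. by move=> k; exact: C_k_cst. Qed.

Lemma smooth_add Phi Psi : smooth_cyl a b Phi -> smooth_cyl a b Psi ->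
  smooth_cyl a b (fun s y => Phi s y + Psi s y).
Proof. by move=> s1 s2 k; exact: C_kD. Qed.

Lemma smooth_mul Phi Psi : smooth_cyl a b Phi -> smooth_cyl a b Psi ->
  smooth_cyl a b (fun s y => Phi s y * Psi s y).
Proof. by move=> s1 s2 k; exact: C_kM. Qed.

Lemma smooth_sum n (Phi : 'I_n -> R -> 'rV[R]_3 -> R) :
  (forall i, smooth_cyl a b (Phi i)) ->
  smooth_cyl a b (fun s y => \sum_(i < n) Phi i s y).
Proof. by move=> s1 k; apply: C_k_sum => // i; exact: s1. Qed.

Lemma smooth_eta : smooth_cyl a b (fun s _ => s).
Proof. by move=> k; exact: C_k_lsub. Qed.

Lemma smooth_coord i : smooth_cyl a b (fun _ y => y 0 i).
Proof.
move=> k; apply: (@C_k_sproj _ _ _ _ (fun p => rsubmx p)) => // [p []//|j].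
exact: C_k_rsub.
Qed.

Lemma smooth_dEta Phi : smooth_cyl a b Phi -> smooth_cyl a b (dEta Phi).
Proof.
move=> sm k; have -> : cyl (dEta Phi) = 'D_eE (cyl Phi).
  by apply/funext => p; exact: cyl_dEta.
exact: (sm k.+1).2.
Qed.

Lemma cyl_dSph i Phi p : smooth_cyl a b Phi -> D p ->
  cyl (dSph i Phi) p = enorm (rsubmx p) * 'D_(eS i) (cyl Phi) p.
Proof.
move=> sm; rewrite (consr_eta p) => /cyl_domE[ps px].
by rewrite consr_rsub cyl_consr dSph_homog//; exact: smooth_diff.
Qed.

Lemma smooth_dSph i Phi : smooth_cyl a b Phi -> smooth_cyl a b (dSph i Phi).
Proof.
move=> sm k.
have c1 : C_k k D (fun p => enorm (rsubmx p)).
  by apply: C_k_enorm => // [p []//|j]; exact: C_k_rsub.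
apply: C_k_eq (C_kM oD c1 ((sm k.+1).2 (eS i))) => // p Dp.
by rewrite (cyl_dSph i sm Dp).
Qed.

End Smooth.
End Cylinder.

Section CylinderCalculus.
Variable R : realType.
Implicit Types (x y v w : 'rV[R]_3) (p : 'rV[R]_(1 + 3)).
Implicit Types (Phi Psi : R -> 'rV[R]_3 -> R).

Notation eE := (consr 1 (0 : 'rV[R]_3)).
Notation eS i := (consr 0 (delta_mx 0 i : 'rV[R]_3)).

Lemma dSph_congr i Phi Psi s y : (forall z, sphere z -> Phi s z = Psi s z) ->
  sphere y -> dSph i Phi s y = dSph i Psi s y.
Proof.
move=> E Sy; apply: near_eq_derive.
apply: (open_near (@open_nonzero R) (sphere_neq0 Sy)) => z z0 /=.
by apply: E; exact: sphere_sproj.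
Qed.

Lemma dSph_radial i (h : R -> R) s y : dSph i (fun s _ => h s) s y = 0.
Proof. exact: derive_cst. Qed.

Variables a b : R.

Lemma dEta_congr Phi Psi s y : a < s < b ->
  (forall s', a < s' < b -> Phi s' y = Psi s' y) -> dEta Phi s y = dEta Psi s y.
Proof.
move=> sab E; rewrite /dEta !derive1E; apply: near_eq_derive.
have H : \forall s' \near s, s' \in `]a, b[ by apply: near_in_itvoo; rewrite in_itv.
by apply: filterS H => s'; rewrite in_itv/=; exact: E.
Qed.

Section Point.
Variables (s : R) (y : 'rV[R]_3).
Hypotheses (sab : a < s < b) (Sy : sphere y).

Let dcyl Phi (sm : smooth_cyl a b Phi) : differentiable (cyl Phi) (consr s y) :=
  smooth_diff sm sab (sphere_neq0 Sy).

Lemma derivable_eta Phi : smooth_cyl a b Phi -> derivable (Phi ^~ y) s 1.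
Proof.
move=> /dcyl d; have := @is_derive_line _ _ _ (consr 0 y) eE s.
have E t : t *: eE + consr 0 y = consr t y by rewrite consrZ consrD mulr1 scaler0 addr0 add0r.
rewrite E => /(_ _ (diff_derivable d)) [+ _].
have -> // : Phi ^~ y = (fun t => cyl Phi (t *: eE + consr 0 y)).
by apply/funext => t; rewrite E cyl_sphere.
Qed.

Lemma dEta_add Phi Psi : smooth_cyl a b Phi -> smooth_cyl a b Psi ->
  dEta (fun s y => Phi s y + Psi s y) s y = dEta Phi s y + dEta Psi s y.
Proof.
by move=> /derivable_eta d1 /derivable_eta d2; rewrite /dEta !derive1E; exact: deriveD d1 d2.
Qed.

Lemma dEta_mul Phi Psi : smooth_cyl a b Phi -> smooth_cyl a b Psi ->
  dEta (fun s y => Phi s y * Psi s y) s y = Phi s y * dEta Psi s y + Psi s y * dEta Phi s y.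
Proof.
by move=> /derivable_eta d1 /derivable_eta d2; rewrite /dEta !derive1E; exact: deriveM d1 d2.
Qed.

Lemma dEta_sum n (Phi : 'I_n -> R -> 'rV[R]_3 -> R) :
  (forall i, smooth_cyl a b (Phi i)) ->
  dEta (fun s y => \sum_(i < n) Phi i s y) s y = \sum_(i < n) dEta (Phi i) s y.
Proof.
move=> sm; rewrite /dEta derive1E.
have -> : (fun s => \sum_(i < n) Phi i s y) = \sum_(i < n) (fun s => Phi i s y).
  by apply/funext => t; rewrite fct_sumE.
rewrite derive_sum => [|i]; last exact: derivable_eta.
by apply: eq_bigr => i _; rewrite derive1E.
Qed.

Lemma dSph_add i Phi Psi : smooth_cyl a b Phi -> smooth_cyl a b Psi ->
  dSph i (fun s y => Phi s y + Psi s y) s y = dSph i Phi s y + dSph i Psi s y.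
Proof.
move=> /dcyl d1 /dcyl d2; rewrite !dSphE.
by rewrite -deriveD//; exact: diff_derivable.
Qed.

Lemma dSph_mul i Phi Psi : smooth_cyl a b Phi -> smooth_cyl a b Psi ->
  dSph i (fun s y => Phi s y * Psi s y) s y = Phi s y * dSph i Psi s y + Psi s y * dSph i Phi s y.
Proof.
move=> /dcyl d1 /dcyl d2; rewrite !dSphE -(cyl_sphere Phi s Sy) -(cyl_sphere Psi s Sy).
by rewrite -[RHS]deriveM//; exact: diff_derivable.
Qed.

Lemma consr_delta (i : 'I_3) : eS i = delta_mx 0 (rshift 1 i) :> 'rV[R]_(1 + 3).
Proof.
apply/rowP; elim/ord_split_ind => j; rewrite ?consr_l ?consr_r !mxE eqxx/=.
  by rewrite eq_lrshift.
by rewrite eq_rshift.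
Qed.

Lemma consr_delta0 : eE = delta_mx 0 (lshift 3 0) :> 'rV[R]_(1 + 3).
Proof.
apply/rowP; elim/ord_split_ind => j; rewrite ?consr_l ?consr_r !mxE ?eqxx//=.
by rewrite (ord1 j) eqxx.
Qed.

Lemma derive_consr (f : 'rV[R]_(1 + 3) -> R) p (t : R) v : differentiable f p ->
  'D_(consr t v) f p = t * 'D_eE f p + \sum_(i < 3) v 0 i * 'D_(eS i) f p.
Proof.
move=> df; rewrite derive_sum_coord// big_split_ord big_ord1 /= consr_l consr_delta0.
by congr (_ + _); apply: eq_bigr => i _; rewrite consr_r consr_delta.
Qed.

(** The Euler identity: a 0-homogeneous function is constant along rays. *)
Lemma euler_dSph Phi : smooth_cyl a b Phi -> \sum_(i < 3) y 0 i * dSph i Phi s y = 0.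
Proof.
move=> /dcyl d; transitivity ('D_(consr 0 y) (cyl Phi) (consr s y)).
  by rewrite derive_consr// mul0r add0r; apply: eq_bigr => i _; rewrite dSphE.
rewrite (@derive_ext _ _ R _ (fun h => cyl Phi (h *: consr 0 y + consr s y)) _ _ 0 1).
  rewrite -[RHS](@derive_cst R R R (Phi s y) 0 1); apply: near_eq_derive.
  near=> h; rewrite consrZ consrD mulr0 add0r cyl_consr.
  have -> : h *: y + y = (h + 1) *: y by rewrite scalerDl scale1r.
  rewrite sproj_scale ?sproj_sphere// -ltrBlDr sub0r.
  by near: h; apply: lt_nbhsr; rewrite ltrN10.
by move=> h; rewrite [h *: 1]mulr1 addr0.
Unshelve. all: by end_near. Qed.

Lemma dSph_coord i j : dSph i (fun _ y => y 0 j) s y = (i == j)%:R - y 0 i * y 0 j.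
Proof.
rewrite /dSph /sph_deriv.
pose g (x : 'rV[R]_3) := (enorm x)^-1; pose c (x : 'rV[R]_3) := x 0 j.
have -> : (fun y : 'rV[R]_3 => y 0 j) \o @sproj R = (fun x => g x * c x).
  by apply/funext => x; rewrite /= mxE.
have y0 := sphere_neq0 Sy.
have o0 := @open_nonzero R.
have ce : C_k 1 [set x : 'rV[R]_3 | x != 0] (@enorm R).
  by apply: (@C_k_enorm _ _ _ _ id) => // k; exact: C_k_coord.
have dg : differentiable g y.
  by apply: differentiableV; [exact: ce.1|rewrite gt_eqF// enorm_gt0].
have dc : differentiable c y by exact: differentiable_coord.
rewrite [LHS]deriveM; [|exact: diff_derivable..].
have Dc : 'D_(delta_mx 0 i) c y = (i == j)%:R.
  by rewrite derive_coord mxE eqxx eq_sym.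
have Dg : 'D_(delta_mx 0 i) g y = - y 0 i.
  rewrite [LHS]deriveV; [|by rewrite gt_eqF// enorm_gt0|apply: diff_derivable; exact: ce.1].
  by rewrite derive_enorm// enorm_sphere// expr1n !invr1 mulr1 scaleN1r dot_delta.
rewrite Dc Dg /g enorm_sphere// invr1 /c.
by rewrite /GRing.scale/= mul1r mulrN mulrC.
Qed.

Lemma dSph_mul_coord i Phi : smooth_cyl a b Phi ->
  dSph i (fun s y => Phi s y * y 0 i) s y =
  Phi s y * (1 - y 0 i * y 0 i) + y 0 i * dSph i Phi s y.
Proof.
move=> sm; rewrite (dSph_mul i sm (@smooth_coord _ _ _ i)).
by rewrite (dSph_coord i i) eqxx.
Qed.

(** The two operators are directional derivatives up to the factor |x| of
    [dSph_homog], which does not depend on s. *)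
Lemma dEta_dSph i Phi : smooth_cyl a b Phi -> dEta (dSph i Phi) s y = dSph i (dEta Phi) s y.
Proof.
move=> sm; have oD := @open_cyl_dom _ a b.
have Dsy := cyl_dom_sphere sab Sy.
rewrite (dEtaE (dSph i Phi) s Sy) (dSphE i (dEta Phi)).
have -> : cyl (dEta Phi) = 'D_eE (cyl Phi) by apply/funext => p; exact: cyl_dEta.
rewrite -(derive_swap eE (eS i) oD Dsy (sm 2%N)).
transitivity ('D_eE (fun p => enorm (rsubmx p) * 'D_(eS i) (cyl Phi) p) (consr s y)).
  apply: near_eq_derive; apply: (open_near oD Dsy) => p Dp.
  exact: (cyl_dSph i sm Dp).
have ce : C_k 1 (cyl_dom a b) (fun p => enorm (rsubmx p)).
  by apply: C_k_enorm => // [p []//|j]; exact: C_k_rsub.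
rewrite [LHS]deriveM; last 2 first.
- by apply: diff_derivable; exact: ce.1.
- by apply: diff_derivable; apply: ((sm 2%N).2 (eS i)).1.
rewrite consr_rsub enorm_sphere//.
have -> : 'D_eE (fun p : 'rV[R]_(1 + 3) => enorm (rsubmx p)) (consr s y) = 0.
  rewrite -[RHS](@derive_cst R R R (enorm y) 0 1); apply: derive_ext => h.
  by rewrite consrZ consrD scaler0 add0r consr_rsub.
by rewrite scaler0 addr0 scale1r.
Qed.

End Point.
End CylinderCalculus.

Section Height.
Variables (R : realType) (m : R).
Hypothesis m0 : 0 < m.
Implicit Types (x y v w : 'rV[R]_3) (Phi : R -> 'rV[R]_3 -> R).

Lemma eta_arg_gt0 x : 2 * m < enorm x -> 0 < 1 - 2 * m / enorm x.
Proof.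
move=> rx; have r0 : 0 < enorm x by apply: lt_trans rx; rewrite mulr_gt0.
by rewrite subr_gt0 ltr_pdivrMr// mul1r.
Qed.

Lemma outside_neq0 x : 2 * m < enorm x -> x != 0.
Proof.
move=> rx; apply: contraTneq rx => ->; rewrite -leNgt /enorm dotE big1.
  by rewrite sqrtr0 mulr_ge0// ltW.
by move=> i _; rewrite mxE mul0r.
Qed.

(** The derivative comes from eta^2 = 1 - 2m / r, that is, d eta / dr = m / (r^2 eta). *)
Lemma differentiable_eta x : 2 * m < enorm x ->
  differentiable (fun z => eta m (enorm z)) x /\
  forall v, 'D_v (fun z => eta m (enorm z)) x =
    m / (enorm x ^+ 2 * eta m (enorm x)) * dot (sproj x) v.
Proof.
move=> rx; have x0 := outside_neq0 rx; have r0 := enorm_gt0 x0.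
have a0 := eta_arg_gt0 rx.
have de : differentiable (@enorm R) x.
  have [H _] := @C_k_enorm _ _ 1 [set x : 'rV[R]_3 | x != 0] id (@open_nonzero R)
     (fun _ h => h) (fun j => C_k_coord 1 j (@open_nonzero R)).
  exact: H.
pose f (z : 'rV[R]_3) := 1 - 2 * m * (enorm z)^-1.
have dV : differentiable (fun z : 'rV[R]_3 => (enorm z)^-1) x.
  by apply: differentiableV => //; rewrite gt_eqF.
have dM : differentiable (fun z : 'rV[R]_3 => 2 * m * (enorm z)^-1) x.
  by apply: differentiableM => //; exact: differentiable_cst.
have df : differentiable f x by apply: differentiableB => //; exact: differentiable_cst.
have Df v : 'D_v f x = 2 * m / enorm x ^+ 2 * dot (sproj x) v.
  rewrite [LHS]deriveB; [|exact: diff_derivable..].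
  rewrite derive_cst sub0r [X in - X]deriveM; [|exact: diff_derivable..].
  rewrite derive_cst scaler0 addr0 deriveV; [|by rewrite gt_eqF|exact: diff_derivable].
  rewrite derive_enorm// /GRing.scale/=.
  have -> : dot (sproj x) v = (enorm x)^-1 * dot x v.
    by rewrite !dotE big_distrr/=; apply: eq_bigr => i _; rewrite mxE mulrA.
  by field; rewrite gt_eqF.
have s0 : 0 < eta m (enorm x) by rewrite sqrtr_gt0.
have H v := @derive_comp1 _ _ _ f x v _ (is_derive1_sqrt a0) df.
split=> [|v]; first by have [] := H 0.
have [_ Hv] := H v; rewrite [LHS]Hv.
by rewrite Df -/(eta m (enorm x)); field; rewrite !gt_eqF.
Qed.

(** The chain rule for x |-> (eta(|x|), x). *)
Lemma derive_height Phi x : 2 * m < enorm x ->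
  differentiable (cyl Phi) (consr (eta m (enorm x)) x) ->
  differentiable (height m Phi) x /\
  forall i, 'D_(delta_mx 0 i) (height m Phi) x =
    m / (enorm x ^+ 2 * eta m (enorm x)) * sproj x 0 i * height m (dEta Phi) x +
    (enorm x)^-1 * height m (dSph i Phi) x.
Proof.
move=> rx dPhi; have x0 := outside_neq0 rx; have r0 := enorm_gt0 x0.
have [de De] := differentiable_eta rx.
pose phi (z : 'rV[R]_3) : 'rV[R]_(1 + 3) := consr (eta m (enorm z)) z.
have E : height m Phi = (fun z => cyl Phi (phi z)).
  by apply/funext => z; rewrite /phi cyl_consr.
have dphi j : differentiable (fun z => phi z 0 j) x.
  elim/ord_split_ind: j => j; rewrite /phi.
    by under eq_fun do rewrite consr_l.
  by under eq_fun do rewrite consr_r; exact: differentiable_coord.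
have dphi' := differentiable_row dphi.
have H v := @derive_comp_row _ _ _ phi (cyl Phi) x v dphi dPhi.
rewrite E; split=> [|i]; first by have [] := H 0.
have [_ ->] := H (delta_mx 0 i).
rewrite big_split_ord big_ord1 /= /phi.
under eq_fun do rewrite consr_l.
rewrite De -consr_delta0 -cyl_dEta cyl_consr; congr (_ * _ + _).
  by rewrite dot_delta.
rewrite (bigD1 i)//= big1 => [|k ki].
  under eq_fun do rewrite consr_r.
  rewrite derive_coord mxE !eqxx mul1r addr0 -consr_delta.
  by rewrite /height dSph_homog// mulKf// gt_eqF.
under eq_fun do rewrite consr_r.
by rewrite derive_coord mxE (negbTE ki) andbF mul0r.
Qed.

End Height.

(** * The Schwarzschild metric and the unit normal of a graph *)

(** Two block triangular factorizations of the same matrix. *)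
Lemma det_rank1 (R : comNzRingType) n (a : 'rV[R]_n) (b : 'cV[R]_n) :
  \det (1%:M - b *m a) = 1 - (a *m b) 0 0.
Proof.
pose M := block_mx (1%:M : 'M[R]_1) a b (1%:M : 'M[R]_n).
have M1 : M = block_mx 1%:M 0 b 1%:M *m block_mx 1%:M a 0 (1%:M - b *m a).
  by rewrite mulmx_block !mul1mx !mul0mx !mulmx1 !addr0 [b *m a + _]addrC subrK.
have M2 : M = block_mx (1%:M - a *m b) a 0 1%:M *m block_mx 1%:M 0 b 1%:M.
  by rewrite mulmx_block !mul1mx !mul0mx !mulmx1 !mulmx0 !add0r subrK.
have := congr1 determinant M1; rewrite M2 !det_mulmx.
rewrite !det_lblock !det_ublock !det1 !mul1r !mulr1 => <-.
by rewrite det_mx11 !mxE.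
Qed.

Section DotAlgebra.
Variable R : realType.
Implicit Types (x y v w : 'rV[R]_3).

Lemma dotC v w : dot v w = dot w v.
Proof. by rewrite !dotE; apply: eq_bigr => i _; rewrite mulrC. Qed.

Lemma dotDl v v' w : dot (v + v') w = dot v w + dot v' w.
Proof. by rewrite /dot mulmxDl mxE. Qed.

Lemma dotZl (c : R) v w : dot (c *: v) w = c * dot v w.
Proof. by rewrite /dot -scalemxAl mxE. Qed.

Lemma dotDr v v' w : dot w (v + v') = dot w v + dot w v'.
Proof. by rewrite dotC dotDl !(dotC w). Qed.

Lemma dotZr (c : R) v w : dot w (c *: v) = c * dot w v.
Proof. by rewrite dotC dotZl dotC. Qed.

End DotAlgebra.

Section NormalVector.
Variables (R : realType) (m : R).
Hypothesis m0 : 0 < m.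
Implicit Types (x y v w : 'rV[R]_3) (u Phi : R -> 'rV[R]_3 -> R).

Lemma pairing_schwarzschild (t : R) x (a b : 'rV[R]_(1 + 3)) :
  pairing (schwarzschild m (pair_mx t x)) a b =
  - (1 - 2 * m / enorm x) * lsubmx a 0 0 * lsubmx b 0 0
  + dot (rsubmx a) (rsubmx b)
  + ((1 - 2 * m / enorm x)^-1 - 1) / enorm x ^+ 2 *
    (dot (rsubmx a) x * dot x (rsubmx b)).
Proof.
rewrite /pairing /schwarzschild row_mxKr.
set f := 1 - _; set c := (f^-1 - 1) / _.
rewrite -[in LHS](hsubmxK a) -[in LHS](hsubmxK b) tr_row_mx mul_row_block mul_row_col.
rewrite !mulmx0 addr0 add0r mulmxDr mulmx1 mulmxDl -scalemxAr -scalemxAl !mulmxA.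
rewrite -[rsubmx a *m x^T *m x *m _]mulmxA addrA.
rewrite 2!mxE [X in _ + X]mxE; congr (_ + _ + _ * _).
  by rewrite mul_mx_scalar -scalemxAl [LHS]mxE [X in _ * X]mxE big_ord1 [X in _ * (_ * X)]mxE mulrA.
by rewrite [LHS]mxE big_ord1.
Qed.

(** The space block is a rank one perturbation of the identity, of determinant
    1 / f where f = 1 - 2m / r; so the volume density is 1 in these coordinates. *)
Lemma det_schwarzschild (t : R) x : 2 * m < enorm x ->
  \det (schwarzschild m (pair_mx t x)) = -1.
Proof.
move=> rx; rewrite /schwarzschild row_mxKr.
set f := 1 - _; set c := (f^-1 - 1) / _.
have f0 : f != 0 by rewrite gt_eqF// eta_arg_gt0.
have r0 := enorm_gt0 (outside_neq0 m0 rx).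
rewrite det_lblock det_mx11 mxE eqxx mulr1n.
have -> : 1%:M + c *: (x^T *m x) = 1%:M - (- c *: x^T) *m x.
  by rewrite -scalemxAl scaleNr opprK.
rewrite det_rank1 -scalemxAr [X in _ - X]mxE -/(dot x x) -sqr_enorm [- c * _]mulNr opprK.
by rewrite /c divfK ?expf_neq0 ?gt_eqF// addrC subrK mulNr mulfV.
Qed.

(** The linear algebra of the unit normal (n0, N) at x = r y, for f = 1 - 2m / r and a
    height whose gradient has radial part B y and tangential part w U. Orthogonality
    to the graph is solved first for the component of N along y, then for N; the
    normalization then determines n0 up to sign. *)
Lemma unit_normal_solve (f r n0 B w : R) (y x N U : 'rV[R]_3) :
  0 < f -> 0 < r -> w = r^-1 -> dot y y = 1 -> dot y U = 0 -> x = r *: y ->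
  (forall i, - f * n0 * (B * y 0 i + w * U 0 i) + N 0 i
     + (f^-1 - 1) / r ^+ 2 * (dot N x * x 0 i) = 0) ->
  - f * n0 * n0 + dot N N + (f^-1 - 1) / r ^+ 2 * (dot N x * dot x N) = -1 ->
  (forall i, N 0 i = f * n0 * (w * U 0 i + f * B * y 0 i)) /\
  f * n0 ^+ 2 * (1 - f * (w ^+ 2 * dot U U + f * B ^+ 2)) = 1.
Proof.
move=> f0 r0 wE yy yU -> orth nn.
have fn : f != 0 by rewrite gt_eqF.
have rn : r != 0 by rewrite gt_eqF.
pose nu := dot y N.
have NE : N = f * n0 *: (B *: y + w *: U) - (f^-1 - 1) * nu *: y.
  apply/rowP => i; have := orth i; rewrite dotZr (dotC N) -/nu !mxE => E.
  have -> : N 0 i = N 0 i - 0 by rewrite subr0.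
  by rewrite -E; field; rewrite rn fn.
have nuE : nu = f ^+ 2 * n0 * B.
  have := congr1 (dot y) NE.
  rewrite -/nu dotDr dotZr dotDr !dotZr -scaleNr dotZr yy yU => E.
  have : nu / f = f * n0 * B.
    by rewrite -[LHS]addr0 -(subrr nu) {2}E; field.
  by move=> E2; rewrite -[LHS](divfK fn) E2; ring.
have {}NE i : N 0 i = f * n0 * (w * U 0 i + f * B * y 0 i).
  by rewrite NE nuE !mxE; field.
split=> //.
have NN : dot N N = f ^+ 2 * n0 ^+ 2 * (w ^+ 2 * dot U U + f ^+ 2 * B ^+ 2).
  have -> : N = f * n0 *: (w *: U + (f * B) *: y).
    by apply/rowP => i; rewrite NE !mxE.
  rewrite !(dotDl, dotDr, dotZl, dotZr) (dotC U y) yU yy; ring.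
move: nn; rewrite NN dotZr dotZl (dotC N y) -/nu nuE => nn.
have := congr1 -%R nn; rewrite opprK; apply: etrans; field; by rewrite fn rn.
Qed.

End NormalVector.

(** * The mean curvature operator in the variables s and y *)

Section SmoothAlgebra.
Variables (R : realType) (a b : R).
Implicit Types (Phi Psi : R -> 'rV[R]_3 -> R).

Lemma smooth_opp Phi : smooth_cyl a b Phi -> smooth_cyl a b (fun s y => - Phi s y).
Proof.
move=> sm; apply: (@smooth_cyl_eq _ _ _ (fun s y => -1 * Phi s y)).
  by move=> s y _ _; rewrite mulN1r.
by apply: smooth_mul => //; exact: smooth_cst.
Qed.

Lemma smooth_exp n Phi : smooth_cyl a b Phi -> smooth_cyl a b (fun s y => Phi s y ^+ n).
Proof.
move=> sm; elim: n => [|n IH]; first exact: smooth_cst.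
apply: (@smooth_cyl_eq _ _ _ (fun s y => Phi s y * Phi s y ^+ n)).
  by move=> s y _ _; rewrite exprS.
exact: smooth_mul.
Qed.

End SmoothAlgebra.

Ltac smooth_step := match goal with
  | H : smooth_cyl _ _ ?F |- smooth_cyl _ _ ?F => exact: H
  | H : smooth_cyl _ _ ?F |- smooth_cyl _ _ (fun s y => ?F s y) => exact: H
  | |- smooth_cyl _ _ (fun _ _ => ?c) => exact: smooth_cst
  | |- smooth_cyl _ _ (fun s _ => s) => exact: smooth_eta
  | |- smooth_cyl _ _ (fun _ y => fun_of_matrix y _ ?i) => exact: smooth_coord
  | |- smooth_cyl _ _ (dEta ?F) => apply: (@smooth_dEta _ _ _ F)
  | |- smooth_cyl _ _ (fun s y => dEta ?F s y) => apply: (@smooth_dEta _ _ _ F)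
  | |- smooth_cyl _ _ (dSph ?i ?F) => apply: (@smooth_dSph _ _ _ i F)
  | |- smooth_cyl _ _ (fun s y => dSph ?i ?F s y) => apply: (@smooth_dSph _ _ _ i F)
  | |- smooth_cyl _ _ (fun s y => @?F s y ^+ ?n) => apply: (@smooth_exp _ _ _ n F)
  | |- smooth_cyl _ _ (fun s y => - @?F s y) => apply: (@smooth_opp _ _ _ F)
  | |- smooth_cyl _ _ (fun s y => @?F s y + @?G s y) => apply: (@smooth_add _ _ _ F G)
  | |- smooth_cyl _ _ (fun s y => @?F s y * @?G s y) => apply: (@smooth_mul _ _ _ F G)
  | |- _ => apply: smooth_sum => ?
  end; cbv beta.
Ltac smooth := repeat smooth_step.

Section Equation.
Variables (R : realType) (m : R).
Hypothesis m0 : 0 < m.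
Implicit Types (x y v w : 'rV[R]_3) (u Phi Psi : R -> 'rV[R]_3 -> R) (s : R).

(** This is 1 / r as a function of s, since s^2 = 1 - 2m / r. *)
Definition inv_radius s : R := (2 * m)^-1 * (1 - s ^+ 2).

(** This is 1 - f |du|^2, where f = s^2 is 1 - 2m / r and |du| is taken in the space
    metric, that is, - f times the squared norm of d(t - u); so it is positive where
    the graph is spacelike. *)
Definition slope_factor u s y : R :=
  1 - s ^+ 2 * (m ^+ 2 * inv_radius s ^+ 4 * dEta u s y ^+ 2
     + inv_radius s ^+ 2 * \sum_(i < 3) dSph i u s y ^+ 2).

(** The space components of the unit normal, multiplied by the square root of
    [slope_factor] (see [normal_on_base]). *)
Definition flux i u s y : R :=
  s * inv_radius s * dSph i u s y +
  m * inv_radius s ^+ 2 * s ^+ 2 * dEta u s y * y 0 i.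

(** Three times the mean curvature multiplied by the cube of the square root of
    [slope_factor]: in this form the operator is polynomial in s and in the
    derivatives of u. *)
Definition cmc_op u s y : R :=
  slope_factor u s y *
    (m ^+ 2 * inv_radius s ^+ 4 * (s * dEta (dEta u) s y + 2 * dEta u s y)
     + s * inv_radius s ^+ 2 * \sum_(i < 3) dSph i (dSph i u) s y)
  - 2^-1 * (m ^+ 2 * inv_radius s ^+ 4 * s * dEta u s y * dEta (slope_factor u) s y
     + s * inv_radius s ^+ 2 *
       \sum_(i < 3) dSph i (slope_factor u) s y * dSph i u s y).

Section Rules.
Variables a b : R.

Lemma smooth_inv_radius : smooth_cyl a b (fun s _ => inv_radius s).
Proof. rewrite /inv_radius; smooth. Qed.

Lemma smooth_slope_factor u : smooth_cyl a b u -> smooth_cyl a b (slope_factor u).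
Proof. move=> su; have sr := smooth_inv_radius; rewrite /slope_factor; smooth. Qed.

Lemma smooth_flux i u : smooth_cyl a b u -> smooth_cyl a b (flux i u).
Proof. move=> su; have sr := smooth_inv_radius; rewrite /flux; smooth. Qed.

Lemma smooth_cmc_op u : smooth_cyl a b u -> smooth_cyl a b (cmc_op u).
Proof.
move=> su; have sr := smooth_inv_radius; have sw := smooth_slope_factor su.
rewrite /cmc_op; smooth.
Qed.

Section Point.
Variables (s : R) (y : 'rV[R]_3).
Hypotheses (sab : a < s < b) (Sy : sphere y).

Lemma sum_sphere : \sum_(i < 3) y 0 i * y 0 i = 1.
Proof. by rewrite -dotE. Qed.

Lemma dEta_cst (c : R) : dEta (fun _ _ => c) s y = 0.
Proof. by rewrite /dEta derive1_cst. Qed.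

Lemma dEta_coord i : dEta (fun _ y => y 0 i) s y = 0.
Proof. by rewrite /dEta derive1_cst. Qed.

Lemma dEta_eta : dEta (fun s _ => s) s y = 1.
Proof. by rewrite /dEta (derive1_id s). Qed.

Lemma dEta_inv_radius : dEta (fun s _ => inv_radius s) s y = - s / m.
Proof.
have se := @smooth_eta R a b.
transitivity (dEta (fun s _ => (2 * m)^-1 + (- (2 * m)^-1) * (s * s)) s y).
  by apply: (dEta_congr sab) => s' _; rewrite /inv_radius expr2; ring.
rewrite (dEta_add sab Sy (Phi := fun _ _ => (2 * m)^-1)
  (Psi := fun s _ => - (2 * m)^-1 * (s * s))); [|smooth|smooth].
rewrite (dEta_mul sab Sy (Phi := fun _ _ => - (2 * m)^-1) (Psi := fun s _ => s * s)); [|smooth|smooth].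
rewrite (dEta_mul sab Sy (Phi := fun s _ => s) (Psi := fun s _ => s)); [|smooth|smooth].
by rewrite !dEta_cst dEta_eta; field; rewrite gt_eqF.
Qed.

(** The sphere derivatives drop out by the Euler identity. *)
Lemma radial_flux u : smooth_cyl a b u ->
  \sum_(i < 3) y 0 i * flux i u s y = m * inv_radius s ^+ 2 * s ^+ 2 * dEta u s y.
Proof.
move=> su; rewrite /flux.
under eq_bigr do rewrite mulrDr mulrCA [X in _ + X]mulrCA.
rewrite big_split/= -!big_distrr/= (euler_dSph sab Sy su) sum_sphere.
by rewrite mulr0 add0r mulr1.
Qed.

End Point.

Lemma sum_dEta_flux u s y : smooth_cyl a b u -> a < s < b -> sphere y ->
  \sum_(i < 3) y 0 i * dEta (flux i u) s y =
  m * inv_radius s ^+ 2 * s ^+ 2 * dEta (dEta u) s y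
  + 2 * m * inv_radius s ^+ 2 * s * dEta u s y
  - 2 * inv_radius s * s ^+ 3 * dEta u s y.
Proof.
move=> su sab Sy; have sr := smooth_inv_radius; have sf i := smooth_flux i su.
transitivity (dEta (fun s y => \sum_(i < 3) y 0 i * flux i u s y) s y).
  rewrite (dEta_sum sab Sy); last by move=> i; smooth.
  apply: eq_bigr => i _.
  by rewrite (dEta_mul sab Sy (Phi := fun _ y => y 0 i)) ?dEta_coord ?mulr0 ?addr0//; smooth.
pose h s' (z : 'rV[R]_3) := inv_radius s' * s' * (inv_radius s' * s') * (m * dEta u s' z).
have E : forall s', a < s' < b ->
    (fun s y => \sum_(i < 3) y 0 i * flux i u s y) s' y = h s' y.
  by move=> s' sab'; rewrite (radial_flux sab' Sy su) /h; ring.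
rewrite (dEta_congr sab E) /h.
pose k s' (z : 'rV[R]_3) := inv_radius s' * s'.
have sk : smooth_cyl a b k by rewrite /k; smooth.
rewrite (dEta_mul sab Sy (Phi := fun s y => k s y * k s y)); [|smooth|smooth].
rewrite (dEta_mul sab Sy (Phi := k)); [|smooth|smooth].
rewrite (dEta_mul sab Sy (Phi := fun _ _ => m)); [|smooth|smooth].
rewrite /k (dEta_mul sab Sy (Phi := fun s _ => inv_radius s) (Psi := fun s _ => s)); [|smooth|smooth].
rewrite dEta_cst dEta_eta (dEta_inv_radius sab Sy).
by field; rewrite gt_eqF.
Qed.

Lemma sum_dSph_flux u s y : smooth_cyl a b u -> a < s < b -> sphere y ->
  \sum_(i < 3) dSph i (flux i u) s y =
  s * inv_radius s * \sum_(i < 3) dSph i (dSph i u) s y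
  + 2 * m * inv_radius s ^+ 2 * s ^+ 2 * dEta u s y.
Proof.
move=> su sab Sy; have sr := smooth_inv_radius.
pose k1 s' (z : 'rV[R]_3) := s' * inv_radius s'.
pose k2 s' (z : 'rV[R]_3) := m * inv_radius s' ^+ 2 * s' ^+ 2.
have s1 : smooth_cyl a b k1 by rewrite /k1; smooth.
have s2 : smooth_cyl a b k2 by rewrite /k2; smooth.
have E i : dSph i (flux i u) s y = k1 s y * dSph i (dSph i u) s y
   + (k2 s y * dEta u s y * (1 - y 0 i * y 0 i) +
      k2 s y * (y 0 i * dSph i (dEta u) s y)).
  rewrite (dSph_add sab Sy i (Phi := fun s y => k1 s y * dSph i u s y)
     (Psi := fun s y => k2 s y * dEta u s y * y 0 i)); [|smooth|smooth].
  rewrite (dSph_mul sab Sy i (Phi := k1)); [|smooth|smooth].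
  rewrite (dSph_mul_coord sab Sy i (Phi := fun s y => k2 s y * dEta u s y)); last by smooth.
  rewrite (dSph_mul sab Sy i (Phi := k2)); [|smooth|smooth].
  rewrite (dSph_radial i (fun s => s * inv_radius s)).
  rewrite (dSph_radial i (fun s => m * inv_radius s ^+ 2 * s ^+ 2)).
  generalize (dSph i (dSph i u) s y) (dSph i (dEta u) s y) (dEta u s y) => d1 d2 d3.
  by ring.
rewrite (eq_bigr _ (fun i _ => E i)) !big_split/= -!big_distrr/=.
rewrite (euler_dSph sab Sy (smooth_dEta su)) sumrB sum_sphere// sumr_const card_ord.
by rewrite /k1 /k2; ring.
Qed.

Lemma sum_flux_dSph u Phi s y : smooth_cyl a b u -> smooth_cyl a b Phi ->
  a < s < b -> sphere y ->
  \sum_(i < 3) flux i u s y * dSph i Phi s y =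
  s * inv_radius s * \sum_(i < 3) dSph i Phi s y * dSph i u s y.
Proof.
move=> su sp sab Sy.
have E i : flux i u s y * dSph i Phi s y =
    s * inv_radius s * (dSph i Phi s y * dSph i u s y) +
    m * inv_radius s ^+ 2 * s ^+ 2 * dEta u s y * (y 0 i * dSph i Phi s y).
  by rewrite /flux; ring.
rewrite (eq_bigr _ (fun i _ => E i)) big_split/= -!big_distrr/=.
by rewrite (euler_dSph sab Sy sp) mulr0 addr0.
Qed.

End Rules.

End Equation.

(** * The equation of constant mean curvature *)

Section MeanCurvature.
Variables (R : realType) (m : R).
Hypothesis m0 : 0 < m.
Implicit Types (x y v w : 'rV[R]_3) (s : R).
Variables (eta0 : R) (u : R -> 'rV[R]_3 -> R).
Hypotheses (eta01 : eta0 <= 1) (su : smooth_cyl 0 eta0 u).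

Lemma base_eta x : base m eta0 x -> 0 < eta m (enorm x) < eta0.
Proof. by move=> [rx ->]; rewrite andbT sqrtr_gt0 eta_arg_gt0. Qed.

Lemma eta_sqr x : base m eta0 x -> eta m (enorm x) ^+ 2 = 1 - 2 * m / enorm x.
Proof. by move=> [rx _]; rewrite sqr_sqrtr// ltW// eta_arg_gt0. Qed.

Lemma base_inv_radius x : base m eta0 x -> inv_radius m (eta m (enorm x)) = (enorm x)^-1.
Proof.
move=> bx; have r0 := enorm_gt0 (outside_neq0 m0 bx.1).
by rewrite /inv_radius (eta_sqr bx); field; rewrite !gt_eqF.
Qed.

Lemma near_base x : base m eta0 x -> \forall z \near x, base m eta0 z.
Proof.
move=> [rx ex].
have x0 := outside_neq0 m0 rx.
have [de _] := differentiable_eta m0 rx.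
have ce : {for x, continuous (@enorm R)}.
  apply: (@C_k_continuous _ _ 0 [set z : 'rV[R]_3 | z != 0]) => //.
  apply: (@C_k_enorm _ _ _ _ id) => //; first exact: open_nonzero.
  by move=> j; exact: C_k_coord (@open_nonzero R).
have c2 := differentiable_continuous de.
have h1 : \forall z \near x, 2 * m < enorm z.
  exact: ce (open_nbhs_nbhs (conj (open_gt (y := 2 * m)) rx)).
have h2 : \forall z \near x, eta m (enorm z) < eta0.
  exact: c2 (open_nbhs_nbhs (conj (open_lt (y := eta0)) ex)).
by apply: filterS (filterI h1 h2) => z [].
Qed.

Lemma base_diff Phi x : smooth_cyl 0 eta0 Phi -> base m eta0 x ->
  differentiable (cyl Phi) (consr (eta m (enorm x)) x).
Proof.
move=> sm bx; apply: (smooth_diff sm (base_eta bx)).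
exact: (outside_neq0 m0 bx.1).
Qed.

(** The unit normal is given only by its characterization, which determines it. *)
Lemma normal_on_base n (t : R) x : future_unit_normal m eta0 u n -> base m eta0 x ->
  let s := eta m (enorm x) in let y := sproj x in
  let q := (Num.sqrt (slope_factor m u s y))^-1 in
  [/\ 0 < slope_factor m u s y, lsubmx (n (pair_mx t x)) 0 0 = q / s
    & forall i, rsubmx (n (pair_mx t x)) 0 i = q * flux m i u s y].
Proof.
move=> fn bx s y q; have [nn orth n0] := fn t x bx.
have x0 := outside_neq0 m0 bx.1; have r0 := enorm_gt0 x0.
have Sy : sphere y by exact: sphere_sproj.
have sb : 0 < s < eta0 by exact: base_eta.
have s0 : 0 < s by case/andP: sb.
have [dh Dh] := derive_height m0 bx.1 (base_diff su bx).
pose U : 'rV[R]_3 := \row_i dSph i u s y.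
pose B := m / (enorm x ^+ 2 * s) * dEta u s y.
have wE : inv_radius m s = (enorm x)^-1 by exact: base_inv_radius.
have fE : 1 - 2 * m / enorm x = s ^+ 2 by rewrite -(eta_sqr bx).
have yU : dot y U = 0.
  rewrite dotE; under eq_bigr do rewrite [X in _ * X]mxE.
  exact: (euler_dSph sb Sy su).
have := @unit_normal_solve R (s ^+ 2) (enorm x) (lsubmx (n (pair_mx t x)) 0 0) B
  (enorm x)^-1 y x (rsubmx (n (pair_mx t x))) U.
case=> //.
- by rewrite exprn_gt0.
- exact: sproj_decomp.
- move=> i; have := orth (delta_mx 0 i).
  rewrite pairing_schwarzschild fE -[graph_tangent _ _ _ _]/(consr _ _) consr_lsub consr_rsub.
  rewrite dot_delta [dot x _]dot_delta Dh /height -/s -/y => <-.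
  by rewrite /B [U 0 i]mxE; ring.
- by move: nn; rewrite pairing_schwarzschild fE.
move: n0; set k0 := lsubmx (n _) 0 0 => k0p nE kE.
have WE : 1 - s ^+ 2 * ((enorm x)^-1 ^+ 2 * dot U U + s ^+ 2 * B ^+ 2) =
    slope_factor m u s y.
  rewrite /slope_factor wE /B; have -> : \sum_(i < 3) dSph i u s y ^+ 2 = dot U U.
    by rewrite dotE; apply: eq_bigr => i _; rewrite !mxE expr2.
  by field; rewrite !gt_eqF.
rewrite WE in kE.
have W0 : 0 < slope_factor m u s y.
  have : 0 < s ^+ 2 * k0 ^+ 2 * slope_factor m u s y by rewrite kE.
  by rewrite pmulr_rgt0// mulr_gt0// exprn_gt0.
(* future directed: the positive root *)
have qE : k0 * s = q.
  have q0 : Num.sqrt (slope_factor m u s y) != 0 by rewrite gt_eqF// sqrtr_gt0.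
  apply: (mulIf q0); rewrite /q mulVf//.
  have : (k0 * s * Num.sqrt (slope_factor m u s y)) ^+ 2 = 1 ^+ 2.
    by rewrite exprMn sqr_sqrtr ?ltW// expr1n -kE; ring.
  move=> /eqP; rewrite eqf_sqr => /orP[/eqP//|/eqP E].
  have : 0 < k0 * s * Num.sqrt (slope_factor m u s y).
    by rewrite mulr_gt0 ?sqrtr_gt0// mulr_gt0.
  by rewrite E ltr0N1.
split=> //; first by rewrite -qE mulfK// gt_eqF.
move=> i; rewrite nE -qE /flux wE /B mxE.
by field; rewrite !gt_eqF.
Qed.

Lemma derive_inv_sqrt (f : 'rV[R]_3 -> R) x v : differentiable f x -> 0 < f x ->
  let q := (Num.sqrt (f x))^-1 in
  differentiable (fun z => (Num.sqrt (f z))^-1) x /\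
  'D_v (fun z => (Num.sqrt (f z))^-1) x = - 2^-1 * q ^+ 3 * 'D_v f x.
Proof.
move=> df f0 q; have [ds Ds] := @derive_comp1 _ _ _ f x v _ (is_derive1_sqrt f0) df.
have s0 : Num.sqrt (f x) != 0 by rewrite gt_eqF// sqrtr_gt0.
split; first exact: (@differentiableV _ _ (@Num.sqrt R \o f)).
rewrite [LHS](@deriveV _ _ (@Num.sqrt R \o f))//; last exact: diff_derivable.
by rewrite Ds /GRing.scale/= /q; field.
Qed.

(** Neither the metric nor the normal depends on t and the volume density is 1, so
    the divergence is the sum of the space derivatives of flux / sqrt W. *)
Lemma cmc_pde_base H x : has_mean_curvature m eta0 u H -> base m eta0 x ->
  let s := eta m (enorm x) in let y := sproj x in
  0 < slope_factor m u s y /\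
  cmc_op m u s y = 3 * H * Num.sqrt (slope_factor m u s y) ^+ 3.
Proof.
move=> [n fn Hn] bx s y.
have x0 := outside_neq0 m0 bx.1; have r0 := enorm_gt0 x0.
have Sy : sphere y by exact: sphere_sproj.
have sb : 0 < s < eta0 by exact: base_eta.
have s0 : 0 < s by case/andP: sb.
have wE : inv_radius m s = (enorm x)^-1 by exact: base_inv_radius.
have [W0 _ _] := normal_on_base 0 fn bx; split=> //.
have sW := smooth_slope_factor m su.
have sP i := smooth_flux m i su.
pose W := height m (slope_factor m u).
pose Q z := (Num.sqrt (W z))^-1.
pose P i := height m (flux m i u).
have W0' : 0 < W x by [].
have nb := near_base bx.
have [dW DW] := derive_height m0 bx.1 (base_diff sW bx).
have [dQ _] := derive_inv_sqrt 0 dW W0'.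
have DQ v := (derive_inv_sqrt v dW W0').2.
have dP i := (derive_height m0 bx.1 (base_diff (sP i) bx)).1.
have DP i := (derive_height m0 bx.1 (base_diff (sP i) bx)).2.
pose p0 := pair_mx (height m u x) x : 'rV[R]_(1 + 3).
have nb4 : \forall q \near p0, base m eta0 (rsubmx q).
  have c4 : {for p0, continuous (fun q : 'rV[R]_(1 + 3) => rsubmx q)}.
    by apply: continuous_row => j; exact: C_k_continuous (C_k_rsub 0 j openT) I.
  by apply: c4; rewrite row_mxKr.
have vol1 q : base m eta0 (rsubmx q) -> Num.sqrt `|\det (schwarzschild m q)| = 1.
  move=> bq; rewrite (consr_eta q) det_schwarzschild//; last exact: bq.1.
  by rewrite normrN1 sqrtr1.
have := Hn x bx; rewrite /divergence -/p0 vol1; last by rewrite row_mxKr.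
rewrite invr1 mul1r big_split_ord big_ord1 /=.
(* the time component of the normal does not depend on t *)
have -> : 'D_(delta_mx 0 (lshift 3 0)) (fun q => Num.sqrt `|\det (schwarzschild m q)| *
    n q 0 (lshift 3 0)) p0 = 0.
  transitivity ('D_(delta_mx 0 (lshift 3 0))
    (fun q : 'rV[R]_(1 + 3) => Q (rsubmx q) / eta m (enorm (rsubmx q))) p0).
    apply: near_eq_derive; apply: filterS nb4 => q bq; rewrite vol1// mul1r.
    have [_ E _] := normal_on_base (lsubmx q 0 0) fn bq.
    by move: E; rewrite -[pair_mx _ _]/(consr _ _) -consr_eta mxE => ->.
  rewrite -[RHS](@derive_cst R R R (Q x / eta m (enorm x)) 0 1); apply: derive_ext => h.
  by rewrite -consr_delta0 consrZ consrD scaler0 add0r consr_rsub.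
rewrite add0r.
have E i : 'D_(delta_mx 0 (rshift 1 i)) (fun q => Num.sqrt `|\det (schwarzschild m q)| *
    n q 0 (rshift 1 i)) p0 =
    Q x * (m / (enorm x ^+ 2 * s) * (y 0 i * dEta (flux m i u) s y)
          + (enorm x)^-1 * dSph i (flux m i u) s y)
    - 2^-1 * Q x ^+ 3 *
      (m / (enorm x ^+ 2 * s) * dEta (slope_factor m u) s y * (y 0 i * flux m i u s y)
       + (enorm x)^-1 * (flux m i u s y * dSph i (slope_factor m u) s y)).
  transitivity ('D_(delta_mx 0 (rshift 1 i))
    (fun q : 'rV[R]_(1 + 3) => Q (rsubmx q) * P i (rsubmx q)) p0).
    apply: near_eq_derive; apply: filterS nb4 => q bq; rewrite vol1// mul1r.
    have [_ _ E] := normal_on_base (lsubmx q 0 0) fn bq.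
    by move: (E i); rewrite -[pair_mx _ _]/(consr _ _) -consr_eta mxE => ->.
  transitivity ('D_(delta_mx 0 i) (fun z => Q z * P i z) x).
    apply: derive_ext => h.
    by rewrite -consr_delta consrZ consrD mulr0 add0r consr_rsub.
  rewrite [LHS]deriveM;
    [|exact: (diff_derivable dQ)|exact: (diff_derivable (dP i))].
  rewrite DQ DW DP -[(Num.sqrt (height _ _ _))^-1]/(Q x) /P /height -/s -/y.
  by rewrite /GRing.scale/=; ring.
rewrite (eq_bigr _ (fun i _ => E i)) sumrB -!big_distrr/= !big_split/= -!big_distrr/=.
rewrite (sum_dEta_flux m0 su sb Sy) (sum_dSph_flux m su sb Sy).
rewrite (radial_flux m sb Sy su) (sum_flux_dSph m su sW sb Sy) -!wE.
have q0 : Q x != 0 by rewrite invr_neq0// gt_eqF// sqrtr_gt0.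
have QE : Num.sqrt (slope_factor m u s y) = (Q x)^-1 by rewrite invrK.
have WE : slope_factor m u s y = (Q x)^-1 ^+ 2.
  by rewrite -QE sqr_sqrtr// ltW.
have rE : enorm x = (inv_radius m s)^-1 by rewrite wE invrK.
have w0 : inv_radius m s != 0 by rewrite wE invr_neq0// gt_eqF.
rewrite QE rE => <-; rewrite /cmc_op {1}WE.
by field; rewrite q0 w0 gt_eqF.
Qed.

(** The point of the exterior region with given s and y; its radius comes from
    solving s^2 = 1 - 2m / r. *)
Lemma sphere_point s y : 0 < s < eta0 -> sphere y ->
  let r := 2 * m / (1 - s ^+ 2) in
  [/\ base m eta0 (r *: y), enorm (r *: y) = r, eta m r = s & sproj (r *: y) = y].
Proof.
move=> /andP[s0 s1] Sy r.
have w0 : 0 < 1 - s ^+ 2.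
  by rewrite subr_gt0 expr_lt1// ?ltW// (lt_le_trans s1).
have r0 : 0 < r by rewrite divr_gt0// mulr_gt0.
have er : enorm (r *: y) = r by rewrite enormZ ?ltW// enorm_sphere// mulr1.
have eE : eta m r = s.
  rewrite /eta /r; have -> : 1 - 2 * m / (2 * m / (1 - s ^+ 2)) = s ^+ 2.
    by field; rewrite !gt_eqF.
  by rewrite sqrtr_sqr ger0_norm// ltW.
have yE : sproj (r *: y) = y by rewrite sproj_scale// sproj_sphere.
split=> //; split; rewrite er ?eE// /r ltr_pdivlMr// gtr_pMr ?mulr_gt0//.
by rewrite ltrBlDr ltrDl exprn_gt0.
Qed.

Lemma cmc_pde H s y : has_mean_curvature m eta0 u H -> 0 < s < eta0 -> sphere y ->
  0 < slope_factor m u s y /\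
  cmc_op m u s y = 3 * H * Num.sqrt (slope_factor m u s y) ^+ 3.
Proof.
move=> hmc se Sy; have [bx er eE yE] := sphere_point se Sy.
by have := cmc_pde_base hmc bx; rewrite /= er eE yE.
Qed.

End MeanCurvature.

(** * Division by X and bounds on the cylinder *)

Section CylinderHadamard.
Variables (R : realType) (d : R).
Implicit Types (F Phi : R -> 'rV[R]_3 -> R) (X s : R) (x y : 'rV[R]_3).

Lemma shrink_consr s X x : shrink s (consr X x : 'rV[R]_(3.+1)) = consr (s * X) x.
Proof.
apply/rowP; elim/ord_split_ind => j; rewrite mxE ?consr_l ?consr_r.
  by rewrite (ord1 j).
by [].
Qed.

Lemma shrink_closed_cyl : shrink_closed (n := 3) (cyl_dom (- d) d).
Proof.
move=> p; rewrite (consr_eta p) => /cyl_domE[pd px] s /andP[s0 s1].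
rewrite shrink_consr; apply/cyl_domE; split=> //.
rewrite -ltr_norml normrM ger0_norm//; rewrite -ltr_norml in pd.
by apply: le_lt_trans pd; rewrite ler_piMl.
Qed.

(** The segment joining (0, x) to (X, x) stays in the cylinder, and the mean along it
    only sees the direction of x. *)
Lemma hadamard_cyl F : smooth_cyl (- d) d F ->
  exists2 G, smooth_cyl (- d) d G &
    forall X y, - d < X < d -> sphere y -> F X y = F 0 y + X * G X y.
Proof.
move=> sF; pose D := cyl_dom (- d) d.
have oD : open D := @open_cyl_dom _ _ _.
pose f : 'rV[R]_(3.+1) -> R := cyl F.
pose G' : 'rV[R]_(1 + 3) -> R := ray_mean (n := 3) 0 ('D_(delta_mx 0 0) f).
pose G (X : R) (y : 'rV[R]_3) := G' (consr X y).
have sm : smooth_on D G'.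
  by apply: smooth_ray_mean oD shrink_closed_cyl _ => k; exact: (sF k.+1).2.
have e0 : delta_mx 0 0 = consr 1 0 :> 'rV[R]_(1 + 3).
  by rewrite consr_delta0; congr delta_mx; exact: val_inj.
have E p : D p -> G' p = cyl G p.
  rewrite (consr_eta p) => /cyl_domE[_ px].
  rewrite cyl_consr /G /G' /ray_mean; congr unit_mean; apply/funext => s.
  by rewrite !shrink_consr e0 /f -!cyl_dEta !cyl_consr sprojK.
exists G => [k|X y Xd Sy]; first exact: (C_k_eq oD E (sm k)).
have Dp : D (consr X y) by exact: cyl_dom_sphere.
have := hadamard shrink_closed_cyl Dp (sF 1%N).
have -> : (consr X y : 'rV[R]_(3.+1)) 0 0 = X.
  by rewrite -[RHS](consr_l X y 0); congr (fun_of_matrix _ _ _); exact: val_inj.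
rewrite -/(G X y) shrink_consr mul0r => H; rewrite -(cyl_sphere F X Sy).
by rewrite [LHS]H cyl_sphere.
Qed.

End CylinderHadamard.

Section Compactness.
Variables (R : realType) (a b : R).
Implicit Types (Phi : R -> 'rV[R]_3 -> R) (X s : R) (x y : 'rV[R]_3).

Lemma sphere_coord y i : sphere y -> `|y 0 i| <= 1.
Proof.
move=> Sy; rewrite -(ler_pXn2r (n := 2)) ?nnegrE// expr1n real_normK ?num_real//.
rewrite -Sy dotE (bigD1 i)//= -expr2 lerDl sumr_ge0// => j _.
by rewrite -expr2 sqr_ge0.
Qed.

Lemma cyl_compact (c d : R) :
  compact [set p : 'rV[R]_(1 + 3) | c <= lsubmx p 0 0 <= d /\ sphere (rsubmx p)].
Proof.
apply: bounded_closed_compact.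
  exists (1 + `|c| + `|d|); split; first by rewrite num_real.
  move=> r rM p [/andP[pc pd] Sp].
  have c1 := ler_norm (- c); rewrite normrN in c1.
  have d1 := ler_norm d; have c0 := normr_ge0 c; have d0 := normr_ge0 d.
  apply: norm_le_coord; first lra.
  rewrite (consr_eta p); elim/ord_split_ind => j; rewrite ?consr_l ?consr_r.
    by rewrite ler_norml; apply/andP; split; lra.
  by apply: (le_trans (sphere_coord _ Sp)); lra.
have cl : continuous (fun q : 'rV[R]_(1 + 3) => lsubmx q 0 0).
  by move=> p; exact: C_k_continuous (C_k_lsub 0 openT) I.
have cd : continuous (fun q : 'rV[R]_(1 + 3) => dot (rsubmx q) (rsubmx q)).
  move=> p; apply: (@C_k_continuous _ _ 0 setT) => //.
  by apply: C_k_dot openT _ => j; exact: C_k_rsub openT.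
have -> : [set p : 'rV[R]_(1 + 3) | c <= lsubmx p 0 0 <= d /\ sphere (rsubmx p)] =
   (fun q => lsubmx q 0 0) @^-1` `[c, d] `&` (fun q => dot (rsubmx q) (rsubmx q)) @^-1` [set 1].
  by apply/seteqP; split => p /=; rewrite in_itv.
apply: closedI.
  by apply: closed_comp => [p _|]; [exact: cl|exact: interval_closed].
by apply: closed_comp => [p _|]; [exact: cd|exact: closed_eq].
Qed.

Lemma cyl_bounded Phi c d : smooth_cyl a b Phi -> a < c -> d < b ->
  exists2 B, 0 <= B & forall s y, c <= s <= d -> sphere y -> `|Phi s y| <= B.
Proof.
move=> sm ac db.
set K := [set p : 'rV[R]_(1 + 3) | c <= lsubmx p 0 0 <= d /\ sphere (rsubmx p)].
have cK : {within K, continuous (cyl Phi)}.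
  apply: continuous_in_subspaceT => p; rewrite inE => -[/andP[pc pd] Sp].
  apply: (C_k_continuous (sm 0%N)); split; last exact: sphere_neq0.
  by rewrite (lt_le_trans ac pc) (le_lt_trans pd db).
have [B [_ HB]] := compact_bounded (continuous_compact cK (@cyl_compact c d)).
exists (Num.max 0 B + 1); first by rewrite addr_ge0// le_max lexx.
move=> s y sc Sy; apply: (HB (Num.max 0 B + 1)).
  by rewrite ltr_pwDr// le_max lexx orbT.
exists (consr s y); last by rewrite cyl_sphere.
by rewrite /K/= consr_lsub consr_rsub.
Qed.

Lemma cyl_lipschitz Phi c d B y X X' : smooth_cyl a b Phi -> a < c -> d < b ->
  (forall s, c <= s <= d -> `|dEta Phi s y| <= B) -> sphere y ->
  c <= X <= d -> c <= X' <= d -> `|Phi X y - Phi X' y| <= B * `|X - X'|.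
Proof.
move=> sm ac db HB Sy.
have D (s : R) : c <= s <= d -> is_derive s 1 (Phi ^~ y) (dEta Phi s y).
  move=> /andP[cs sd]; have sab : a < s < b by rewrite (lt_le_trans ac cs) (le_lt_trans sd db).
  by rewrite /dEta derive1E; apply: derivableP; exact: derivable_eta sm.
have main (Y Y' : R) : Y <= Y' -> c <= Y -> Y' <= d -> `|Phi Y' y - Phi Y y| <= B * `|Y' - Y|.
  move=> YY cY Yd.
  have [||z] := @MVT_segment R (Phi ^~ y) (fun s => dEta Phi s y) Y Y' YY.
  - move=> s; rewrite in_itv/= => /andP[/ltW Ys /ltW sY]; apply: D.
    by rewrite (le_trans cY Ys) (le_trans sY Yd).
  - apply: derivable_within_continuous => s; rewrite in_itv/= => /andP[Ys sY].
    apply: (@ex_derive _ _ _ _ _ _ (dEta Phi s y)); apply: D.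
    by rewrite (le_trans cY Ys) (le_trans sY Yd).
  - rewrite in_itv/= => /andP[Yz zY] ->; rewrite normrM ler_wpM2r// HB//.
    by rewrite (le_trans cY Yz) (le_trans zY Yd).
move=> /andP[cX Xd] /andP[cX' Xd'].
have [XX|/ltW XX] := leP X' X; first exact: main.
by rewrite distrC [`|X - X'|]distrC; exact: main.
Qed.

End Compactness.

(** * Hyperbolic functions and the Kruskal amplitude *)

Section Hyperbolic.
Variable R : realType.
Implicit Types (z t M : R).

Lemma cosh_gt0 z : 0 < cosh z.
Proof. by rewrite divr_gt0// addr_gt0// expR_gt0. Qed.

Lemma sinhN z : sinh (- z) = - sinh z.
Proof. by rewrite /sinh opprK; ring. Qed.

Lemma coshN z : cosh (- z) = cosh z.
Proof. by rewrite /cosh opprK addrC. Qed.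

Lemma sinh_lt_cosh z : `|sinh z| < cosh z.
Proof.
have e1 := expR_gt0 z; have e2 := expR_gt0 (- z).
by rewrite /sinh /cosh ltr_norml; apply/andP; split; lra.
Qed.

Lemma sinhB z t : sinh (z - t) = sinh z * cosh t - cosh z * sinh t.
Proof.
by rewrite /sinh /cosh opprB !expRD; field.
Qed.

Lemma sinh_ge0 z : 0 <= z -> 0 <= sinh z.
Proof.
by move=> z0; rewrite divr_ge0// subr_ge0 ler_expR; lra.
Qed.

Lemma sinh_gt0 z : 0 < z -> 0 < sinh z.
Proof.
by move=> z0; rewrite divr_gt0// subr_gt0 ltr_expR; lra.
Qed.

Lemma is_derive_sinh z : is_derive z 1 (@sinh R) (cosh z).
Proof.
have dN : is_derive z 1 (fun t : R => expR (- t)) (- expR (- z)).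
  have := @is_derive1_comp R expR (fun t => - t) z _ _ (is_derive_expR _) (is_deriveNid _ _).
  by rewrite mulrN1.
have := @is_deriveZ R R R _ (2^-1) z 1 _ (is_deriveB (is_derive_expR z) dN).
rewrite opprK => H.
have -> : @sinh R = 2^-1 *: (expR - (fun t : R => expR (- t))).
  by apply/funext => t; rewrite /sinh !fctE [RHS]mulrC.
by rewrite /cosh mulrC.
Qed.

Lemma is_derive_cosh z : is_derive z 1 (@cosh R) (sinh z).
Proof.
have dN : is_derive z 1 (fun t : R => expR (- t)) (- expR (- z)).
  have := @is_derive1_comp R expR (fun t => - t) z _ _ (is_derive_expR _) (is_deriveNid _ _).
  by rewrite mulrN1.
have H := @is_deriveZ R R R _ (2^-1) z 1 _ (is_deriveD (is_derive_expR z) dN).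
have -> : @cosh R = 2^-1 *: (expR + (fun t : R => expR (- t))).
  by apply/funext => t; rewrite /cosh !fctE [RHS]mulrC.
by rewrite /sinh mulrC.
Qed.

Lemma cosh_le z M : `|z| <= M -> cosh z <= cosh M.
Proof.
wlog z0 : z / 0 <= z => [H|].
  case: (lerP 0 z) => [|z0] zM; first by move=> z0; exact: H.
  by rewrite -coshN; apply: H; rewrite ?normrN// oppr_ge0 ltW.
rewrite ger0_norm// le_eqVlt => /orP[/eqP->//|zM].
have [|t|t tzM E] := @MVT R (@cosh R) (@sinh R) z M zM.
- by move=> t _; exact: is_derive_cosh.
- apply: derivable_within_continuous => t' _.
  exact: (@ex_derive _ _ _ _ _ _ _ (is_derive_cosh t')).
have t0 : 0 <= t by move: tzM; rewrite in_itv/= => /andP[/ltW zt _]; exact: le_trans zt.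
by rewrite -subr_ge0 E mulr_ge0 ?sinh_ge0// subr_ge0 ltW.
Qed.

(** Monotonicity of tanh, with the denominators cleared. *)
Lemma sinh_ratio z M : `|z| <= M -> `|sinh z| * cosh M <= sinh M * cosh z.
Proof.
wlog z0 : z / 0 <= z => [H|].
  case: (lerP 0 z) => z0 zM; first exact: H.
  rewrite -normrN -sinhN -(coshN z); apply: H; rewrite ?normrN//.
  by rewrite oppr_ge0 ltW.
rewrite ger0_norm// => zM; rewrite ger0_norm ?sinh_ge0// -subr_ge0.
by have := @sinh_ge0 (M - z); rewrite sinhB (mulrC (sinh z)); apply; rewrite subr_ge0.
Qed.

End Hyperbolic.

Section SmoothHyperbolic.
Variables (R : realType) (V : normedModType R) (A : set V).
Hypothesis oA : open A.

Lemma C_k_expRN k (f : V -> R) : C_k k A f -> C_k k A (fun x => expR (- f x)).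
Proof.
move=> cf; apply: C_k_expR => //.
by apply: C_k_eq (C_kM oA (C_k_cst k (-1) oA) cf) => // x _; rewrite mulN1r.
Qed.

Lemma C_k_sinh k (f : V -> R) : C_k k A f -> C_k k A (fun x => sinh (f x)).
Proof.
move=> cf; have c1 := C_k_expR oA cf; have c2 := C_k_expRN cf.
have c3 := C_kM oA (C_kD oA c1 (C_kM oA (C_k_cst k (-1) oA) c2)) (C_k_cst k (2^-1) oA).
by apply: C_k_eq c3 => // x _; rewrite /sinh mulN1r.
Qed.

Lemma C_k_cosh k (f : V -> R) : C_k k A f -> C_k k A (fun x => cosh (f x)).
Proof.
move=> cf; have c1 := C_k_expR oA cf; have c2 := C_k_expRN cf.
exact: (C_kM oA (C_kD oA c1 c2) (C_k_cst k (2^-1) oA)).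
Qed.

End SmoothHyperbolic.

Section Amplitude.
Variable R : realType.
Implicit Types (s t m : R).

(** This is (r / 2m - 1)^(1/2) exp(r / 4m) in terms of s, for s > 0. Being smooth
    and odd for |s| < 1, it lets the surface be continued to s <= 0. *)
Definition kruskal_amp s : R :=
  s * (Num.sqrt (1 - s ^+ 2))^-1 * expR ((2 * (1 - s ^+ 2))^-1).

Lemma C_k_amp (V : normedModType R) (A : set V) k (f : V -> R) : open A ->
  (forall x, A x -> -1 < f x < 1) -> C_k k A f -> C_k k A (fun x => kruskal_amp (f x)).
Proof.
move=> oA f1 cf.
have g0 x : A x -> 0 < 1 - f x ^+ 2.
  by move=> /f1; rewrite -ltr_norml subr_gt0 -real_normK ?num_real// => h; rewrite expr_lt1.
have cg : C_k k A (fun x => 1 - f x ^+ 2).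
  apply: C_k_eq (C_kD oA (C_k_cst k 1 oA) (C_kM oA (C_k_cst k (-1) oA) (C_kM oA cf cf))) => //.
  by move=> x _; rewrite mulN1r expr2.
have c1 : C_k k A (fun x => (Num.sqrt (1 - f x ^+ 2))^-1).
  apply: C_kV => //; last exact: C_k_sqrt.
  by move=> x /g0 gx; rewrite gt_eqF// sqrtr_gt0.
have c2 : C_k k A (fun x => (2 * (1 - f x ^+ 2))^-1).
  apply: C_kV => //; last exact: C_kM (C_k_cst k 2 oA) cg.
  by move=> x /g0 gx; rewrite gt_eqF// mulr_gt0.
exact: (C_kM oA (C_kM oA cf c1) (C_k_expR oA c2)).
Qed.

Lemma kruskal_amp_gt0 s : 0 < s < 1 -> 0 < kruskal_amp s.
Proof.
move=> /andP[s0 s1]; rewrite !mulr_gt0 ?expR_gt0// invr_gt0 sqrtr_gt0.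
by rewrite subr_gt0 expr_lt1// ltW.
Qed.

Lemma near_amp (c : R) : 0 < c -> \forall s \near (0 : R), `|kruskal_amp s| <= c.
Proof.
move=> c0; pose A : set R := [set s | -1 < s < 1].
have oA : open A.
  have -> : A = `]-1, 1[%classic by apply/seteqP; split => s /=; rewrite in_itv.
  exact: interval_open.
have cid : C_k 0 A (@id R) by move=> x _; exact: cvg_id.
have A0 : A 0 by rewrite /A/= ltrN10 ltr01.
have := C_k_continuous (@C_k_amp R A 0 id oA (fun x h => h) cid) A0.
move=> /cvgrPdist_le/(_ c c0); apply: filterS => s.
by rewrite {1}/kruskal_amp !mul0r sub0r normrN.
Qed.

Variables (m : R).
Hypothesis m0 : 0 < m.

Lemma amp_radius s : 0 < s < 1 -> let r := 2 * m / (1 - s ^+ 2) in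
  Num.sqrt (r / (2 * m) - 1) * expR (r / (4 * m)) = kruskal_amp s.
Proof.
move=> /andP[s0 s1] r.
have g0 : 0 < 1 - s ^+ 2 by rewrite subr_gt0 expr_lt1// ltW.
have -> : r / (2 * m) - 1 = s ^+ 2 * (1 - s ^+ 2)^-1.
  by rewrite /r; field; rewrite !gt_eqF.
have -> : r / (4 * m) = (2 * (1 - s ^+ 2))^-1.
  by rewrite /r; field; rewrite !gt_eqF.
by rewrite sqrtrM ?sqr_ge0// sqrtr_sqr ger0_norm ?ltW// sqrtrV ?ltW.
Qed.

End Amplitude.

(** * The height as an implicit function across s = 0 *)

Section HeightEquation.
Variables (R : realType) (G : R -> 'rV[R]_3 -> R) (d : R).
Hypothesis sG : smooth_cyl (- d) d G.
Implicit Types (s t : R) (y : 'rV[R]_3).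

(** The equation T = X G(X, y) at T = A sinh t and X = A cosh t, where A is the
    amplitude at s, after division by A. The division removes the degeneracy at
    s = 0, where T and X vanish for all t. *)
Definition slope_gap s y t : R :=
  sinh t - cosh t * G (kruskal_amp s * cosh t) y.

Definition slope_gap_deriv s y t : R :=
  cosh t - (sinh t * G (kruskal_amp s * cosh t) y +
    cosh t * (dEta G (kruskal_amp s * cosh t) y * (kruskal_amp s * sinh t))).

Lemma is_derive_slope_gap s y t : sphere y ->
  - d < kruskal_amp s * cosh t < d ->
  is_derive t 1 (slope_gap s y) (slope_gap_deriv s y t).
Proof.
move=> Sy Xd; set X := kruskal_amp s * cosh t.
have dX : is_derive t 1 (fun t => kruskal_amp s * cosh t) (kruskal_amp s * sinh t).
  exact: (@is_deriveZ R R R _ (kruskal_amp s) t 1 _ (is_derive_cosh t)).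
have dG : is_derive X 1 (G ^~ y) (dEta G X y).
  by rewrite /dEta derive1E; apply: derivableP; exact: derivable_eta sG.
have dGX := @is_derive1_comp R (G ^~ y) (fun t => kruskal_amp s * cosh t) t _ _ dG dX.
have dM := @is_deriveM R R _ _ t 1 _ _ (is_derive_cosh t) dGX.
have := is_deriveB (is_derive_sinh t) dM.
move=> H; apply: is_derive_eq H _.
by rewrite /slope_gap_deriv /GRing.scale/= -/X; ring.
Qed.

Variables (M0 Bd eps : R).
Let M1 := M0 + 1.
Let M2 := M0 + 2.
Let C := cosh M2.
Hypotheses (M00 : 0 <= M0) (Bd0 : 0 <= Bd) (eps1 : eps <= 1).
Hypothesis ampd : forall s, - eps < s < eps -> `|kruskal_amp s| * C < d.
Hypothesis dGB : forall s y, - eps < s < eps -> sphere y -> forall t, `|t| <= M2 ->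
  `|dEta G (kruskal_amp s * cosh t) y| <= Bd.
Hypothesis GB : forall s y, - eps < s < eps -> sphere y -> forall t, `|t| <= M2 ->
  `|G (kruskal_amp s * cosh t) y| * cosh M0 <= sinh M0 + Bd * (`|kruskal_amp s| * C) * cosh M0.
Hypothesis ampG : forall s, - eps < s < eps ->
  2 * (Bd * (`|kruskal_amp s| * C)) < sinh M1 / cosh M1 - sinh M0 / cosh M0.

Let M1_gt0 : 0 < M1. Proof. by rewrite ltr_wpDl. Qed.
Let M12 : M1 < M2. Proof. by rewrite ltrD2l ltr1n. Qed.

Lemma amp_in_range s t : - eps < s < eps -> `|t| <= M2 -> - d < kruskal_amp s * cosh t < d.
Proof.
move=> se tM; rewrite -ltr_norml normrM (ger0_norm (ltW (cosh_gt0 t))).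
by apply: le_lt_trans (ampd se); rewrite ler_wpM2l// cosh_le.
Qed.

Lemma slope_bound s y t : - eps < s < eps -> sphere y -> `|t| <= M2 ->
  `|G (kruskal_amp s * cosh t) y| <= sinh M0 / cosh M0 + Bd * (`|kruskal_amp s| * C).
Proof.
move=> se Sy tM; have c0 := cosh_gt0 M0.
rewrite -(ler_pM2r c0) mulrDl divfK ?gt_eqF//; exact: GB.
Qed.

(** The term cosh t dominates: |sinh t| < cosh t is multiplied by a number close to
    tanh M0 < 1, and the derivative of G comes with the small amplitude. *)
Lemma slope_gap_derive_gt0 s y t : - eps < s < eps -> sphere y -> `|t| <= M2 ->
  0 < slope_gap_deriv s y t.
Proof.
rewrite /slope_gap_deriv.
move=> se Sy tM; have ct := cosh_gt0 t; have stc := ltW (sinh_lt_cosh t).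
have h1 := slope_bound se Sy tM; have h2 := dGB se Sy tM; have h3 := ampG se.
set g := G _ _ in h1 *; set g' := dEta _ _ _ in h2 *; set a := kruskal_amp s in h1 h2 h3 *.
have k1 : sinh M1 / cosh M1 < 1.
  rewrite ltr_pdivrMr ?cosh_gt0// mul1r; apply: le_lt_trans (sinh_lt_cosh _).
  exact: ler_norm.
have sC : `|sinh t| <= C by apply: (le_trans stc); exact: cosh_le.
have e1 : `|sinh t * g| <= cosh t * (sinh M0 / cosh M0 + Bd * (`|a| * C)).
  by rewrite normrM ler_pM.
have e2 : `|cosh t * (g' * (a * sinh t))| <= cosh t * (Bd * (`|a| * C)).
  rewrite normrM (ger0_norm (ltW ct)) ler_pM2l// normrM ler_pM//.
  by rewrite normrM ler_wpM2l.
rewrite subr_gt0; apply: le_lt_trans (ler_norm _) _.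
apply: le_lt_trans (ler_normD _ _) _; apply: le_lt_trans (lerD e1 e2) _.
by rewrite -mulrDr gtr_pMr//; lra.
Qed.

Lemma slope_gap_incr s y t t' : - eps < s < eps -> sphere y -> - M2 <= t -> t' <= M2 ->
  t < t' -> slope_gap s y t < slope_gap s y t'.
Proof.
move=> se Sy Mt tM tt'.
have rng z : t <= z <= t' -> `|z| <= M2.
  by move=> /andP[z1 z2]; rewrite ler_norml (le_trans Mt z1) (le_trans z2 tM).
have D z : t <= z <= t' -> is_derive z 1 (slope_gap s y) (slope_gap_deriv s y z).
  by move=> /rng zM; apply: is_derive_slope_gap => //; exact: amp_in_range.
have [z||z] := @MVT R (slope_gap s y) (slope_gap_deriv s y) t t' tt'.
- by rewrite in_itv/= => /andP[/ltW z1 /ltW z2]; apply: D; rewrite z1.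
- apply: derivable_within_continuous => z; rewrite in_itv/= => h.
  exact: (@ex_derive _ _ _ _ _ _ _ (D z h)).
rewrite in_itv/= => /andP[/ltW z1 /ltW z2] E; rewrite -subr_gt0 E; apply: mulr_gt0; last by rewrite subr_gt0.
by apply: slope_gap_derive_gt0 => //; apply: rng; rewrite z1.
Qed.

Lemma slope_gap_signs s y : - eps < s < eps -> sphere y ->
  slope_gap s y (- M1) < 0 < slope_gap s y M1.
Proof.
move=> se Sy; have nM1 : `|M1| <= M2 by rewrite gtr0_norm// ltW.
have c1 := cosh_gt0 M1.
have h3 := ampG se; have b0 : 0 <= Bd * (`|kruskal_amp s| * C).
  by rewrite mulr_ge0// mulr_ge0// ltW// cosh_gt0.
have key t : `|t| <= M2 -> `|G (kruskal_amp s * cosh t) y| < sinh M1 / cosh M1.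
  by move=> tM; apply: le_lt_trans (slope_bound se Sy tM) _; lra.
rewrite /slope_gap sinhN coshN.
have := key M1 nM1; rewrite -(ltr_pM2r c1) divfK ?gt_eqF// -[X in _ * X](ger0_norm (ltW c1)).
rewrite -normrM mulrC ltr_norml => /andP[k1 k2].
by apply/andP; split; lra.
Qed.

(** For 0 < s this is the height divided by 4m, by [tilt_unique]; for s <= 0 it defines
    the extension. *)
Definition tilt s y : R := xget 0 [set t | - M1 < t < M1 /\ slope_gap s y t = 0].

Lemma tiltP s y : - eps < s < eps -> sphere y ->
  - M1 < tilt s y < M1 /\ slope_gap s y (tilt s y) = 0.
Proof.
move=> se Sy; apply: (@xgetPex _ 0 [set t | - M1 < t < M1 /\ slope_gap s y t = 0]).
have /andP[g1 g2] := slope_gap_signs se Sy.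
have M10 : - M1 <= M1 by rewrite (@le_trans _ _ 0)// ?oppr_le0 ltW.
have cg : {within `[- M1, M1], continuous (slope_gap s y)}.
  apply: derivable_within_continuous => z; rewrite in_itv/= -ler_norml => zM.
  have zM2 : `|z| <= M2 by apply: le_trans zM _; exact: ltW.
  exact: (@ex_derive _ _ _ _ _ _ _ (is_derive_slope_gap Sy (amp_in_range se zM2))).
have [|z] := @IVT R (slope_gap s y) _ _ 0 M10 cg.
  by rewrite ge_min (ltW g1) le_max (ltW g2) orbT.
rewrite in_itv/= => /andP[z1 z2] z0; exists z; split=> //.
apply/andP; split; rewrite lt_neqAle ?z1 ?z2 andbT.
  by apply: contraTneq g1 => ->; rewrite z0 ltxx.
by apply: contraTneq g2 => <-; rewrite z0 ltxx.
Qed.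

Lemma tilt_unique s y t : - eps < s < eps -> sphere y -> `|t| <= M2 ->
  slope_gap s y t = 0 -> t = tilt s y.
Proof.
move=> se Sy; rewrite ler_norml => /andP[t1 t2] t0.
have [/andP[/ltW r1 /ltW r2] r0] := tiltP se Sy.
have r1' : - M2 <= tilt s y by apply: le_trans r1; rewrite lerN2 ltW.
have r2' : tilt s y <= M2 by apply: (le_trans r2); exact: ltW.
case: (ltgtP t (tilt s y)) => // h.
  by have := slope_gap_incr se Sy t1 r2' h; rewrite t0 r0 ltxx.
by have := slope_gap_incr se Sy r1' t2 h; rewrite t0 r0 ltxx.
Qed.

Let K (q : 'rV[R]_(1 + (1 + 3))) : R :=
  sinh (lsubmx q 0 0) - cosh (lsubmx q 0 0) *
  cyl G (consr (kruskal_amp (lsubmx (rsubmx q) 0 0) * cosh (lsubmx q 0 0)) (rsubmx (rsubmx q))).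

Let A := cyl_dom (R := R) (- eps) eps.
Let B : set 'rV[R]_(1 + (1 + 3)) := [set q | `|lsubmx q 0 0| < M2 /\ A (rsubmx q)].

Let K_consr t p : K (consr t p) = slope_gap (lsubmx p 0 0) (sproj (rsubmx p)) t.
Proof. by rewrite /K /consr row_mxKl row_mxKr mxE cyl_consr. Qed.

(** Continuity comes from strict monotonicity in t: the signs at t0 - e and t0 + e
    persist for nearby (s, y). The implicit function theorem does the rest. *)
Lemma smooth_tilt : smooth_cyl (- eps) eps tilt.
Proof.
have oA : open A by exact: open_cyl_dom.
have oT : open [set: 'rV[R]_(1 + (1 + 3))] by exact: openT.
pose q0 (q : 'rV[R]_(1 + (1 + 3))) := q 0 (lshift (1 + 3) 0).
pose q1 (q : 'rV[R]_(1 + (1 + 3))) := q 0 (rshift 1 (lshift 3 0)).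
have q0E q : lsubmx q 0 0 = q0 q by rewrite mxE.
have q1E q : lsubmx (rsubmx q) 0 0 = q1 q by rewrite !mxE.
have cr : continuous (fun q : 'rV[R]_(1 + (1 + 3)) => rsubmx q).
  move=> q; apply: continuous_row => j.
  have -> : (fun q : 'rV[R]_(1 + (1 + 3)) => rsubmx q 0 j) = (fun q => q 0 (rshift 1 j)).
    by apply/funext => z; rewrite mxE.
  exact: coord_continuous.
have oB : open B.
  rewrite openE => q [qM qA].
  have h1 : \forall z \near q, `|lsubmx z 0 0| < M2.
    have cn : {for q, continuous (fun z : 'rV[R]_(1 + (1 + 3)) => `|lsubmx z 0 0|)}.
      apply: (@continuous_comp _ _ _ (fun z : 'rV[R]_(1 + (1 + 3)) => lsubmx z 0 0) (@Num.norm R R)).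
        rewrite (_ : (fun z : 'rV[R]_(1 + (1 + 3)) => lsubmx z 0 0) = q0); last by apply/funext.
        exact: coord_continuous.
      exact: norm_continuous.
    exact: cn (open_nbhs_nbhs (conj (open_lt (y := M2)) qM)).
  have h2 : \forall z \near q, A (rsubmx z) by exact: cr (open_nbhs_nbhs (conj oA qA)).
  by apply: filterS (filterI h1 h2).
have smK : smooth_on B K.
  move=> k.
  have c0 : C_k k B (fun q => lsubmx q 0 0).
    by apply: C_k_eq (C_k_coord k _ oB) => // q _; rewrite q0E.
  have c1 : C_k k B (fun q => lsubmx (rsubmx q) 0 0).
    by apply: C_k_eq (C_k_coord k _ oB) => // q _; rewrite q1E.
  have ca : C_k k B (fun q => kruskal_amp (lsubmx (rsubmx q) 0 0)).
    apply: C_k_amp => // q [_ [/andP[e1 e2] _]].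
    by rewrite (lt_le_trans e2 eps1) andbT (le_lt_trans _ e1)// lerN2.
  have cX := C_kM oB ca (C_k_cosh oB c0).
  have cG : C_k k B (fun q => cyl G (consr
      (kruskal_amp (lsubmx (rsubmx q) 0 0) * cosh (lsubmx q 0 0)) (rsubmx (rsubmx q)))).
    apply: (@C_k_comp _ _ _ k B (cyl_dom (- d) d) _ _ oB _ _ _ (sG k)).
    - exact: open_cyl_dom.
    - move=> q [qM [qe qx]]; apply/cyl_domE; split=> //.
      by apply: amp_in_range => //; exact: ltW.
    elim/ord_split_ind => j.
      by apply: C_k_eq cX => // q _; rewrite consr_l.
    apply: C_k_eq (C_k_coord k (rshift 1 (rshift 1 j)) oB) => // q _.
    by rewrite consr_r !mxE.
  have := C_kD oB (C_k_sinh oB c0) (C_kM oB (C_k_cst k (-1) oB) (C_kM oB (C_k_cosh oB c0) cG)).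
  by apply: C_k_eq => // q _; rewrite /K mulN1r.
have tB t p : `|t| < M2 -> A p -> B (consr t p).
  by move=> tM Ap; rewrite /B/= row_mxKl row_mxKr mxE.
have tilt_lt p : A p -> `|cyl tilt p| < M1.
  by move=> [pe px]; have [+ _] := tiltP pe (sphere_sproj px); rewrite ltr_norml.
have tiltB p : A p -> B (consr (cyl tilt p) p).
  by move=> Ap; apply: tB => //; apply: lt_trans M12; exact: tilt_lt.
have ctilt (p : 'rV[R]_(1 + 3)) : A p -> {for p, continuous (cyl tilt)}.
  move=> Ap; have [pe px] := Ap; set t0 := cyl tilt p.
  have t0M := tilt_lt p Ap; rewrite -/t0 in t0M.
  have Kt0 : K (consr t0 p) = 0.
    by rewrite K_consr; have [_] := tiltP pe (sphere_sproj px).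
  have cK t : `|t| < M2 -> {for p, continuous (fun z => K (consr t z))}.
    move=> tM; apply: (@continuous_comp _ _ _ (fun z => consr t z) K).
      apply: continuous_row => j; apply: (@C_k_continuous _ _ 0 setT) => //.
      elim/ord_split_ind: j => j.
        by apply: (C_k_eq openT _ (C_k_cst 0 t openT)) => z _; rewrite consr_l.
      by apply: (C_k_eq openT _ (C_k_coord 0 j openT)) => z _; rewrite consr_r.
    by apply: (C_k_continuous (smK 0%N)); exact: tB.
  have FF : Filter (nbhs p) by exact: nbhs_filter.
  apply/(@cvgrPdist_le _ _ _ (nbhs p) FF) => e e0.
  pose e' := Num.min e (M2 - M1).
  have e'0 : 0 < e' by rewrite lt_min e0 subr_gt0.
  have e'e : e' <= e by rewrite ge_min lexx.
  have e'M : e' <= M2 - M1 by rewrite ge_min lexx orbT.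
  move: t0M; rewrite ltr_norml => /andP[t0M1 t0M2].
  have tpM : `|t0 + e'| < M2 by rewrite ltr_norml; apply/andP; split; lra.
  have tmM : `|t0 - e'| < M2 by rewrite ltr_norml; apply/andP; split; lra.
  have [t1 t2] : - M2 <= t0 - e' /\ t0 + e' <= M2.
    by move: tpM tmM; rewrite !ltr_norml => /andP[_ /ltW h1] /andP[/ltW h2 _].
  have Kp : 0 < K (consr (t0 + e') p).
    rewrite -Kt0 !K_consr; apply: slope_gap_incr => //; [exact: sphere_sproj|lra|by rewrite ltrDl].
  have Km : K (consr (t0 - e') p) < 0.
    rewrite -Kt0 !K_consr; apply: slope_gap_incr => //; [exact: sphere_sproj|lra|].
    by rewrite ltrBlDr ltrDl.
  have h1 : \forall z \near p, 0 < K (consr (t0 + e') z).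
    exact: (cK _ tpM _ (open_nbhs_nbhs (conj (open_gt (y := 0)) Kp))).
  have h2 : \forall z \near p, K (consr (t0 - e') z) < 0.
    exact: (cK _ tmM _ (open_nbhs_nbhs (conj (open_lt (y := 0)) Km))).
  apply: filterS (filterI (open_nbhs_nbhs (conj oA Ap)) (filterI h1 h2)) => z [Az [/= zp zm]].
  have [ze zx] := Az; have Sz := sphere_sproj zx.
  have := tilt_lt z Az; rewrite ltr_norml => /andP[r1 r2].
  have r0 : slope_gap (lsubmx z 0 0) (sproj (rsubmx z)) (cyl tilt z) = 0.
    by have [_] := tiltP ze Sz.
  rewrite K_consr in zp; rewrite K_consr in zm.
  have l1 : cyl tilt z <= t0 + e'.
    rewrite leNgt; apply/negP => h.
    have a1 : - M2 <= t0 + e' by lra.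
    have a2 : cyl tilt z <= M2 by rewrite ltW// (lt_trans r2).
    by have := slope_gap_incr ze Sz a1 a2 h; rewrite r0 => /(lt_trans zp); rewrite ltxx.
  have l2 : t0 - e' <= cyl tilt z.
    rewrite leNgt; apply/negP => h.
    have a1 : - M2 <= cyl tilt z by rewrite ltW// (lt_trans _ r1)// ltrN2.
    have a2 : t0 - e' <= M2 by lra.
    have := slope_gap_incr ze Sz a1 a2 h; rewrite r0 => H.
    by have := lt_trans H zm; rewrite ltxx.
  by rewrite -/t0 ler_norml; apply/andP; split; lra.
apply: (@smooth_implicit R (1 + 3) A B K (cyl tilt) oA oB smK) => //.
- by move=> p [pe px]; rewrite K_consr; have [_] := tiltP pe (sphere_sproj px).
- move=> p Ap; have [pe px] := Ap.
  have tM : `|cyl tilt p| <= M2 by rewrite ltW// (lt_trans (tilt_lt p Ap)).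
  have -> : 'D_(consr 1 0) K (consr (cyl tilt p) p) =
      'D_1 (slope_gap (lsubmx p 0 0) (sproj (rsubmx p))) (cyl tilt p).
    apply: derive_ext => h.
    by rewrite consrZ consrD scaler0 add0r K_consr.
  have [_ ->] := is_derive_slope_gap (sphere_sproj px) (amp_in_range pe tM).
  by rewrite gt_eqF//; apply: slope_gap_derive_gt0 => //; exact: sphere_sproj.
Qed.

End HeightEquation.

(** * The smooth extension *)

Section Extension.
Variables (R : realType) (m eta0 : R) (u : R -> 'rV[R]_3 -> R).
Hypotheses (m0 : 0 < m) (eta00 : 0 < eta0) (eta01 : eta0 <= 1).

Lemma graph_in_kruskal (d : R) F s y :
  (forall x, base m eta0 x ->
          let T := kruskal_T m (enorm x) (height m u x) in
          let X := kruskal_X m (enorm x) (height m u x) in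
          X < d -> T = F X (sproj x)) ->
  0 < s < eta0 -> sphere y ->
  kruskal_amp s * cosh (u s y / (4 * m)) < d ->
  kruskal_amp s * sinh (u s y / (4 * m)) = F (kruskal_amp s * cosh (u s y / (4 * m))) y.
Proof.
move=> HF se Sy; have [bx er eE yE] := sphere_point m0 eta01 se Sy.
have s1 : 0 < s < 1 by case/andP: se => -> /lt_le_trans ->.
have := HF _ bx; rewrite /= /kruskal_T /kruskal_X /height er eE yE.
by rewrite (amp_radius m0 s1).
Qed.

Lemma small_amp (c : R) : 0 < c -> exists2 s, 0 < s < eta0 & kruskal_amp s <= c.
Proof.
move=> /near_amp/nbhs_normP[e /= e0 He].
exists (Num.min e eta0 / 2).
  rewrite divr_gt0 ?lt_min ?e0 ?eta00//= ltr_pdivrMr// (@le_lt_trans _ _ eta0)//.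
    by rewrite ge_min lexx orbT.
  by rewrite ltr_pMr// ltr1n.
apply: (le_trans (ler_norm _)); apply: He; rewrite /ball_/= sub0r normrN.
rewrite ger0_norm ?divr_ge0// ?le_min ?ltW// ltr_pdivrMr// (@le_lt_trans _ _ e)//.
  by rewrite ge_min lexx.
by rewrite ltr_pMr// ltr1n.
Qed.

(** The passage to the limit s -> 0. *)
Lemma le_of_small_amp (a b k c0 : R) : 0 < c0 -> 0 <= k ->
  (forall s, 0 < s < eta0 -> kruskal_amp s <= c0 -> a <= b + k * kruskal_amp s) -> a <= b.
Proof.
move=> c00 k0 H; apply/ler_addgt0Pr => e e0.
have k1 : 0 < k + 1 by rewrite ltr_wpDl.
have [|s se ss] := @small_amp (Num.min c0 (e / (k + 1))).
  by rewrite lt_min c00 divr_gt0.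
move: ss; rewrite le_min => /andP[s1 s2].
apply: (le_trans (H s se s1)); rewrite lerD2l.
have s01 : 0 < s < 1 by case/andP: se => -> /lt_le_trans ->.
have a0 := kruskal_amp_gt0 s01.
rewrite ler_pdivlMr// in s2; apply: le_trans s2; rewrite mulrDr mulr1 (mulrC k).
by rewrite lerDl ltW.
Qed.

Lemma smooth_extension_exists : bounded_height eta0 u ->
  extends_across_bifurcation m eta0 u -> exists v, smooth_extension eta0 u v.
Proof.
move=> [M HM] [d [F [d0 sF _ HF]]].
pose M0 := `|M| / (4 * m).
have M00 : 0 <= M0 by rewrite divr_ge0// mulr_ge0// ltW.
(* tau is sought in ]-M1, M1[ and everything is controlled on [-M2, M2] *)
pose M1 := M0 + 1; pose M2 := M0 + 2; pose C := cosh M2.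
have C0 : 0 < C by exact: cosh_gt0.
have c0 : 0 < cosh M0 by exact: cosh_gt0.
have uM s y : 0 < s < eta0 -> sphere y -> `|u s y / (4 * m)| <= M0.
  move=> se Sy; rewrite normrM normfV (ger0_norm (_ : 0 <= 4 * m)); last by rewrite mulr_ge0// ltW.
  apply: ler_wpM2r; first by rewrite invr_ge0 mulr_ge0// ltW.
  exact: (le_trans (HM s y se Sy) (ler_norm M)).
have [G sG FG] := hadamard_cyl sF.
pose rho := d / 2.
have rho0 : 0 < rho by rewrite divr_gt0.
have rd : rho < d by rewrite ltr_pdivrMr// ltr_pMr// ltr1n.
have nrd : - d < - rho by rewrite ltrN2.
have [BF BF0 HBF] := cyl_bounded (smooth_dEta sF) nrd rd.
have [Bd Bd0 HBd] := cyl_bounded (smooth_dEta sG) nrd rd.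
have in_rho X : `|X| <= rho -> - rho <= X <= rho by rewrite ler_norml.
have r00 : - rho <= 0 <= rho by rewrite oppr_le0 ltW.
have lipF X y : `|X| <= rho -> sphere y -> `|F X y - F 0 y| <= BF * `|X|.
  move=> Xr Sy; rewrite -[in leRHS](subr0 X); apply: (cyl_lipschitz sF nrd rd) => //.
    by move=> s sr; exact: HBF.
  exact: in_rho.
have lipG X y : `|X| <= rho -> sphere y -> `|G X y - G 0 y| <= Bd * `|X|.
  move=> Xr Sy; rewrite -[in leRHS](subr0 X); apply: (cyl_lipschitz sG nrd rd) => //.
    by move=> s sr; exact: HBd.
  exact: in_rho.
have graph s y : 0 < s < eta0 -> sphere y -> kruskal_amp s <= rho / C ->
   let t := u s y / (4 * m) in let X := kruskal_amp s * cosh t in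
   [/\ 0 < kruskal_amp s, 0 < X, `|X| <= rho, X <= kruskal_amp s * C
     & kruskal_amp s * sinh t = F X y].
  move=> se Sy sa t X; have tM := uM s y se Sy.
  have s01 : 0 < s < 1 by case/andP: se => -> /lt_le_trans ->.
  have a0 := kruskal_amp_gt0 s01; have ct := cosh_gt0 t.
  have X0 : 0 < X by rewrite mulr_gt0.
  have XC : X <= kruskal_amp s * C.
    by rewrite ler_pM2l// cosh_le// (le_trans tM)// /M2 lerDl.
  have Xr : X <= rho by apply: (le_trans XC); rewrite -ler_pdivlMr.
  split=> //; first by rewrite gtr0_norm.
  by apply: (graph_in_kruskal HF) => //; exact: le_lt_trans rd.
have rC : 0 < rho / C by rewrite divr_gt0.
(* |T| < X = O(A) on the surface *)
have F0 y : sphere y -> F 0 y = 0.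
  move=> Sy; apply/eqP; rewrite -normr_le0.
  apply: (@le_of_small_amp _ 0 ((1 + BF) * C) (rho / C)) => //.
    by rewrite mulr_ge0 ?addr_ge0// ltW.
  move=> s se sa; have [a0 X0 Xr XC E] := graph s y se Sy sa.
  set t := u s y / _ in X0 Xr XC E; set X := _ * cosh t in X0 Xr XC E.
  have h1 := lipF X y Xr Sy; rewrite (gtr0_norm X0) in h1.
  have h2 : `|F X y| <= kruskal_amp s * C.
    rewrite -E normrM (gtr0_norm a0) ler_pM2l//.
    apply: (le_trans (ltW (sinh_lt_cosh t))).
    by rewrite -(ler_pM2l a0).
  have h3 : BF * X <= BF * (kruskal_amp s * C) by rewrite ler_wpM2l.
  have -> : F 0 y = F X y - (F X y - F 0 y) by rewrite opprB addrC subrK.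
  apply: (le_trans (ler_normB _ _)).
  by rewrite add0r; move: h1 h2 h3; nra.
(* T / X = tanh tau with |tau| <= M0 *)
have G0 y : sphere y -> `|G 0 y| * cosh M0 <= sinh M0.
  move=> Sy; apply: (@le_of_small_amp _ _ (Bd * C * cosh M0) (rho / C)) => //.
    by rewrite mulr_ge0 ?(ltW c0)// mulr_ge0// ltW.
  move=> s se sa; have [a0 X0 Xr XC E] := graph s y se Sy sa.
  set t := u s y / _ in X0 Xr XC E; set X := _ * cosh t in X0 Xr XC E.
  have h1 := lipG X y Xr Sy; rewrite (gtr0_norm X0) in h1.
  have Xd : - d < X < d.
    by rewrite -ltr_norml; exact: le_lt_trans Xr rd.
  have ct := cosh_gt0 t.
  have GE : cosh t * G X y = sinh t.
    apply: (mulfI (lt0r_neq0 a0)); rewrite E (FG X y Xd Sy) F0// add0r.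
    by rewrite /X mulrA.
  have h2 : `|G X y| * cosh M0 <= sinh M0.
    rewrite -(ler_pM2l ct) mulrA -{1}(gtr0_norm ct) -normrM GE (mulrC (cosh t)).
    by apply: sinh_ratio; exact: uM.
  have h3 : Bd * X <= Bd * (kruskal_amp s * C) by rewrite ler_wpM2l.
  have -> : G 0 y = G X y - (G X y - G 0 y) by rewrite opprB addrC subrK.
  have h4 : `|G X y - (G X y - G 0 y)| <= `|G X y| + Bd * (kruskal_amp s * C).
    by apply: (le_trans (ler_normB _ _)); rewrite lerD2l (le_trans h1).
  rewrite -(ler_pM2r c0) in h4; apply: (le_trans h4).
  by rewrite mulrDl; move: h2; lra.
(* tanh M1 - tanh M0 is the room left for the variation of G over the range of X;
   c bounds the amplitude accordingly *)
pose gap := sinh M1 / cosh M1 - sinh M0 / cosh M0.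
have gap0 : 0 < gap.
  have c1 := cosh_gt0 M1.
  rewrite subr_gt0 ltr_pdivrMr// mulrAC ltr_pdivlMr// -subr_gt0.
  have -> : sinh M1 * cosh M0 - sinh M0 * cosh M1 = sinh (M1 - M0).
    by rewrite sinhB (mulrC (cosh M1)).
  by apply: sinh_gt0; rewrite /M1 addrAC subrr add0r.
pose c := Num.min (rho / C) (gap / (4 * (Bd + 1) * C)).
have B1 : 0 < Bd + 1 by rewrite ltr_wpDl.
have cpos : 0 < c by rewrite lt_min rC /= divr_gt0// mulr_gt0// mulr_gt0//.
have /nbhs_normP[e /= e0 He] := near_amp cpos.
pose eps := Num.min e eta0.
have eps0 : 0 < eps by rewrite lt_min e0.
have epse : eps <= eta0 by rewrite ge_min lexx orbT.
have eps1 : eps <= 1 by exact: le_trans eta01.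
have ampc s : - eps < s < eps -> `|kruskal_amp s| <= c.
  rewrite -ltr_norml => se; apply: He; rewrite /ball_/= sub0r normrN.
  by apply: lt_le_trans se _; rewrite ge_min lexx.
have ampr s : - eps < s < eps -> `|kruskal_amp s| * C <= rho.
  move=> /ampc h; rewrite -ler_pdivlMr//; apply: le_trans h _.
  by rewrite ge_min lexx.
have ampd s : - eps < s < eps -> `|kruskal_amp s| * C < d.
  by move=> /ampr h; exact: le_lt_trans rd.
have inr s t : - eps < s < eps -> `|t| <= M2 ->
    `|kruskal_amp s * cosh t| <= `|kruskal_amp s| * C.
  move=> se tM; rewrite normrM (gtr0_norm (cosh_gt0 t)) ler_wpM2l//.
  exact: cosh_le.
have dGB s y : - eps < s < eps -> sphere y -> forall t, `|t| <= M2 ->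
    `|dEta G (kruskal_amp s * cosh t) y| <= Bd.
  move=> se Sy t tM; apply: HBd => //; apply: in_rho.
  by apply: (le_trans (inr s t se tM)); exact: ampr.
have GB s y : - eps < s < eps -> sphere y -> forall t, `|t| <= M2 ->
    `|G (kruskal_amp s * cosh t) y| * cosh M0 <=
    sinh M0 + Bd * (`|kruskal_amp s| * C) * cosh M0.
  move=> se Sy t tM; set X := _ * cosh t.
  have Xa : `|X| <= `|kruskal_amp s| * C by exact: inr.
  have h1 := lipG X y (le_trans Xa (ampr s se)) Sy.
  have -> : G X y = G 0 y + (G X y - G 0 y) by rewrite addrC subrK.
  have h2 : `|G 0 y + (G X y - G 0 y)| <= `|G 0 y| + Bd * (`|kruskal_amp s| * C).
    apply: (le_trans (ler_normD _ _)); rewrite lerD2l (le_trans h1)//.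
    by rewrite ler_wpM2l.
  rewrite -(ler_pM2r c0) in h2; apply: (le_trans h2).
  by rewrite mulrDl lerD2r; exact: G0.
have ampG s : - eps < s < eps -> 2 * (Bd * (`|kruskal_amp s| * C)) < gap.
  move=> /ampc; rewrite le_min => /andP[_]; rewrite ler_pdivlMr; last by rewrite mulr_gt0// mulr_gt0.
  have : 0 <= `|kruskal_amp s| * C by rewrite mulr_ge0// ltW.
  set a := `|_|; move=> a0 h.
  have h' : a * (4 * (Bd + 1) * C) = 4 * (Bd * (a * C)) + 4 * (a * C) by ring.
  rewrite h' in h; have : 0 <= Bd * (a * C) by rewrite mulr_ge0.
  by lra.
exists (fun s y => 4 * m * tilt G M0 s y); rewrite /smooth_extension; exists eps; split.
- by rewrite eps0 epse.
- apply: smooth_mul; first exact: smooth_cst.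
  exact: (@smooth_tilt R G d sG M0 Bd eps).
move=> s y /andP[s0 se] Sy.
have se0 : 0 < s < eta0 by rewrite s0 (lt_le_trans se).
have se' : - eps < s < eps by rewrite se andbT (lt_trans _ s0)// oppr_lt0.
have sa : kruskal_amp s <= rho / C.
  by apply: (le_trans (ler_norm _)); apply: (le_trans (ampc s se')); rewrite ge_min lexx.
have [a0 X0 Xr XC E] := graph s y se0 Sy sa.
set t := u s y / _ in X0 Xr XC E; set X := _ * cosh t in X0 Xr XC E.
have Xd : - d < X < d by rewrite -ltr_norml; exact: le_lt_trans Xr rd.
have <- : t = tilt G M0 s y.
  apply: (@tilt_unique R G d sG M0 Bd eps) => //.
    by apply: (le_trans (uM s y se0 Sy)); rewrite lerDl.
  apply/eqP; rewrite subr_eq0; apply/eqP; apply: (mulfI (lt0r_neq0 a0)).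
  by rewrite E (FG X y Xd Sy) F0// add0r -mulrA.
by rewrite /t mulrC divfK// gt_eqF// mulr_gt0.
Qed.

End Extension.

(** * Quantities determined by the boundary values *)

Section Expressions.
Variable R : realType.
Implicit Types (e : sph_expr R) (v : R -> 'rV[R]_3 -> R) (y : 'rV[R]_3).

Fixpoint sph_exprD (i : 'I_3) e : sph_expr R :=
  match e with
  | SphConst _ => SphConst 0
  | SphDeriv t => SphDeriv R (i :: t)
  | SphAdd e1 e2 => SphAdd (sph_exprD i e1) (sph_exprD i e2)
  | SphMul e1 e2 => SphAdd (SphMul e1 (sph_exprD i e2)) (SphMul e2 (sph_exprD i e1))
  end.

Variables a b : R.

Lemma smooth_sph_eval e v : smooth_cyl a b v ->
  smooth_cyl a b (fun s y => sph_eval e (v s) y).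
Proof.
move=> sv; elim: e => [c|t|e1 IH1 e2 IH2|e1 IH1 e2 IH2] /=.
- exact: smooth_cst.
- elim: t => [//|i t IH].
  exact: (@smooth_dSph _ _ _ i (fun s y => sph_derivs t (v s) y)).
- exact: smooth_add.
- exact: smooth_mul.
Qed.

(** The formal derivative is correct at every s, since v s is smooth on the sphere. *)
Lemma dSph_sph_eval e v i s y : smooth_cyl a b v -> a < s < b -> sphere y ->
  sph_deriv i (fun z => sph_eval e (v s) z) y = sph_eval (sph_exprD i e) (v s) y.
Proof.
move=> sv sab Sy.
change (dSph i (fun s y => sph_eval e (v s) y) s y = sph_eval (sph_exprD i e) (v s) y).
elim: e => [c|t|e1 IH1 e2 IH2|e1 IH1 e2 IH2] /=.
- exact: (dSph_radial i (fun _ => c)).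
- by [].
- rewrite -IH1 -IH2 (dSph_add sab Sy i (Phi := fun s y => sph_eval e1 (v s) y)
    (Psi := fun s y => sph_eval e2 (v s) y))//; exact: smooth_sph_eval.
- rewrite -IH1 -IH2 (dSph_mul sab Sy i (Phi := fun s y => sph_eval e1 (v s) y)
    (Psi := fun s y => sph_eval e2 (v s) y))//; exact: smooth_sph_eval.
Qed.

Lemma sph_derivs_eval e v t (f : 'rV[R]_3 -> R) s y : smooth_cyl a b v -> a < s < b ->
  (forall z, sphere z -> f z = sph_eval e (v s) z) -> sphere y ->
  sph_derivs t f y = sph_eval (foldr sph_exprD e t) (v s) y.
Proof.
move=> sv sab E; elim: t y => [|i t IH] y Sy /=; first exact: E.
rewrite -(dSph_sph_eval _ _ sv sab Sy).
exact: (@dSph_congr _ i (fun _ => sph_derivs t f)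
  (fun _ => sph_eval (foldr sph_exprD e t) (v s)) s).
Qed.

End Expressions.

Section OneSided.
Variable R : realType.

Lemma eq_at_right (f g : R -> R) (c : R) : 0 < c ->
  {for 0, continuous f} -> {for 0, continuous g} ->
  (forall s, 0 < s < c -> f s = g s) -> f 0 = g 0.
Proof.
move=> c0 cf cg E; apply/eqP; rewrite -subr_eq0 -normr_le0; apply/ler_addgt0Pr => e e0.
rewrite add0r.
have ch : {for 0, continuous (fun s => f s - g s)} by exact: continuousB.
have /nbhs_normP[d /= d0 Hd] : \forall s \near 0, `|(f 0 - g 0) - (f s - g s)| < e.
  by move: ch => /cvgr_dist_lt/(_ _ e0).
have m0 : 0 < Num.min c d by rewrite lt_min c0.
have h0 : 0 < Num.min c d / 2 by rewrite divr_gt0.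
have h1 : Num.min c d / 2 < Num.min c d by rewrite ltr_pdivrMr// ltr_pMr// ltr1n.
have := Hd (Num.min c d / 2); rewrite /ball_/= sub0r normrN gtr0_norm//.
have [hc hd] : Num.min c d / 2 < c /\ Num.min c d / 2 < d.
  by apply/andP; rewrite -lt_min.
by move=> /(_ hd); rewrite (E (_ / 2)) ?h0// subrr subr0 => /ltW.
Qed.

Lemma continuous_eta a b Phi s (y : 'rV[R]_3) : smooth_cyl a b Phi -> a < s < b -> sphere y ->
  {for s, continuous (Phi ^~ y)}.
Proof.
move=> sm sab Sy; apply: differentiable_continuous; apply/derivable1_diffP.
exact: (derivable_eta sab Sy sm).
Qed.

End OneSided.

Section Determined.
Variables (R : realType) (sol : R -> (R -> 'rV[R]_3 -> R) -> Prop).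
Hypothesis sol_gt0 : forall eps v, sol eps v -> 0 < eps.
Hypothesis sol_smooth : forall eps v, sol eps v -> smooth_cyl (- eps) eps v.
Local Notation field := ((R -> 'rV[R]_3 -> R) -> R -> 'rV[R]_3 -> R).
Implicit Types (Phi Psi : field) (v : R -> 'rV[R]_3 -> R) (y : 'rV[R]_3).

Definition smooth_field Phi :=
  forall eps v, sol eps v -> smooth_cyl (- eps) eps (Phi v).

Definition boundary_expr Phi :=
  exists e, forall eps v, sol eps v -> forall y, sphere y ->
    Phi v 0 y = sph_eval e (v 0) y.

(** The derivatives of order < n at s = 0 are universal expressions in the boundary
    values. The definition recurses on the derivative rather than quantifying over the
    order, so that the rules of calculus are only needed for first derivatives. *)
Fixpoint determined n Phi : Prop :=
  smooth_field Phi /\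
  (if n is n'.+1 then boundary_expr Phi /\ determined n' (fun v => dEta (Phi v)) else True).

Lemma determined_smooth n Phi : determined n Phi -> smooth_field Phi.
Proof. by case: n => [|n] []. Qed.

Lemma sol_mid eps v : sol eps v -> - eps < 0 < eps.
Proof. by move=> /sol_gt0 e0; rewrite oppr_lt0 e0. Qed.

Lemma smooth_field_dEta Phi : smooth_field Phi -> smooth_field (fun v => dEta (Phi v)).
Proof. by move=> sm eps v /sm; exact: smooth_dEta. Qed.

Lemma determined_boundary n Phi : determined n Phi -> forall k, (k < n)%N ->
  exists e, forall eps v, sol eps v -> forall y, sphere y ->
    derive1n k (Phi v ^~ y) 0 = sph_eval e (v 0) y.
Proof.
have iterE k (f : R -> 'rV[R]_3 -> R) y : derive1n k (f ^~ y) = (iter k (@dEta R) f) ^~ y.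
  by elim: k => [//|k IH]; rewrite derive1nS IH.
move=> dP k kn; suff [e He] : exists e, forall eps v, sol eps v -> forall y, sphere y ->
    iter k (@dEta R) (Phi v) 0 y = sph_eval e (v 0) y.
  by exists e => eps v sv y Sy; rewrite iterE (He _ _ sv).
elim: k n Phi kn dP => [|k IH] [//|n] Phi kn [_ [bP dP]]; first exact: bP.
by have [e He] := IH n _ kn dP; exists e => eps v sv y Sy; rewrite iterSr (He eps).
Qed.

(** Agreement for s > 0 suffices: at s = 0 all derivatives of smooth functions are
    limits from the right. *)
Lemma determined_congr n Phi Psi : smooth_field Psi ->
  (forall eps v, sol eps v -> forall s y, 0 < s < eps -> sphere y -> Phi v s y = Psi v s y) ->
  determined n Phi -> determined n Psi.
Proof.
elim: n Phi Psi => [//|n IH] Phi Psi sP E [sm [[e He] dP]]; split=> //; split.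
  exists e => eps v sv y Sy; rewrite -(He _ _ sv)//.
  have e0 := sol_gt0 sv; have mid := sol_mid sv.
  apply: (@eq_at_right _ (Psi v ^~ y) (Phi v ^~ y) eps e0).
  - exact: continuous_eta (sP _ _ sv) mid Sy.
  - exact: continuous_eta (sm _ _ sv) mid Sy.
  - by move=> s se; rewrite (E eps).
apply: IH dP; first exact: smooth_field_dEta.
move=> eps v sv s y se Sy.
by apply: (dEta_congr se) => s' se'; exact: (E eps).
Qed.

Lemma determinedW n Phi : determined n.+1 Phi -> determined n Phi.
Proof.
elim: n Phi => [|n IH] Phi [sm [bP dP]]; split=> //.
by split=> //; exact: IH.
Qed.

Lemma determined_dEta n Phi : determined n.+1 Phi -> determined n (fun v => dEta (Phi v)).
Proof. by case=> _ []. Qed.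

Lemma determined_cst n (c : R) : determined n (fun _ _ _ => c).
Proof.
elim: n c => [|n IH] c; split=> //; first by move=> *; exact: smooth_cst.
  by move=> *; exact: smooth_cst.
split; first by exists (SphConst c).
apply: determined_congr (IH 0).
  by apply: smooth_field_dEta => eps v _; exact: smooth_cst.
by move=> eps v sv s y se Sy; rewrite dEta_cst.
Qed.

Lemma determined_add n Phi Psi : determined n Phi -> determined n Psi ->
  determined n (fun v s y => Phi v s y + Psi v s y).
Proof.
elim: n Phi Psi => [|n IH] Phi Psi [s1 d1] [s2 d2]; split.
- by move=> eps v sv; apply: smooth_add; [exact: s1|exact: s2].
- by [].
- by move=> eps v sv; apply: smooth_add; [exact: s1|exact: s2].
case: d1 d2 => [[e1 H1] d1] [[e2 H2] d2]; split.
  by exists (SphAdd e1 e2) => eps v sv y Sy /=; rewrite (H1 eps) ?(H2 eps).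
apply: determined_congr (IH _ _ d1 d2).
  apply: smooth_field_dEta => eps v sv; apply: smooth_add; [exact: s1|exact: s2].
move=> eps v sv s y /andP[s0 se] Sy; rewrite (dEta_add (a := - eps) (b := eps))//.
- by rewrite se andbT (lt_trans _ s0)// oppr_lt0 (sol_gt0 sv).
- exact: s1.
- exact: s2.
Qed.

Lemma sol_sub eps v s : sol eps v -> 0 < s < eps -> - eps < s < eps.
Proof. by move=> /sol_gt0 e0 /andP[s0 ->]; rewrite andbT (lt_trans _ s0)// oppr_lt0. Qed.

Lemma determined_mul n Phi Psi : determined n Phi -> determined n Psi ->
  determined n (fun v s y => Phi v s y * Psi v s y).
Proof.
elim: n Phi Psi => [|n IH] Phi Psi d1 d2.
  by split=> // eps v sv; apply: smooth_mul; [exact: d1.1|exact: d2.1].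
have s1 := d1.1; have s2 := d2.1.
have sm : smooth_field (fun v s y => Phi v s y * Psi v s y).
  by move=> eps v sv; apply: smooth_mul; [exact: s1|exact: s2].
split=> //; split.
  have [_ [[e1 H1] _]] := d1; have [_ [[e2 H2] _]] := d2.
  by exists (SphMul e1 e2) => eps v sv y Sy /=; rewrite (H1 eps) ?(H2 eps).
apply: determined_congr (determined_add (IH _ _ (determinedW d1) (determined_dEta d2))
  (IH _ _ (determinedW d2) (determined_dEta d1))); first exact: smooth_field_dEta.
move=> eps v sv s y se Sy.
by rewrite (dEta_mul (sol_sub sv se) Sy (s1 _ _ sv) (s2 _ _ sv)).
Qed.

Lemma determined_opp n Phi : determined n Phi -> determined n (fun v s y => - Phi v s y).
Proof.
move=> d; apply: determined_congr (determined_mul (determined_cst n (-1)) d).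
  by move=> eps v sv; apply: smooth_opp; exact: (determined_smooth d).
by move=> *; rewrite mulN1r.
Qed.

Lemma determined_sub n Phi Psi : determined n Phi -> determined n Psi ->
  determined n (fun v s y => Phi v s y - Psi v s y).
Proof. by move=> d1 d2; apply: determined_add => //; exact: determined_opp. Qed.

Lemma determined_exp n k Phi : determined n Phi -> determined n (fun v s y => Phi v s y ^+ k).
Proof.
move=> d; elim: k => [|k IH]; first exact: determined_cst.
apply: determined_congr (determined_mul d IH).
  by move=> eps v sv; apply: smooth_exp; exact: (determined_smooth d).
by move=> *; rewrite exprS.
Qed.

Lemma determined_sum n k (Phi : 'I_k -> field) : (forall i, determined n (Phi i)) ->
  determined n (fun v s y => \sum_(i < k) Phi i v s y).
Proof.
elim: k Phi => [|k IH] Phi d.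
  apply: determined_congr (determined_cst n 0).
    by move=> eps v sv; apply: smooth_sum => -[].
  by move=> *; rewrite big_ord0.
apply: determined_congr (determined_add (d ord0) (IH _ (fun i => d (lift ord0 i)))).
  by move=> eps v sv; apply: smooth_sum => i; exact: (determined_smooth (d i)).
by move=> *; rewrite big_ord_recl.
Qed.

Lemma determined_dSph n i Phi : determined n Phi -> determined n (fun v => dSph i (Phi v)).
Proof.
have sd Psi : smooth_field Psi -> smooth_field (fun v => dSph i (Psi v)).
  by move=> sm eps v sv; apply: smooth_dSph; exact: sm.
elim: n Phi => [|n IH] Phi [sm d]; split=> //; try exact: sd.
case: d => -[e He] d; split.
  exists (sph_exprD i e) => eps v sv y Sy.
  rewrite -(dSph_sph_eval _ _ (sol_smooth sv) (sol_mid sv) Sy).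
  exact: (@dSph_congr _ i (Phi v) (fun s => sph_eval e (v s)) 0 y (He _ _ sv) Sy).
apply: determined_congr (IH _ d); first by apply: smooth_field_dEta; exact: sd.
move=> eps v sv s y se Sy.
by rewrite (dEta_dSph (sol_sub sv se) Sy i (sm _ _ sv)).
Qed.

(** A factor s gains one order, as the k-th derivative of s Phi at s = 0 is k times the
    derivative of Phi of order k - 1. *)
Lemma determined_eta n Phi : determined n Phi ->
  determined n.+1 (fun v s y => s * Phi v s y).
Proof.
have sd Psi : smooth_field Psi -> smooth_field (fun v s y => s * Psi v s y).
  by move=> sm eps v sv; apply: smooth_mul; [exact: smooth_eta|exact: sm].
elim: n Phi => [|n IH] Phi d; have sm := determined_smooth d; split; try exact: sd; split.
- by exists (SphConst 0) => *; rewrite mul0r.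
- by split=> //; apply: smooth_field_dEta; exact: sd.
- by exists (SphConst 0) => *; rewrite mul0r.
apply: determined_congr (determined_add d (IH _ (determined_dEta d))).
  by apply: smooth_field_dEta; exact: sd.
move=> eps v sv s y se Sy; have sab := sol_sub sv se.
rewrite (dEta_mul sab Sy (Phi := fun s _ => s)); [|exact: smooth_eta|exact: sm].
by rewrite dEta_eta mulr1 addrC.
Qed.

Lemma determined_eta_id n : determined n (fun _ s _ => s).
Proof.
case: n => [|n]; first by split=> // eps v sv; exact: smooth_eta.
apply: determined_congr (determined_eta (determined_cst n 1)).
  by move=> eps v sv; exact: smooth_eta.
by move=> *; rewrite mulr1.
Qed.

Lemma determined_euler n Phi : determined n Phi ->
  determined n (fun v s y => s * dEta (Phi v) s y).
Proof.
case: n => [|n] d; last by apply: determined_eta; exact: determined_dEta.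
split=> // eps v sv; apply: smooth_mul; first exact: smooth_eta.
by apply: smooth_dEta; exact: d.1.
Qed.

(** Division by a quantity with a known nonzero boundary value: in Phi Psi' =
    (Phi Psi)' - Psi Phi' the right-hand side is known to one order less, and the
    same argument applies to Psi'. *)
Lemma determined_cancel n Phi Psi (c : R) : c != 0 ->
  (forall eps v, sol eps v -> forall y, sphere y -> Phi v 0 y = c) ->
  smooth_field Psi -> determined n Phi ->
  determined n (fun v s y => Phi v s y * Psi v s y) -> determined n Psi.
Proof.
move=> c0 Hc; elim: n Psi => [//|n IH] Psi sP d1 d2; split=> //; split.
  have [_ [[e He] _]] := d2; exists (SphMul (SphConst c^-1) e) => eps v sv y Sy /=.
  by rewrite -(He _ _ sv)// (Hc eps)// mulKf.
have d3 : determined n Psi by apply: IH => //; exact: determinedW.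
apply: IH; [exact: smooth_field_dEta|exact: determinedW|].
apply: determined_congr (determined_sub (determined_dEta d2)
  (determined_mul d3 (determined_dEta d1))).
  move=> eps v sv; apply: smooth_mul; first exact: (determined_smooth d1).
  exact: smooth_field_dEta.
move=> eps v sv s y se Sy; have sab := sol_sub sv se.
by rewrite (dEta_mul sab Sy (determined_smooth d1 sv) (sP _ _ sv)) addrK.
Qed.

(** A square determines its root once the boundary value of the root is known and
    nonzero: the derivative of the square is 2 Phi Phi', and Phi can be cancelled. *)
Lemma determined_sqrt n Phi (c : R) : c != 0 ->
  (forall eps v, sol eps v -> forall y, sphere y -> Phi v 0 y = c) ->
  smooth_field Phi -> determined n (fun v s y => Phi v s y ^+ 2) -> determined n Phi.
Proof.
move=> c0 Hc sP; elim: n => [//|n IH] d; split=> //; split.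
  by exists (SphConst c).
have dn := IH (determinedW d).
have sd := smooth_field_dEta sP.
apply: (determined_cancel c0 Hc) => //.
apply: determined_congr (determined_mul (determined_cst n 2^-1) (determined_dEta d)).
  by move=> eps v sv; apply: smooth_mul; [exact: sP|exact: sd].
move=> eps v sv s y se Sy; have sab := sol_sub sv se.
have -> : dEta (fun s y => Phi v s y ^+ 2) s y = dEta (fun s y => Phi v s y * Phi v s y) s y.
  by apply: (dEta_congr sab) => s' _; rewrite expr2.
by rewrite (dEta_mul sab Sy (sP _ _ sv) (sP _ _ sv)); field.
Qed.

(** The operator s d/ds + (k + 1) can be inverted on Taylor series at s = 0: on
    boundary values it is multiplication by k + 1, and differentiation turns k into
    k + 1. *)
Lemma determined_fuchs n k Phi : smooth_field Phi ->
  determined n (fun v s y => s * dEta (Phi v) s y + k.+1%:R * Phi v s y) ->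
  determined n Phi.
Proof.
elim: n k Phi => [//|n IH] k Phi sP d; split=> //; split.
  have [_ [[e He] _]] := d; exists (SphMul (SphConst k.+1%:R^-1) e) => eps v sv y Sy /=.
  by rewrite -(He _ _ sv)// mul0r add0r mulKf// pnatr_eq0.
have sd := smooth_field_dEta sP.
apply: (IH k.+1) => //; apply: determined_congr (determined_dEta d).
  move=> eps v sv; have s1 := sd _ _ sv; smooth.
move=> eps v sv s y se Sy; have sab := sol_sub sv se.
have s1 := sd _ _ sv; have s2 := sP _ _ sv.
rewrite (dEta_add sab Sy (Phi := fun s y => s * dEta (Phi v) s y)
  (Psi := fun s y => k.+1%:R * Phi v s y)); [|smooth|smooth].
rewrite (dEta_mul sab Sy (Phi := fun s _ => s) (Psi := dEta (Phi v))); [|smooth|smooth].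
rewrite (dEta_mul sab Sy (Phi := fun _ _ => k.+1%:R)); [|smooth|smooth].
by rewrite dEta_eta dEta_cst -(natr1 k.+1); ring.
Qed.

End Determined.

(** * The recursion *)

Section Recursion.
Variables (R : realType) (m H : R).
Hypothesis m0 : 0 < m.

Definition cmc_solution (eps : R) (v : R -> 'rV[R]_3 -> R) : Prop :=
  [/\ 0 < eps, smooth_cyl (- eps) eps v
    & forall s y, 0 < s < eps -> sphere y -> 0 < slope_factor m v s y /\
        cmc_op m v s y = 3 * H * Num.sqrt (slope_factor m v s y) ^+ 3].

Let sol_gt0 eps v : cmc_solution eps v -> 0 < eps. Proof. by case. Qed.
Let sol_smooth eps v : cmc_solution eps v -> smooth_cyl (- eps) eps v. Proof. by case. Qed.
Local Notation det n Phi := (determined cmc_solution n Phi).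

Local Notation dadd := (determined_add sol_gt0).
Local Notation dsub := (determined_sub sol_gt0).
Local Notation dmul := (determined_mul sol_gt0).
Local Notation dexp := (determined_exp sol_gt0).
Local Notation dsum := (determined_sum sol_gt0).
Local Notation dcst := (determined_cst sol_gt0 _).
Local Notation dsph := (determined_dSph sol_gt0 sol_smooth).

Lemma slope_factor0 v y : slope_factor m v 0 y = 1.
Proof. by rewrite /slope_factor expr0n mul0r subr0. Qed.

Lemma cmc_op0 v y : cmc_op m v 0 y = (8 * m ^+ 2)^-1 * dEta v 0 y.
Proof.
rewrite /cmc_op slope_factor0 /inv_radius.
by field; rewrite gt_eqF.
Qed.

(** The limit s -> 0 of the equation. *)
Lemma cmc_op_boundary eps v y : cmc_solution eps v -> sphere y -> cmc_op m v 0 y = 3 * H.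
Proof.
move=> sv Sy; have [e0 sm E] := sv; have mid := sol_mid sol_gt0 sv.
have cW : {for 0, continuous (slope_factor m v ^~ y)}.
  exact: continuous_eta (smooth_slope_factor m sm) mid Sy.
rewrite (@eq_at_right _ (cmc_op m v ^~ y)
  (fun s => 3 * H * Num.sqrt (slope_factor m v s y) ^+ 3) eps e0).
- by rewrite slope_factor0 sqrtr1 expr1n mulr1.
- exact: continuous_eta (smooth_cmc_op m sm) mid Sy.
- apply: continuousM; first exact: cst_continuous.
  have cS : {for 0, continuous (fun s => Num.sqrt (slope_factor m v s y))}.
    by apply: (@continuous_comp _ _ _ (slope_factor m v ^~ y) (@Num.sqrt R)) => //;
    exact: sqrt_continuous.
  exact: (continuousM cS (continuousM cS cS)).
- by move=> s se; exact: (E s y se Sy).2.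
Qed.

Lemma boundary_slope eps v y : cmc_solution eps v -> sphere y ->
  derive1 (v ^~ y) 0 = 24 * m ^+ 2 * H.
Proof.
move=> sv Sy; have := cmc_op_boundary sv Sy; rewrite cmc_op0 -/(dEta v 0 y) => E.
have m2 : 8 * m ^+ 2 != 0 by rewrite mulf_neq0 ?pnatr_eq0// expf_neq0// gt_eqF.
by rewrite -/(dEta v 0 y) -[LHS](mulVKf m2) E; ring.
Qed.

Lemma determined_inv_radius n : det n (fun _ s _ => inv_radius m s).
Proof.
exact: (dmul (dcst (2 * m)^-1) (dsub (dcst 1) (dexp 2 (determined_eta_id sol_gt0 n)))).
Qed.

(** The equation makes the square of [cmc_op] a polynomial in [slope_factor]. For H
    nonzero the root has the boundary value 3 H; for H = 0 the operator vanishes. *)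
Lemma determined_cmc_op n : det n (fun v s y => slope_factor m v s y) ->
  det n (fun v s y => cmc_op m v s y).
Proof.
move=> dW.
have sC : smooth_field cmc_solution (fun v => cmc_op m v).
  by move=> eps v sv; apply: smooth_cmc_op; exact: sol_smooth sv.
have [H0|H0] := eqVneq H 0.
  apply: (determined_congr sol_gt0 sC _ (determined_cst sol_gt0 n 0)).
  by move=> eps v [_ _ E] s y se Sy; rewrite (E s y se Sy).2 H0 mulr0 mul0r.
apply: (determined_sqrt sol_gt0 (c := 3 * H)) => //.
- by rewrite mulf_neq0// pnatr_eq0.
- by move=> eps v sv y; exact: cmc_op_boundary sv.
apply: (determined_congr sol_gt0 _ _ (dmul (dcst (9 * H ^+ 2)) (dexp 3 dW))).
  by move=> eps v sv; apply: smooth_exp; exact: sC sv.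
move=> eps v [_ _ E] s y se Sy; have [W0 ->] := E s y se Sy.
have e2 : Num.sqrt (slope_factor m v s y) ^+ 2 = slope_factor m v s y.
  by rewrite sqr_sqrtr// ltW.
by rewrite -[in LHS]e2; ring.
Qed.

(** When p + 1 derivatives of v are known, [slope_factor] = 1 - s^2 Psi is known to
    order p + 2. In the equation all terms but the one in S = s v_ss + 2 v_s carry a
    factor s and are known to order p + 1; so S is, hence v_s. *)
Lemma determined_step p : det p.+1 id -> det p.+2 id.
Proof.
move=> dv; have dw : det p (fun v s y => dEta v s y) := determined_dEta dv.
have dS i : det p.+1 (fun v s y => dSph i v s y) := dsph i dv.
have dSp i : det p (fun v s y => dSph i v s y) := determinedW (dS i).
have dSS i : det p.+1 (fun v s y => dSph i (dSph i v) s y) :=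
  dsph i (dS i).
have dr n := determined_inv_radius n.
have raise n Phi : det n Phi -> det n.+1 (fun v s y => s * Phi v s y).
  exact: determined_eta.
pose Psi v s y := m ^+ 2 * inv_radius m s ^+ 4 * dEta v s y ^+ 2
     + inv_radius m s ^+ 2 * \sum_(i < 3) dSph i v s y ^+ 2.
have dP : det p Psi :=
  dadd (dmul (dmul (dcst (m ^+ 2)) (dexp 4 (dr p))) (dexp 2 dw))
    (dmul (dexp 2 (dr p)) (dsum (fun i => dexp 2 (dSp i)))).
have raise2 Phi : det p Phi -> det p.+2 (fun v s y => s ^+ 2 * Phi v s y).
  move=> d; apply: (determined_congr sol_gt0 _ _ (raise _ _ (raise _ _ d))).
    move=> eps v sv; apply: smooth_mul; last exact: (determined_smooth d) sv.
    by apply: smooth_exp; exact: smooth_eta.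
  by move=> *; rewrite expr2 mulrA.
have dW2 : det p.+2 (fun v s y => slope_factor m v s y) := dsub (dcst 1) (raise2 _ dP).
have dW : det p.+1 (fun v s y => slope_factor m v s y) := determinedW dW2.
have dWp : det p (fun v s y => slope_factor m v s y) := determinedW dW.
have dWe : det p.+1 (fun v s y => dEta (slope_factor m v) s y) := determined_dEta dW2.
have dWep : det p (fun v s y => dEta (slope_factor m v) s y) := determinedW dWe.
have dWS i : det p.+1 (fun v s y => dSph i (slope_factor m v) s y) :=
  dsph i dW.
have dE : det p.+1 (fun v s y => cmc_op m v s y) := determined_cmc_op dW.
pose S (v : R -> 'rV[R]_3 -> R) s y := s * dEta (dEta v) s y + 2 * dEta v s y.
have dS0 : det p S := dadd (determined_euler sol_gt0 dw) (dmul (dcst 2) dw).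
have dw1 : det p.+1 (fun v => dEta v).
  apply: (determined_fuchs sol_gt0 (k := 1)).
    by move=> eps v sv; apply: smooth_dEta; exact: sol_smooth sv.
  pose lead (v : R -> 'rV[R]_3 -> R) s (y : 'rV[R]_3) := m ^+ 2 * inv_radius m s ^+ 4.
  have dl n : det n lead := dmul (dcst (m ^+ 2)) (dexp 4 (dr n)).
  have sS : smooth_field cmc_solution S := determined_smooth dS0.
  apply: (@determined_cancel _ _ sol_gt0 _ lead S (m ^+ 2 * (2 * m)^-1 ^+ 4)) => //.
  - by rewrite mulf_neq0 ?expf_neq0 ?invr_neq0 ?mulf_neq0 ?pnatr_eq0 ?gt_eqF.
  - by move=> eps v sv y Sy; rewrite /lead /inv_radius expr0n subr0 mulr1.
  (* the terms of the equation other than lead * S *)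
  have dT1 := determinedW (raise2 _ (dmul dP (dmul (dl p) dS0))).
  have dT2 := determinedW (raise _ _ (dmul dW (dmul (dexp 2 (dr p.+1)) (dsum dSS)))).
  have dT3 := raise _ _ (dmul (dl p) (dmul dw dWep)).
  have dT4 := determinedW (raise _ _
    (dmul (dexp 2 (dr p.+1)) (dsum (fun i => dmul (dWS i) (dS i))))).
  have d := dadd (dsub (dadd dE dT1) dT2) (dmul (dcst 2^-1) (dadd dT3 dT4)).
  apply: (determined_congr sol_gt0 _ _ d).
    by move=> eps v sv; apply: smooth_mul; [exact: (determined_smooth (dl 0)) sv|exact: sS sv].
  move=> eps v sv s y se Sy.
  rewrite /lead /S /cmc_op.
  have -> : slope_factor m v s y = 1 - s ^+ 2 * Psi v s y by [].
  by ring.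
split; first by move=> eps v; exact: sol_smooth.
by split=> //; have [_ []] := dv.
Qed.

Lemma determined_solution n : det n id.
Proof.
suff [] : det n id /\ det n.+1 id by [].
elim: n => [|n [_ IH]]; last by split=> //; exact: determined_step.
have s0 : smooth_field cmc_solution id by move=> eps v; exact: sol_smooth.
split; first by [].
split=> //; split; first by exists (SphDeriv R [::]).
by split=> //; exact: smooth_field_dEta.
Qed.

End Recursion.

(** * The theorem *)

Section Congruence.
Variables (R : realType) (m a b : R) (u v : R -> 'rV[R]_3 -> R).
Hypothesis E : forall s y, a < s < b -> sphere y -> u s y = v s y.

Lemma dEta_congr_on s y : a < s < b -> sphere y -> dEta u s y = dEta v s y.
Proof. by move=> sab Sy; apply: (dEta_congr sab) => s' sab'; exact: E. Qed.

Lemma dSph_congr_on i s y : a < s < b -> sphere y -> dSph i u s y = dSph i v s y.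
Proof. by move=> sab Sy; apply: dSph_congr => // z Sz; exact: E. Qed.

End Congruence.

Lemma slope_factor_congr (R : realType) (m a b : R) u v :
  (forall s (y : 'rV[R]_3), a < s < b -> sphere y -> u s y = v s y) ->
  forall s y, a < s < b -> sphere y -> slope_factor m u s y = slope_factor m v s y.
Proof.
move=> E s y sab Sy; rewrite /slope_factor (dEta_congr_on E sab Sy).
by under eq_bigr do rewrite (dSph_congr_on E _ sab Sy).
Qed.

Lemma cmc_op_congr (R : realType) (m a b : R) u v :
  (forall s (y : 'rV[R]_3), a < s < b -> sphere y -> u s y = v s y) ->
  forall s y, a < s < b -> sphere y -> cmc_op m u s y = cmc_op m v s y.
Proof.
move=> E s y sab Sy; have EW := slope_factor_congr m E.
rewrite /cmc_op (EW s y sab Sy) (dEta_congr_on E sab Sy) (dEta_congr_on EW sab Sy).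
rewrite (dEta_congr_on (dEta_congr_on E) sab Sy).
have S1 : \sum_(i < 3) dSph i (dSph i u) s y = \sum_(i < 3) dSph i (dSph i v) s y.
  by apply: eq_bigr => i _; exact: (dSph_congr_on (dSph_congr_on E i) i sab Sy).
have S2 : \sum_(i < 3) dSph i (slope_factor m u) s y * dSph i u s y =
    \sum_(i < 3) dSph i (slope_factor m v) s y * dSph i v s y.
  apply: eq_bigr => i _.
  by rewrite (dSph_congr_on EW i sab Sy) (dSph_congr_on E i sab Sy).
move: S1 S2; generalize (\sum_(i < 3) dSph i (dSph i u) s y)
  (\sum_(i < 3) dSph i (slope_factor m u) s y * dSph i u s y) => A B.
by move=> -> ->.
Qed.

Lemma cmc_solution_extension (R : realType) (m eta0 H : R) u v :
  0 < m -> eta0 <= 1 -> smooth_cyl 0 eta0 u -> has_mean_curvature m eta0 u H ->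
  smooth_extension eta0 u v -> exists eps, cmc_solution m H eps v.
Proof.
move=> m0 eta01 su hu [eps [/andP[e0 ee] sv E]]; exists eps; split=> // s y se Sy.
rewrite (slope_factor_congr m E se Sy) (cmc_op_congr m E se Sy).
apply: (cmc_pde m0 eta01 su hu) => //.
by case/andP: se => -> /lt_le_trans ->.
Qed.

Theorem theorem4p1 (R : realType) (m H : R) (hm : 0 < m) :
  exists P : nat -> seq 'I_3 -> sph_expr R,
  forall (eta0 : R) (u : R -> 'rV[R]_3 -> R),
    0 < eta0 <= 1 ->
    smooth_cyl 0 eta0 u ->
    bounded_height eta0 u ->
    spacelike_graph m eta0 u ->
    has_mean_curvature m eta0 u H ->
    extends_across_bifurcation m eta0 u ->
  exists v : R -> 'rV[R]_3 -> R,
    [/\ smooth_extension eta0 u v,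
        forall (k : nat) (s : seq 'I_3) (y : 'rV[R]_3), sphere y ->
          sph_derivs s (fun z => derive1n k (v ^~ z) 0) y
          = sph_eval (P k s) (v 0) y
      & forall y : 'rV[R]_3, sphere y ->
          derive1 (v ^~ y) 0 = 24 * m ^+ 2 * H].
Proof.
have [e He] := choice (fun k => determined_boundary (determined_solution H hm k.+1) (ltnSn k)).
(* sphere derivatives of the k-th expression are taken formally *)
exists (fun k s => foldr (@sph_exprD R) (e k) s) => eta0 u /andP[eta00 eta01] su bu _ hu xu.
have [v ext] := smooth_extension_exists hm eta00 eta01 bu xu.
have [eps sol] := cmc_solution_extension hm eta01 su hu ext.
exists v; split=> // [k s y Sy|y Sy]; last exact: boundary_slope sol Sy.
have [e0 sv _] := sol.
apply: (sph_derivs_eval _ sv) => //; first by rewrite oppr_lt0 e0.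
by move=> z Sz; exact: (He k eps v sol z Sz).
Qed.
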